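(* Let $A_0$ be a continuous cumulative hazard function and let $c(\cdot)$ be a piecewise continuous, nonnegative function on $[0,\infty)$. Let $(\theta_i)_{i\ge1}$ be i.i.d. random variables with common distribution $\Pi$, and let $\Gamma_i=E_1+\cdots+E_i$, where $(E_i)_{i\ge1}$ are i.i.d. with exponential distribution with mean $1$, independent of $(\theta_i)_{i\ge1}$. Let $A\sim BP(c(\cdot),A_0(\cdot))$ (the beta process with parameters $c(\cdot)$ and $A_0(\cdot)$) on $[0,t_0]$, where $t_0>0$ is fixed. Assume that $A_0$ is continuous with $A_0(t_0)<\infty$. Let $\Pi(dz)=\eta(dz)/A_0(t_0)$, where $\eta([0,t])=A_0(t)$. Put $$L_{n,\theta}(x)=\frac{\Gamma(c(\theta))}{\Gamma(c(\theta)/n)\,\Gamma(c(\theta)-c(\theta)/n)}\int_x^1 s^{c(\theta)/n-1}(1-s)^{c(\theta)(1-1/n)-1}\,ds$$ and $$M_z(x)=A_0(t_0)\,c(z)\int_x^1 s^{-1}(1-s)^{c(z)-1}\,ds.$$ Then, as $n\to\infty$, $$A_n(t)=\sum_{i=1}^n L_{n,\theta_i}^{-1}\!\left(\frac{\Gamma_i}{A_0(t_0)\,n}\right)\delta_{\theta_i}\ \overset{v}{\longrightarrow}\ A(t)=\sum_{i=1}^\infty M_{\theta_i}^{-1}(\Gamma_i)\,\delta_{\theta_i}.$$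
   Context: $\Gamma(\cdot)$ with an argument is the Gamma function, while $\Gamma_i$ are the partial sums defined in the claim; $\delta_\theta$ is the Dirac measure at $\theta$. The same notation is used for a measure and for its distribution function. Vague convergence ($\overset{v}{\to}$): for measures $\mu,\mu_1,\mu_2,\ldots$ on $\mathbb{R}$ whose distribution functions $\mu(t)=\mu((-\infty,t])$ are finite for all $t\in\mathbb{R}$ and satisfy $\mu(-\infty)=0$, $\mu_n\overset{v}{\to}\mu$ means $\mu_n(t)\to\mu(t)$ for every $t\in\mathbb{R}$ at which $\mu$ is continuous. Inverses: $L_{n,\theta}^{-1}$ and $M_z^{-1}$ denote the inverse functions of the monotone functions $x\mapsto L_{n,\theta}(x)$ and $x\mapsto M_z(x)$; $L_{n,\theta}^{-1}(p)$ is the $(1-p)$-th quantile of the Beta$(c(\theta)/n,\,c(\theta)(1-1/n))$ distribution. Beta process: $A\sim BP(c(\cdot),A_0(\cdot))$ is the completely random measure with Lévy measure $L_t(ds)=\left[\int_0^t c(z)s^{-1}(1-s)^{c(z)-1}\,dA_0(z)\right]ds$ for $t\ge0$, $0<s<1$. The series $\sum_{i\ge1}M_{\theta_i}^{-1}(\Gamma_i)\delta_{\theta_i}$ is the Wolpert–Ickstadt representation of the beta process. *)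

(* Defs.v *)
From HB Require Import structures.
From mathcomp Require Import all_boot all_order all_algebra finmap.
From mathcomp Require Import all_classical all_reals all_analysis.
From mathcomp Require Import measurable_realfun.
Import Order.TTheory GRing.Theory Num.Theory.
Import numFieldNormedType.Exports.

Set Implicit Arguments.
Unset Strict Implicit.
Unset Printing Implicit Defensive.

Local Open Scope classical_set_scope.
Local Open Scope ring_scope.

(* A0 is only relevant on [0, +oo[; it may reach +oo. The requirement that the
   jumps of a cumulative hazard be at most 1 is void for a continuous one. *)
Definition continuous_cumulative_hazard (R : realType) (A0 : R -> \bar R) :=
  [/\ A0 0 = 0%E,
      {in `[0, +oo[ &, forall s t : R, s <= t -> (A0 s <= A0 t)%E} &
      {within `[0, +oo[, continuous A0}].

(* Finitely many discontinuities in bounded intervals, finite one-sided limits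
   everywhere; the value at a discontinuity is unconstrained. *)
Definition piecewise_continuous_halfline (R : realType) (c : R -> R) :=
  [/\ forall b : R, finite_set [set z | 0 < z <= b /\ ~ {for z, continuous c}],
      forall z : R, 0 <= z -> cvg (c x @[x --> z^'+]) &
      forall z : R, 0 < z -> cvg (c x @[x --> z^'-])].

Definition mutually_independent d (T : measurableType d) (R : realType)
    (P : probability T R) d' (T' : measurableType d') (I : choiceType)
    (X : I -> T -> T') :=
  forall (J : {fset I}) (C : I -> set T'), (forall i, measurable (C i)) ->
    P (\bigcap_(i in [set` J]) (X i @^-1` C i)) =
    (\prod_(i <- J) P (X i @^-1` C i))%E.

Definition dist_fun (R : realType) (mu : {measure set R -> \bar R}) (t : R) :
  \bar R := mu `]-oo, t]%classic.

Definition has_dist_fun (R : realType) (mu : {measure set R -> \bar R}) :=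
  (forall t : R, (dist_fun mu t < +oo)%E) /\
  dist_fun mu t @[t --> -oo] --> 0%E.

Definition vague_cvg (R : realType) (mu_ : nat -> {measure set R -> \bar R})
    (mu : {measure set R -> \bar R}) :=
  [/\ forall n, has_dist_fun (mu_ n), has_dist_fun mu &
      forall t : R, {for t, continuous (dist_fun mu)} ->
        dist_fun (mu_ n) t @[n --> \oo] --> dist_fun mu t].

(* Equal to 0 where the integral diverges, e.g. at a = 0. *)
Definition Gamma_fun (R : realType) (a : R) : R :=
  fine (\int[lebesgue_measure]_(s in `]0%R, +oo[)
    (s `^ (a - 1) * expR (- s))%:E)%E.

Definition beta_tail (R : realType) (c : R -> R) (n : nat) (z x : R) : \bar R :=
  ((Gamma_fun (c z) / (Gamma_fun (c z / n%:R) * Gamma_fun (c z - c z / n%:R)))%:E *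
   \int[lebesgue_measure]_(s in `[x, 1%R])
     (s `^ (c z / n%:R - 1) * (1 - s) `^ (c z * (1 - n%:R^-1) - 1))%:E)%E.

Definition levy_tail (R : realType) (c : R -> R) (a0 z x : R) : \bar R :=
  ((a0 * c z)%:E *
   \int[lebesgue_measure]_(s in `[x, 1%R])
     (s^-1 * (1 - s) `^ (c z - 1))%:E)%E.

(* Inverse of a nonincreasing function on [0, 1] vanishing at 1. For a
   continuous strictly decreasing f and p in its range, it is the solution x of
   f x = p; for f = 1 - F with F a distribution function on [0, 1], it is the
   quantile inf {x | F x >= 1 - p}. It is 0 when p exceeds all the values of f:
   for beta_tail when p > 1, and for both tails when c vanishes at z (they are
   then identically 0). *)
Definition tail_inv (R : realType) (f : R -> \bar R) (p : R) : R :=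
  inf [set x : R | 0 <= x <= 1 /\ (f x <= p%:E)%E].

Lemma tail_inv_ge0 (R : realType) (f : R -> \bar R) (p : R) : 0 <= tail_inv f p.
Proof.
rewrite /tail_inv; set S := [set _ | _].
have [->|S0] := eqVneq S set0; first by rewrite inf0.
by apply: lb_le_inf; [exact/set0P | move=> x [/andP[]]].
Qed.

Section random_measures.
Context d (T : measurableType d) (R : realType).
Implicit Types (c : R -> R) (theta E : nat -> T -> R) (w : T).

(* Indices start at 0: arrival E i is E_1 + ... + E_(i+1) in 1-based numbering. *)
Definition arrival E (i : nat) w : R := \sum_(j < i.+1) E j w.

Definition finite_beta_sum c (a0 : R) theta E (n : nat) w :
    {measure set R -> \bar R} :=
  msum (fun i => mscale
    (NngNum (tail_inv_ge0 (beta_tail c n (theta i w))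
                          (arrival E i w / (a0 * n%:R))))
    \d_(theta i w)) n.

Definition beta_series c (a0 : R) theta E w : {measure set R -> \bar R} :=
  mseries (fun i => mscale
    (NngNum (tail_inv_ge0 (levy_tail c a0 (theta i w)) (arrival E i w)))
    \d_(theta i w)) 0.

Definition levy_density c (eta : {measure set R -> \bar R}) (t s : R) :
    \bar R :=
  (\int[eta]_(z in `[0%R, t]) (c z * s^-1 * (1 - s) `^ (c z - 1))%:E)%E.

(* A is a completely random measure concentrated on [0, t0], with Levy measure
   L_t(ds) = levy_density c eta t s ds on ]0, 1[; eta is the measure with
   distribution function A0. *)
Record beta_process (P : probability T R) c (eta : {measure set R -> \bar R})
    (t0 : R) (A : T -> {measure set R -> \bar R}) : Prop := {
  beta_process_measurable : forall B : set R, measurable B ->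
    B `<=` `[0, t0] ->
    measurable_fun [set: T] (fun w => A w B) ;
  beta_process_support : {ae P, forall w, A w (~` `[0, t0]) = 0%E} ;
  beta_process_independent : forall B : nat -> set R,
    (forall k, measurable (B k)) -> (forall k, B k `<=` `[0, t0]) ->
    trivIset [set: nat] B ->
    mutually_independent P (fun k w => A w (B k)) ;
  beta_process_laplace : forall t u : R, 0 <= t <= t0 -> 0 <= u ->
    (\int[P]_w expeR (- (u%:E * A w `[0%R, t]%classic)) =
     expeR (- \int[lebesgue_measure]_(s in `]0%R, 1%R[)
                ((1 - expR (- (u * s)))%:E * levy_density c eta t s)))%E }.

End random_measures.

(* Main.v *)
Require Import Defs.
From HB Require Import structures.
From mathcomp Require Import all_boot all_order all_algebra finmap.
From mathcomp Require Import all_classical all_reals all_analysis.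
From mathcomp Require Import measurable_realfun.
From mathcomp Require Import ring lra.
Import Order.TTheory GRing.Theory Num.Theory.
Import numFieldNormedType.Exports.

(** Write M_z for the Levy tail at the mark z, L_(n,z) for the beta tail,
    S_1 < S_2 < ... for the arrival times, and k = c z. If k = 0 both tails and all
    atoms at z vanish; below k > 0.

    Convergence of the atoms. Since Gamma e = Gamma (1 + e) / e, the constant
    n Gamma(k) / (Gamma(k/n) Gamma(k - k/n)) tends to k, and the beta density with
    its constant removed tends to s^-1 (1 - s)^(k - 1); by domination
    a0 n L_(n,z) (x) tends to M_z (x) for 0 < x < 1 ([cvg_beta_tail]). As M_z is
    strictly decreasing on ]0, 1[, generalized inverses converge as well ([cvg_tail_inv]), so
    that each atom of the n-th sum tends to the corresponding atom of the series
    ([cvg_beta_tail_inv]).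

    Exchange of limit and sum. The bound 1 / s <= 1 / sqrt (x s) for s > x gives
    a0 n L_(n,z) (x) <= K / sqrt x with K depending only on a bound for c, hence
    atoms at most (K / S_i)^2 for all n >= 2 ([beta_tail_inv_le]). A piecewise
    continuous c is bounded on [0, t0] and almost surely S_i grows linearly
    ([ae_partial_time_growth]), so these bounds are summable and dominated
    convergence for series ([tannery]) gives the convergence of the distribution
    functions, at every t ([vague_cvg_beta]).

    Law of the limit. The points (theta_i, S_i) form a marked Poisson process, and
    for f >= 0 the Laplace functional E exp (- sum_i f (theta_i, S_i)) is
    exp (- int_0^oo E (1 - exp (- f (theta, x))) dx) ([laplace_marked_poisson]). The
    proof runs a discrete time martingale: the product of exp (- f) over the first
    n points times the Laplace functional of the future after S_n has constant
    expectation, by the renewal identity for exponential waiting times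
    ([renewal_equation]). For f (z, x) = v z * M_z^-1 (x), the change of variables
    x = M_z (s) turns the exponent into an integral against the Levy measure
    ([campbell_levy_tail]); v = u 1_[0, t] gives the Laplace transform of a beta
    process ([laplace_exponent_levy]). For v a combination of indicators of disjoint
    sets B_j the exponent is a sum over j, so the joint moments of the variables
    exp (- A (B_j)) factor. These variables take values in [0, 1], where moments
    determine laws, and independence follows ([moments_independent]). *)

Set Implicit Arguments.
Unset Strict Implicit.
Unset Printing Implicit Defensive.

Local Open Scope classical_set_scope.
Local Open Scope ring_scope.

(** * Integrals of powers and the Gamma function *)

Section integrals_of_powers.
Context {R : realType}.
Notation mu := (@lebesgue_measure R).

(** The antiderivative is only required to have one-sided limits at the ends, so
    that integrands unbounded at an end point are covered: exhaust the open
    interval by compact ones and pass to the limit monotonically. *)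
Lemma integral_ge0_FTC_oo (f F : R -> R) (a b : R) : a < b ->
  (forall x, a < x < b -> 0 <= f x) ->
  {in `]a, b[, continuous f} ->
  {in `]a, b[, forall x, derivable F x 1} -> {in `]a, b[, F^`()%classic =1 f} ->
  F x @[x --> a^'+] --> F a -> F x @[x --> b^'-] --> F b ->
  (\int[mu]_(x in `]a, b[) (f x)%:E = (F b - F a)%:E)%E.
Proof.
move=> ab f0 cf dF F'f Fa Fb.
pose e n : R := (b - a) / n.+3%:R.
have e0 n : 0 < e n by rewrite divr_gt0// subr_gt0.
have e_lt n : a + e n < b - e n.
  have n3 : n.+3%:R != 0 :> R by rewrite pnatr_eq0.
  rewrite -subr_gt0 (_ : _ - _ = (b - a) * (1 - 2 / n.+3%:R)); last first.
    by rewrite /e; move: (n.+3%:R) n3 => k k0; field.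
  by rewrite mulr_gt0 ?subr_gt0// ltr_pdivrMr// mul1r ltr_nat.
have e_cvg : e n @[n --> \oo] --> 0.
  rewrite -(mulr0 (b - a)); apply: cvgMr.
  apply: (@cvg_comp _ _ _ (addn 2) (fun n : nat => n.+1%:R^-1) _ \oo).
    exact: cvg_addnl.
  exact: cvg_harmonic.
have e_le m n : (m <= n)%N -> e n <= e m.
  move=> mn; rewrite ler_pM2l ?subr_gt0// lef_pV2 ?posrE// ler_nat.
  by rewrite !ltnS.
pose G n := `[a + e n, b - e n]%classic.
have GE : \bigcup_n G n = `]a, b[%classic.
  apply/seteqP; split => x /=.
    move=> [n _]; rewrite /G/= !in_itv/= => /andP[h1 h2].
    by have := e0 n; move=> ?; apply/andP; split; lra.
  rewrite in_itv/= => /andP[ax xb].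
  have m0 : 0 < Num.min (x - a) (b - x) by rewrite lt_min !subr_gt0 ax xb.
  move/cvgrPdist_lt : e_cvg => /(_ _ m0)[n _ /(_ n (leqnn n))]/=.
  rewrite sub0r normrN gtr0_norm// lt_min => /andP[h1 h2].
  by exists n => //; rewrite /G/= in_itv/=; apply/andP; split; lra.
have Gsub n x : x \in `[a + e n, b - e n] -> a < x < b.
  rewrite in_itv/= => /andP[h1 h2].
  by have := e0 n; move=> ?; apply/andP; split; lra.
have intG n : (\int[mu]_(x in G n) (f x)%:E =
    (F (b - e n))%:E - (F (a + e n))%:E)%E.
  apply: continuous_FTC2 => //.
  - apply: continuous_in_subspaceT => x; rewrite inE => /Gsub h.
    by apply: cf; rewrite in_itv.
  - have cF x : a < x < b -> {for x, continuous F}.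
      move=> h; apply: differentiable_continuous.
      by apply/derivable1_diffP/dF; rewrite in_itv.
    split.
    + move=> x; rewrite in_itv/= => /andP[h1 h2].
      by apply: dF; rewrite in_itv/=; have := e0 n; move=> ?; apply/andP; split; lra.
    + apply/cvg_at_right_filter/cF.
      by have := e0 n; have := e_lt n; move=> ? ?; apply/andP; split; lra.
    + apply/cvg_at_left_filter/cF.
      by have := e0 n; have := e_lt n; move=> ? ?; apply/andP; split; lra.
  - move=> x; rewrite in_itv/= => /andP[h1 h2].
    by apply: F'f; rewrite in_itv/=; have := e0 n; move=> ?; apply/andP; split; lra.
have : (\int[mu]_(x in G n) (f x)%:E @[n --> \oo] -->
    \int[mu]_(x in \bigcup_n G n) (f x)%:E)%E.
  apply: ge0_nondecreasing_set_cvg_integral.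
  - move=> m n mn; apply/subsetPset => x; rewrite /G/= !in_itv/=.
    by have := e_le _ _ mn; move=> ? /andP[? ?]; apply/andP; split; lra.
  - by move=> n; exact: measurable_itv.
  - move=> n; apply/measurable_EFinP.
    apply: (@measurable_funS _ _ _ _ `]a, b[%classic) => //.
      by move=> x /Gsub/=; rewrite in_itv.
    apply: open_continuous_measurable_fun => // x.
    by rewrite inE => h; exact: cf.
  - by move=> n x /Gsub h; rewrite lee_fin f0.
rewrite GE => h.
suff h2 : (\int[mu]_(x in G n) (f x)%:E @[n --> \oo] --> (F b - F a)%:E)%E.
  exact: (cvg_unique _ h h2).
under eq_fun do rewrite intG -EFinB.
apply: cvg_EFin; first by near=> n.
apply: (@cvgB _ R^o).
- move/cvg_at_leftP : Fb; apply; split => [n|].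
    by rewrite ltrBlDr ltrDl.
  by rewrite -[X in _ --> X]subr0; apply: cvgB => //; exact: cvg_cst.
- move/cvg_at_rightP : Fa; apply; split => [n|].
    by rewrite ltrDl.
  by rewrite -[X in _ --> X]addr0; apply: cvgD => //; exact: cvg_cst.
Unshelve. all: by end_near. Qed.

Lemma continuous_powRl (a x : R) : 0 < x ->
  {for x, continuous (fun s : R => s `^ a)}.
Proof.
move=> x0; apply: differentiable_continuous; apply/derivable1_diffP.
by apply: derivable_powR; rewrite in_itv/= x0.
Qed.

Lemma integral_powR (a b : R) : 0 < a -> 0 < b ->
  (\int[mu]_(s in `]0%R, b[) (s `^ (a - 1))%:E = (b `^ a / a)%:E)%E.
Proof.
move=> a0 b0.
have a_neq0 : a != 0 by rewrite gt_eqF.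
rewrite (@integral_ge0_FTC_oo _ (fun s => s `^ a / a))//.
- by rewrite powR0// mul0r subr0.
- by move=> x _; exact: powR_ge0.
- move=> x; rewrite in_itv/= => /andP[x0 _].
  exact: continuous_powRl.
- move=> x; rewrite in_itv/= => /andP[x0 _].
  apply: derivableM => //; apply: derivable_powR; by rewrite in_itv/= x0.
- move=> x; rewrite in_itv/= => /andP[x0 _]; rewrite derive1E.
  have h := is_derive1_powR a x0.
  apply: derive_val; apply: is_derive_eq; rewrite scaler0 add0r.
  by rewrite -[_ *: _]/(_ * _) mulrA mulVf// mul1r.
- rewrite powR0//; apply: cvgMl; exact: powR_cvg0.
- apply: cvg_at_left_filter.
  by apply: cvgMl; exact: continuous_powRl.
Qed.

Lemma integral_onem_powR (c x : R) : 0 < c -> x < 1 ->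
  (\int[mu]_(s in `]x, 1%R[) ((1 - s) `^ (c - 1))%:E = ((1 - x) `^ c / c)%:E)%E.
Proof.
move=> c0 x1.
have c_neq0 : c != 0 by rewrite gt_eqF.
have dp (a s : R) : s < 1 ->
    is_derive s 1 (fun s => (1 - s) `^ a) (- (a * (1 - s) `^ (a - 1))).
  move=> s1; have s0 : 0 < 1 - s by rewrite subr_gt0.
  have h1 := is_derive1_powR a s0.
  have h2 : is_derive s 1 (fun s : R => 1 - s) (-1).
    split; first exact: derivableB.
    by rewrite deriveB// derive_cst derive_id sub0r.
  have := @is_derive1_comp _ (fun s : R => s `^ a) (fun s => 1 - s) s _ _ h1 h2.
  by move=> h; apply: is_derive_eq; rewrite mulrN1.
rewrite (@integral_ge0_FTC_oo _ (fun s => - ((1 - s) `^ c / c)))//.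
- by rewrite subrr powR0// mul0r oppr0 sub0r opprK.
- by move=> s _; exact: powR_ge0.
- move=> s; rewrite in_itv/= => /andP[_ s1].
  apply: differentiable_continuous; apply/derivable1_diffP.
  by have := dp (c - 1) s s1 => h; exact: ex_derive.
- move=> s; rewrite in_itv/= => /andP[_ s1]; have h := dp c s s1.
  by apply: derivableN; apply: derivableM.
- move=> s; rewrite in_itv/= => /andP[_ s1]; rewrite derive1E.
  have h := dp c s s1.
  apply: derive_val; apply: is_derive_eq.
  rewrite scaler0 add0r -[_ *: _]/(_ * _).
  by field.
- apply: cvg_at_right_filter; apply: cvgN; apply: cvgMl.
  suff : {for x, continuous (fun s : R => (1 - s) `^ c)} by [].
  apply: differentiable_continuous; apply/derivable1_diffP.
  by have h := dp c x x1; exact: ex_derive.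
- rewrite subrr powR0// mul0r oppr0.
  rewrite -[X in _ --> X]oppr0; apply: cvgN.
  rewrite -[X in _ --> X](mul0r c^-1); apply: cvgMl.
  have /cvg_at_rightP h := @powR_cvg0 R c c0.
  apply/cvg_at_leftP => u [u1 ucvg].
  apply: (h (fun n => 1 - u n)); split => [n|]; first by rewrite subr_gt0.
  by rewrite -[X in _ --> X](subrr 1); apply: cvgB => //; exact: cvg_cst.
Qed.

Lemma integral_expRN (x : R) :
  (\int[mu]_(s in `]x, +oo[) (expR (- s))%:E = (expR (- x))%:E)%E.
Proof.
have dexp (s : R) : is_derive s 1 (fun s : R => - expR (- s)) (expR (- s)).
  have h1 := is_derive_expR (- s).
  have h2 : is_derive s 1 (fun s : R => - s) (-1).
    by split; [exact: derivableN|rewrite deriveN// derive_id].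
  have := @is_derive1_comp _ expR (fun s => - s) s _ _ h1 h2 => h.
  split; first by apply: derivableN; exact: ex_derive.
  rewrite deriveN; last exact: ex_derive.
  by rewrite (@derive_val _ _ _ _ _ _ _ h) mulrN1 opprK.
have cexp : continuous (fun s : R => expR (- s)).
  move=> s; apply: continuous_comp; last exact: continuous_expR.
  exact: opp_continuous.
rewrite integral_itv_obnd_cbnd; last first.
  by apply/measurable_EFinP; apply: measurable_funTS; exact: continuous_measurable_fun.
rewrite (@ge0_continuous_FTC2y _ _ (fun s => - expR (- s)) _ 0)//.
- by rewrite sub0e EFinN oppeK.
- exact: continuous_subspaceT.
- rewrite -[X in _ --> X]oppr0; apply: cvgN; exact: cvgr_expR.
- by apply: cvgN; apply: cvg_at_right_filter; exact: cexp.
- by move=> s _; rewrite derive1E; apply: derive_val.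
Qed.

(** Tonelli over the triangle r < s. It replaces integration by parts wherever
    the boundary terms would have to be discussed. *)
Lemma tonelli_triangle (A : set R) (f g : R -> \bar R) : measurable A ->
  measurable_fun A f -> measurable_fun A g ->
  (forall x, A x -> 0 <= f x)%E -> (forall x, A x -> 0 <= g x)%E ->
  (\int[mu]_(s in A) (f s * \int[mu]_(r in A `&` `]-oo, s[) g r) =
   \int[mu]_(r in A) (g r * \int[mu]_(s in A `&` `]r, +oo[) f s))%E.
Proof.
move=> mA mf mg f0 g0.
pose f' := (f \_ A)%E; pose g' := (g \_ A)%E.
have mf' : measurable_fun setT f' by apply/(measurable_restrictT f).
have mg' : measurable_fun setT g' by apply/(measurable_restrictT g).
have f'0 x : (0 <= f' x)%E by apply: erestrict_ge0.
have g'0 x : (0 <= g' x)%E by apply: erestrict_ge0.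
pose GR := measurableTypeR R.
pose D := [set p : GR * GR | p.2 < p.1 :> R].
have mD : measurable D.
  have /(_ _ [set true]) := @measurable_fun_ltr _ (GR * GR)%type R setT snd fst
    measurable_snd measurable_fst.
  by move=> /(_ measurableT I); rewrite setTI.
pose h (p : GR * GR) := (f' p.1 * g' p.2 * (\1_D p)%:E)%E.
have mh : measurable_fun setT h.
  apply: emeasurable_funM.
    by apply: emeasurable_funM; apply: measurableT_comp.
  by apply/measurable_EFinP.
have h0 p : (0 <= h p)%E by rewrite !mule_ge0// lee_fin.
have hE (s r : R) : h (s, r) = if r < s then (f' s * g' r)%E else 0%E.
  rewrite /h indicE (_ : (_ \in D) = (r < s)); last first.
    by apply/idP/idP; rewrite in_setE.
  by case: (r < s); rewrite ?mule1 ?mule0.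
have patchI (k : R -> \bar R) (B : set R) x :
    (k \_ (A `&` B))%E x = if x \in B then (k \_ A)%E x else 0%E.
  by rewrite !patchE in_setI; case: (x \in A); case: (x \in B).
transitivity (\int[mu]_s \int[mu]_r h (s, r))%E; last first.
  rewrite (fubini_tonelli h)//; apply/esym.
  rewrite integral_mkcond; apply: eq_integral => r _; rewrite patchE.
  case: ifPn => [rA|rA]; last first.
    apply/esym/integral0_eq => s _; rewrite hE /g' patchE (negbTE rA) mule0.
    by case: ifP.
  rewrite integral_mkcond -ge0_integralZl//; last 3 first.
  - apply/(measurable_restrictT f); first exact: measurableI.
    by apply: measurable_funS mf => // x [].
  - by move=> s _; apply: erestrict_ge0 => x [/f0].
  - by apply: g0; exact/set_mem.
  apply: eq_integral => s _; rewrite hE patchI mem_setE in_itv/= andbT.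
  by case: ifP => _; rewrite ?mule0// /g' patchE rA muleC.
rewrite integral_mkcond; apply: eq_integral => s _; rewrite patchE.
case: ifPn => [sA|sA]; last first.
  apply/esym/integral0_eq => r _; rewrite hE /f' patchE (negbTE sA) mul0e.
  by case: ifP.
rewrite integral_mkcond -ge0_integralZl//; last 3 first.
- apply/(measurable_restrictT g); first exact: measurableI.
  by apply: measurable_funS mg => // x [].
- by move=> r _; apply: erestrict_ge0 => x [/g0].
- by apply: f0; exact/set_mem.
apply: eq_integral => r _; rewrite hE patchI mem_setE in_itv/=.
by case: ifP => _; rewrite ?mule0// /f' patchE sA.
Qed.

(** Shifting the exponent by one removes the singularity at 0: everything below is
    about Gamma at 1 + b with b nonnegative, where domination is easy, and
    [Gamma_funE] comes back to small arguments. *)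
Definition Gamma_integrand (b s : R) : R := s `^ b * expR (- s).

Lemma measurable_Gamma_integrand b (D : set R) :
  measurable_fun D (Gamma_integrand b).
Proof.
apply: measurable_funTS; apply: measurable_funM; first exact: measurable_powR.
exact: measurableT_comp.
Qed.

Lemma measurable_EFin_Gamma_integrand b (D : set R) :
  measurable_fun D (fun s => (Gamma_integrand b s)%:E).
Proof. by apply/measurable_EFinP; exact: measurable_Gamma_integrand. Qed.

(** The functional equation of Gamma: write s ^ a as the integral of
    a r ^ (a - 1) over r < s and exchange the two integrals. *)
Lemma Gamma_integralS (a : R) : 0 < a ->
  (\int[mu]_(s in `]0%R, +oo[) (s `^ a * expR (- s))%:E =
   a%:E * \int[mu]_(s in `]0%R, +oo[) (s `^ (a - 1) * expR (- s))%:E)%E.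
Proof.
move=> a0.
pose A : set R := `]0%R, +oo[%classic.
have mA : measurable A by exact: measurable_itv.
have mpow b : measurable_fun A (fun s : R => (s `^ b)%:E).
  apply/measurable_EFinP/measurable_funTS; exact: measurable_powR.
have mexp : measurable_fun A (fun s : R => (expR (- s))%:E).
  exact/measurable_EFinP/measurable_funTS/measurableT_comp.
have := @tonelli_triangle A (fun s => (expR (- s))%:E)
  (fun s => (s `^ (a - 1))%:E) mA mexp (mpow _).
move=> H.
have {H} : (\int[mu]_(s in `]0%R, +oo[) ((s `^ a * expR (- s))%:E * (a^-1)%:E) =
   \int[mu]_(s in `]0%R, +oo[) (s `^ (a - 1) * expR (- s))%:E)%E.
  transitivity (\int[mu]_(s in `]0%R, +oo[) ((expR (- s))%:E *
     \int[mu]_(r in `]0%R, +oo[ `&` `]-oo, s[) (r `^ (a - 1))%:E))%E.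
    apply: eq_integral => s; rewrite inE/= in_itv/= andbT => s0.
    have -> : `]0%R, +oo[ `&` `]-oo, s[ = `]0%R, s[%classic :> set R.
      by apply/seteqP; split => x /=; rewrite !in_itv/= ?andbT; [case=> -> ->|case/andP].
    rewrite integral_powR// -!EFinM; congr EFin; ring.
  rewrite H; last 2 first.
  - by move=> x _; rewrite lee_fin expR_ge0.
  - by move=> x _; rewrite lee_fin powR_ge0.
  apply: eq_integral => r; rewrite inE /A/= in_itv/= andbT => r0.
  have -> : `]0%R, +oo[ `&` `]r, +oo[ = `]r, +oo[%classic :> set R.
    apply/seteqP; split => x /=; rewrite !in_itv/= ?andbT; [by case|move=> rx].
    by split => //; exact: lt_trans rx.
  by rewrite integral_expRN EFinM.
move=> <-; rewrite ge0_integralZr//; last 3 first.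
- exact: (measurable_EFin_Gamma_integrand a).
- by move=> x _; rewrite lee_fin mulr_ge0 ?powR_ge0 ?expR_ge0.
- by rewrite lee_fin invr_ge0 ltW.
by rewrite muleCA -EFinM mulfV ?gt_eqF// mule1.
Qed.


Lemma Gamma_integrand_ge0 b s : 0 <= Gamma_integrand b s.
Proof. by rewrite mulr_ge0 ?powR_ge0 ?expR_ge0. Qed.

(** A power with exponent between 0 and C is at most 1 before 1 and at most the
    C-th power after 1; this is the dominating function for the continuity of
    Gamma in its argument. *)
Lemma Gamma_integrand_le (b C s : R) : 0 <= b <= C -> 0 <= s ->
  Gamma_integrand b s <= Gamma_integrand 0 s + Gamma_integrand C s.
Proof.
move=> /andP[b0 bC] s0; rewrite /Gamma_integrand -mulrDl ler_wpM2r ?expR_ge0//.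
rewrite powRr0; have [s1|s1] := leP 1 s.
  by rewrite (le_trans (ler_powR s1 bC))// lerDr.
have [->|sn0] := eqVneq s 0.
  rewrite (@le_trans _ _ 1)//; last by rewrite lerDl powR_ge0.
  by rewrite /powR eqxx lern1 leq_b1.
rewrite (@le_trans _ _ 1)//; last by rewrite lerDl powR_ge0.
have s01 : 0 < s <= 1 by rewrite lt_neqAle eq_sym sn0 s0 ltW.
by rewrite -[leRHS](powRr0 s); exact: ger_powR.
Qed.

Lemma Gamma_integral0 :
  (\int[mu]_(s in `]0%R, +oo[) (Gamma_integrand 0 s)%:E = 1)%E.
Proof.
under eq_integral do rewrite /Gamma_integrand powRr0 mul1r.
by rewrite integral_expRN oppr0 expR0.
Qed.

Lemma Gamma_integral_nat_lty (n : nat) :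
  (\int[mu]_(s in `]0%R, +oo[) (Gamma_integrand n%:R s)%:E < +oo)%E.
Proof.
elim: n => [|n IH]; first by rewrite Gamma_integral0 ltry.
rewrite Gamma_integralS// -natr1 addrK.
rewrite lte_mul_pinfty//.
Qed.

Lemma Gamma_integrand_integrable (b : R) : 0 <= b ->
  mu.-integrable `]0%R, +oo[ (EFin \o Gamma_integrand b).
Proof.
move=> b0; apply/integrableP; split.
  by apply/measurable_EFinP; apply: measurable_Gamma_integrand.
under eq_integral => s _ do
  rewrite /= ger0_norm ?Gamma_integrand_ge0//.
have [N bN] : exists N : nat, b <= N%:R.
  by exists (Num.truncn b).+1; rewrite ltW// truncnS_gt.
apply: (@le_lt_trans _ _ (\int[mu]_(s in `]0%R, +oo[) ((Gamma_integrand 0 s)%:E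
   + (Gamma_integrand N%:R s)%:E))%E).
  apply: ge0_le_integral => //.
  - by move=> s _; rewrite lee_fin Gamma_integrand_ge0.
  - exact: measurable_EFin_Gamma_integrand.
  - by apply: emeasurable_funD; exact: measurable_EFin_Gamma_integrand.
  - move=> s; rewrite /= in_itv/= andbT => /ltW s0; rewrite -EFinD lee_fin.
    by apply: Gamma_integrand_le => //; rewrite b0.
rewrite ge0_integralD//.
- by rewrite Gamma_integral0 lte_add_pinfty ?ltry// Gamma_integral_nat_lty.
- by move=> s _; rewrite lee_fin Gamma_integrand_ge0.
- exact: measurable_EFin_Gamma_integrand.
- by move=> s _; rewrite lee_fin Gamma_integrand_ge0.
- exact: measurable_EFin_Gamma_integrand.
Qed.

Lemma EFin_Gamma_fun1D (b : R) : 0 <= b ->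
  (Gamma_fun (1 + b))%:E = (\int[mu]_(s in `]0%R, +oo[) (Gamma_integrand b s)%:E)%E.
Proof.
move=> b0; rewrite /Gamma_fun addrAC subrr add0r fineK//.
by have := integrable_fin_num _ (Gamma_integrand_integrable b0); apply.
Qed.

Lemma Gamma_funE (a : R) : 0 < a -> Gamma_fun a = Gamma_fun (1 + a) / a.
Proof.
move=> a0; have an0 : a != 0 by rewrite gt_eqF.
apply/eqP; rewrite eq_sym (can2_eq (mulfVK an0) (mulfK an0)) mulrC; apply/eqP.
have := EFin_Gamma_fun1D (ltW a0); rewrite Gamma_integralS//.
rewrite {3}/Gamma_fun; set I := (\int[_]_(_ in _) _)%E => h.
have : I \is a fin_num.
  have : (a%:E * I)%E \is a fin_num by rewrite -h.
  have : (0 <= I)%E.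
    by apply: integral_ge0 => s _; rewrite lee_fin Gamma_integrand_ge0.
  case: I {h} => //=; by rewrite gt0_muley.
by move: h => /[swap] /fineK <- /eqP; rewrite -EFinM eqe => /eqP.
Qed.

(** Only the part of the integral beyond 1 is kept, where the power is at least
    1; the bound does not depend on b. *)
Lemma Gamma_fun1D_ge (b : R) : 0 <= b -> expR (- 1) <= Gamma_fun (1 + b).
Proof.
move=> b0; rewrite -lee_fin EFin_Gamma_fun1D//.
rewrite -integral_expRN.
apply: (@le_trans _ _ (\int[mu]_(s in `]1%R, +oo[) (Gamma_integrand b s)%:E)%E).
  apply: ge0_le_integral => //.
  - exact/measurable_EFinP/measurable_funTS/measurableT_comp.
  - exact: measurable_EFin_Gamma_integrand.
  - move=> s; rewrite /= in_itv/= andbT => s1; rewrite lee_fin.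
    rewrite ler_peMl ?expR_ge0// -[leLHS](powRr0 s).
    exact: (ler_powR (ltW s1)).
apply: ge0_subset_integral => //.
- exact: measurable_EFin_Gamma_integrand.
- by move=> s _; rewrite lee_fin Gamma_integrand_ge0.
- by move=> s /=; rewrite !in_itv/= !andbT; exact: lt_trans.
Qed.

Lemma Gamma_fun1D_le (b C : R) : 0 <= b <= C ->
  Gamma_fun (1 + b) <= 1 + Gamma_fun (1 + C).
Proof.
move=> /andP[b0 bC]; have C0 := le_trans b0 bC.
rewrite -lee_fin EFinD !EFin_Gamma_fun1D//.
rewrite -Gamma_integral0 -ge0_integralD//; last 4 first.
- by move=> s _; rewrite lee_fin Gamma_integrand_ge0.
- exact: measurable_EFin_Gamma_integrand.
- by move=> s _; rewrite lee_fin Gamma_integrand_ge0.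
- exact: measurable_EFin_Gamma_integrand.
apply: ge0_le_integral => //.
- by move=> s _; rewrite lee_fin Gamma_integrand_ge0.
- exact: measurable_EFin_Gamma_integrand.
- by apply: emeasurable_funD; exact: measurable_EFin_Gamma_integrand.
- move=> s; rewrite /= in_itv/= andbT => /ltW s0; rewrite -EFinD lee_fin.
  by apply: Gamma_integrand_le => //; rewrite b0.
Qed.

Lemma cvg_Gamma_fun1D (b_ : R^nat) (b C : R) :
  (forall n, 0 <= b_ n <= C) -> 0 <= b -> b_ n @[n --> \oo] --> b ->
  Gamma_fun (1 + b_ n) @[n --> \oo] --> Gamma_fun (1 + b).
Proof.
move=> b_C b0 b_b.
have C0 : 0 <= C by have /andP[] := b_C 0%N; exact: le_trans.
suff : (\int[mu]_(s in `]0%R, +oo[) (Gamma_integrand (b_ n) s)%:E @[n --> \oo]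
   --> \int[mu]_(s in `]0%R, +oo[) (Gamma_integrand b s)%:E)%E.
  rewrite -EFin_Gamma_fun1D//; under eq_fun => n.
    by rewrite -EFin_Gamma_fun1D; [over|have /andP[] := b_C n].
  by move/fine_cvg.
apply: (@dominated_cvg _ _ _ mu `]0%R, +oo[%classic (measurable_itv _)
   (fun n s => (Gamma_integrand (b_ n) s)%:E)
   (fun s => (Gamma_integrand b s)%:E)
   (EFin \o (fun s => Gamma_integrand 0 s + Gamma_integrand C s))) => //=.
- by move=> n; exact: measurable_EFin_Gamma_integrand.
- move=> s; rewrite in_itv/= andbT => s0; apply: cvg_EFin; first by near=> n.
  apply: cvgMl; rewrite /powR gt_eqF//; apply: continuous_cvg.
    exact: continuous_expR.
  exact: cvgMl.
- rewrite (_ : EFin \o _ = ((EFin \o Gamma_integrand 0) \+ (EFin \o Gamma_integrand C))%E)//.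
  by apply: integrableD => //; exact: Gamma_integrand_integrable.
- move=> n s; rewrite in_itv/= andbT => s0.
  rewrite ger0_norm ?Gamma_integrand_ge0// lee_fin.
  by apply: Gamma_integrand_le => //; exact: ltW.
Unshelve. all: by end_near. Qed.

End integrals_of_powers.

(** * Beta densities with parameters of order 1/n *)

Section beta_tail_asymptotics.
Context {R : realType}.
Notation mu := (@lebesgue_measure R).

Lemma Gamma_fun_ge0 (a : R) : 0 <= Gamma_fun a.
Proof.
apply: fine_ge0; apply: integral_ge0 => s _.
by rewrite lee_fin mulr_ge0 ?powR_ge0 ?expR_ge0.
Qed.

(** The normalising constant of the beta law of parameters k / n and k - k / n. *)
Definition beta_coef (k : R) (n : nat) : R :=
  Gamma_fun k / (Gamma_fun (k / n%:R) * Gamma_fun (k - k / n%:R)).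

Definition beta_density (k : R) (n : nat) (s : R) : R :=
  s `^ (k / n%:R - 1) * (1 - s) `^ (k * (1 - n%:R^-1) - 1).

(** The limit of n times the beta density, up to the factor k: the jump intensity
    of the beta process. *)
Definition levy_kernel (k s : R) : R := s^-1 * (1 - s) `^ (k - 1).

Lemma beta_coef_ge0 k n : 0 <= beta_coef k n.
Proof. by rewrite divr_ge0 ?mulr_ge0 ?Gamma_fun_ge0. Qed.

Lemma measurable_beta_density k n (D : set R) :
  measurable_fun D (fun s => (beta_density k n s)%:E).
Proof.
apply/measurable_EFinP/measurable_funTS/measurable_funM.
  exact: measurable_powR.
apply: (measurableT_comp (measurable_powR _)); exact: measurable_funB.
Qed.

Lemma measurable_invr : measurable_fun [set: R] (@GRing.inv R).
Proof.
rewrite (_ : @GRing.inv R = (fun s => s * (s ^+ 2) `^ (-1))).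
  apply: measurable_funM => //.
  apply: (measurableT_comp (measurable_powR _)); exact: exprn_measurable.
apply/funext => s; rewrite powR_inv1 ?sqr_ge0//.
have [->|s0] := eqVneq s 0; first by rewrite invr0 mul0r.
by rewrite expr2 invfM mulrA mulfV// mul1r.
Qed.

Lemma measurable_levy_kernel k (D : set R) :
  measurable_fun D (fun s => (levy_kernel k s)%:E).
Proof.
apply/measurable_EFinP/measurable_funTS/measurable_funM.
  exact: measurable_invr.
apply: (measurableT_comp (measurable_powR _)); exact: measurable_funB.
Qed.

Lemma beta_density_ge0 k n s : 0 <= beta_density k n s.
Proof. by rewrite mulr_ge0 ?powR_ge0. Qed.

Lemma levy_kernel_ge0 k s : 0 <= s -> 0 <= levy_kernel k s.
Proof. by move=> s0; rewrite mulr_ge0 ?powR_ge0 ?invr_ge0. Qed.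

Lemma integral_beta_density_oo k n (x y : R) :
  (\int[mu]_(s in `[x, y]) (beta_density k n s)%:E =
   \int[mu]_(s in `]x, y[) (beta_density k n s)%:E)%E.
Proof. by rewrite integral_itv_bndoo//; exact: measurable_beta_density. Qed.

Lemma integral_levy_kernel_oo k (x y : R) :
  (\int[mu]_(s in `[x, y]) (levy_kernel k s)%:E =
   \int[mu]_(s in `]x, y[) (levy_kernel k s)%:E)%E.
Proof. by rewrite integral_itv_bndoo//; exact: measurable_levy_kernel. Qed.

(** With e = k / n, the equations Gamma e = Gamma (1 + e) / e and
    Gamma (k - e) = Gamma (1 + (k - e)) / (k - e) absorb the factor n: the right-hand
    side has no singularity left as n grows. *)
Lemma natr_beta_coef (k : R) (n : nat) : 0 < k -> (2 <= n)%N ->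
  n%:R * beta_coef k n =
  (k - k / n%:R) * Gamma_fun (1 + k) /
    (Gamma_fun (1 + k / n%:R) * Gamma_fun (1 + (k - k / n%:R))).
Proof.
move=> k0 n2.
have n0 : 0 < n%:R :> R by rewrite ltr0n (leq_trans _ n2).
have e0 : 0 < k / n%:R by rewrite divr_gt0.
have d0 : 0 < k - k / n%:R.
  by rewrite subr_gt0 ltr_pdivrMr// ltr_pMr// ltr1n.
have G_neq0 b : 0 < b -> Gamma_fun (1 + b) != 0 :> R.
  by move=> b0; rewrite gt_eqF// (lt_le_trans _ (Gamma_fun1D_ge (ltW b0)))// expR_gt0.
rewrite /beta_coef (Gamma_funE k0) (Gamma_funE e0) (Gamma_funE d0).
move: (G_neq0 _ k0) (G_neq0 _ e0) (G_neq0 _ d0).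
have alg (N e d g1 g2 g3 : R) : N * e = k -> N != 0 -> e != 0 -> d != 0 ->
    g2 != 0 -> g3 != 0 ->
    N * (g1 / k / (g2 / e * (g3 / d))) = d * g1 / (g2 * g3).
  by move=> <- N_neq0 e_neq0 d_neq0 g20 g30; field; rewrite N_neq0 e_neq0 d_neq0 g20 g30.
move=> _ g2 g3; apply: alg => //; rewrite ?gt_eqF//.
by rewrite mulrC divfK// gt_eqF.
Qed.

(** The integral diverges at 0 and [fine] sends +oo to 0; hence the beta tails
    vanish identically where c does. *)
Lemma Gamma_fun0 : Gamma_fun 0 = 0 :> R.
Proof.
rewrite /Gamma_fun [X in fine X](_ : _ = +oo%E)//.
apply: eq_infty => A; pose a : R := expR (- 1) / (1 + `|A|).
have A0 : 0 < 1 + `|A| by rewrite ltr_pwDl.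
have a0 : 0 < a by rewrite divr_gt0// expR_gt0.
apply: (@le_trans _ _ (\int[mu]_(s in `]0%R, 1%R[)
    (Gamma_integrand (0 - 1) s)%:E)%E); last first.
  apply: ge0_subset_integral => //.
  - exact: measurable_EFin_Gamma_integrand.
  - by move=> s _; rewrite lee_fin Gamma_integrand_ge0.
  - by move=> s /=; rewrite !in_itv/= => /andP[->].
apply: (@le_trans _ _ (\int[mu]_(s in `]0%R, 1%R[)
    ((expR (- 1))%:E * (s `^ (a - 1))%:E))%E); last first.
  apply: ge0_le_integral => //.
  - by move=> s _; rewrite mule_ge0// lee_fin ?powR_ge0 ?expR_ge0.
  - apply: emeasurable_funM => //.
    by apply/measurable_EFinP/measurable_funTS; exact: measurable_powR.
  - exact: measurable_EFin_Gamma_integrand.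
  - move=> s /=; rewrite in_itv/= => /andP[s0 s1].
    rewrite -EFinM lee_fin mulrC ler_pM ?powR_ge0 ?expR_ge0//.
      by apply: ger_powR; [rewrite s0 ltW|rewrite lerD2r ltW].
    by rewrite ler_expR lerN2 ltW.
rewrite ge0_integralZl//; last 2 first.
- by apply/measurable_EFinP/measurable_funTS; exact: measurable_powR.
- by move=> s _; rewrite lee_fin powR_ge0.
rewrite integral_powR// powR1 -EFinM lee_fin /a div1r invf_div mulrC.
rewrite divfK ?gt_eqF ?expR_gt0//.
by rewrite (le_trans (ler_norm A))// lerDr.
Qed.

Lemma Gamma_fun1 : Gamma_fun (1 + 0) = 1 :> R.
Proof. by apply: EFin_inj; rewrite EFin_Gamma_fun1D// Gamma_integral0. Qed.

Lemma cvg_invn (k : R) : k / n.+2%:R @[n --> \oo] --> (0 : R).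
Proof.
rewrite -(mulr0 k); apply: cvgMr.
apply: (@cvg_comp _ _ _ (addn 1) (fun n : nat => n.+1%:R^-1) _ \oo).
  exact: cvg_addnl.
exact: cvg_harmonic.
Qed.

Lemma divn_ge0_le (k : R) (n : nat) : 0 <= k -> 0 <= k / n.+2%:R <= k / 2.
Proof.
by move=> k0; rewrite divr_ge0//= ler_wpM2l// lef_pV2 ?posrE// ler_nat.
Qed.

Lemma cvg_natr_beta_coef (k : R) : 0 < k ->
  n.+2%:R * beta_coef k n.+2 @[n --> \oo] --> k.
Proof.
move=> k0; rewrite (_ : (fun n => _) = (fun n =>
  (k - k / n.+2%:R) * Gamma_fun (1 + k) /
    (Gamma_fun (1 + k / n.+2%:R) * Gamma_fun (1 + (k - k / n.+2%:R))))); last first.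
  by apply/funext => n; rewrite natr_beta_coef.
have h := cvg_invn k.
have kd : k - k / n.+2%:R @[n --> \oo] --> k.
  by rewrite -[X in _ --> X]subr0; apply: cvgB => //; exact: cvg_cst.
have G1_neq0 : Gamma_fun (1 + k) != 0 :> R.
  by rewrite gt_eqF// (lt_le_trans _ (Gamma_fun1D_ge (ltW k0)))// expR_gt0.
rewrite [X in _ --> X](_ : _ =
    k * Gamma_fun (1 + k) / (Gamma_fun (1 + 0) * Gamma_fun (1 + k))); last first.
  by rewrite Gamma_fun1 mul1r mulfK.
apply: cvgM; first exact: cvgMl.
apply: cvgV; first by rewrite Gamma_fun1 mul1r.
apply: cvgM.
  apply: (@cvg_Gamma_fun1D _ _ _ k) => // n.
  have /andP[-> /le_trans] := divn_ge0_le n (ltW k0); apply.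
  by rewrite ler_pdivrMr// ler_peMr ?ler1n ?ltW.
apply: (@cvg_Gamma_fun1D _ _ _ k) => //; last exact: ltW.
move=> n; have /andP[] := divn_ge0_le n (ltW k0).
by move: (k / n.+2%:R) => e h0 h1; apply/andP; split; lra.
Qed.

Lemma beta_density_le_levy (k s : R) (n : nat) : 0 < k -> (2 <= n)%N ->
  0 < s < 1 ->
  beta_density k n s <= s^-1 * (1 - s) `^ (k * (1 - n%:R^-1) - 1).
Proof.
move=> k0 n2 /andP[s0 s1]; rewrite ler_wpM2r ?powR_ge0//.
rewrite -(powR_inv1 (ltW s0)); apply: ger_powR; first by rewrite s0 ltW.
by rewrite lerDr divr_ge0// ltW.
Qed.

Lemma half_exponent_le (k : R) (n : nat) : 0 < k -> (2 <= n)%N ->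
  k / 2 <= k * (1 - n%:R^-1).
Proof.
move=> k0 n2; rewrite ler_pM2l//.
have : n%:R^-1 <= 2^-1 :> R by rewrite lef_pV2 ?posrE ?ltr0n ?ler_nat// (leq_trans _ n2).
lra.
Qed.

Lemma cvg_integral_beta_density (k x : R) : 0 < k -> 0 < x < 1 ->
  (\int[mu]_(s in `[x, 1%R]) (beta_density k n.+2 s)%:E @[n --> \oo] -->
   \int[mu]_(s in `[x, 1%R]) (levy_kernel k s)%:E)%E.
Proof.
move=> k0 /andP[x0 x1].
under eq_fun do rewrite integral_beta_density_oo.
rewrite integral_levy_kernel_oo.
apply: (@dominated_cvg _ _ _ mu `]x, 1%R[%classic (measurable_itv _)
   (fun n s => (beta_density k n.+2 s)%:E)
   (fun s => (levy_kernel k s)%:E)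
   (fun s => (x^-1 * (1 - s) `^ (k / 2 - 1))%:E)) => //=.
- by move=> n; exact: measurable_beta_density.
- move=> s; rewrite in_itv/= => /andP[xs s1].
  have s0 := lt_trans x0 xs.
  apply: cvg_EFin; first by near=> n.
  have pc (a : R^nat) (b c : R) : 0 < b -> a n @[n --> \oo] --> c ->
      b `^ (a n) @[n --> \oo] --> b `^ c.
    move=> b0 ac; rewrite /powR gt_eqF//; apply: continuous_cvg.
      exact: continuous_expR.
    exact: cvgMl.
  rewrite /levy_kernel -(powR_inv1 (ltW s0)); apply: cvgM; apply: pc => //.
  + rewrite -[X in _ --> X](add0r (-1)); apply: cvgD; [exact: cvg_invn|exact: cvg_cst].
  + by rewrite subr_gt0.
  + apply: cvgB; last exact: cvg_cst.
    rewrite -[X in _ --> X]mulr1; apply: cvgMr.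
    rewrite -[X in _ --> X]subr0; apply: cvgB; first exact: cvg_cst.
    by have := cvg_invn 1; under eq_fun do rewrite mul1r.
- apply/integrableP; split.
    apply/measurable_EFinP/measurable_funTS/measurable_funM => //.
    apply: (measurableT_comp (measurable_powR _)); exact: measurable_funB.
  under eq_integral => s _ do
    rewrite /= ger0_norm ?mulr_ge0 ?powR_ge0 ?invr_ge0 ?(ltW x0)// EFinM.
  rewrite ge0_integralZl//.
  + by rewrite integral_onem_powR ?divr_gt0// -EFinM ltry.
  + apply/measurable_EFinP/measurable_funTS.
    apply: (measurableT_comp (measurable_powR _)); exact: measurable_funB.
  + by move=> s _; rewrite lee_fin powR_ge0.
  + by rewrite lee_fin invr_ge0 ltW.
- move=> n s; rewrite in_itv/= => /andP[xs s1].
  have s0 := lt_trans x0 xs.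
  rewrite ger0_norm ?beta_density_ge0// lee_fin.
  apply: (le_trans (beta_density_le_levy k0 _ _)); rewrite ?s0//.
  apply: ler_pM; rewrite ?invr_ge0 ?powR_ge0 ?(ltW s0)//.
    by rewrite lef_pV2 ?posrE// ltW.
  apply: ger_powR; first by rewrite subr_gt0 s1/= lerBlDr lerDl ltW.
  by rewrite lerD2r half_exponent_le.
Unshelve. all: by end_near. Qed.

(** The bound of the whole domination argument. As 1 / s is at most
    1 / (sqrt x * sqrt s) for s > x, what remains is integrable on ]0, 1[ with one
    factor singular at each end; cutting at 1/2 separates the two. *)
Lemma integral_beta_density_le (k x : R) (n : nat) : 0 < k -> (2 <= n)%N ->
  0 < x <= 1 ->
  (\int[mu]_(s in `[x, 1%R]) (beta_density k n s)%:E <=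
   ((Num.sqrt x)^-1 * (4 + 2 / (k - k / n%:R)))%:E)%E.
Proof.
move=> k0 n2 /andP[x0 x1]; rewrite integral_beta_density_oo.
have d0 : 0 < k - k / n%:R.
  by rewrite subr_gt0 ltr_pdivrMr ?ltr0n ?(leq_trans _ n2)// ltr_pMr// ltr1n.
set d := k - k / n%:R in d0 *.
have dE : k * (1 - n%:R^-1) = d by rewrite /d mulrBr mulr1.
pose g1 (s : R) := (2 * s `^ (2^-1 - 1))%:E.
pose g2 (s : R) := (2 * (1 - s) `^ (d - 1))%:E.
have mg1 (D : set R) : measurable_fun D g1.
  by apply/measurable_EFinP/measurable_funTS/measurable_funM.
have mg2 (D : set R) : measurable_fun D g2.
  apply/measurable_EFinP/measurable_funTS/measurable_funM => //.
  apply: (measurableT_comp (measurable_powR _)); exact: measurable_funB.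
have mg12 (D : set R) : measurable_fun D (fun s => g1 s + g2 s)%E.
  exact: emeasurable_funD.
have mc12 (D : set R) :
    measurable_fun D (fun s => ((Num.sqrt x)^-1)%:E * (g1 s + g2 s))%E.
  by apply: emeasurable_funM => //; exact: mg12.
have g10 s : (0 <= g1 s)%E by rewrite lee_fin mulr_ge0 ?powR_ge0.
have g20 s : (0 <= g2 s)%E by rewrite lee_fin mulr_ge0 ?powR_ge0.
have sx0 : 0 < Num.sqrt x by rewrite sqrtr_gt0.
apply: (@le_trans _ _ (\int[mu]_(s in `]x, 1%R[)
    (((Num.sqrt x)^-1)%:E * (g1 s + g2 s)))%E).
  apply: ge0_le_integral => //.
  - by move=> s _; rewrite lee_fin beta_density_ge0.
  - exact: measurable_beta_density.
  - exact: mc12.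
  move=> s /=; rewrite in_itv/= => /andP[xs s1].
  have s0 : 0 < s by exact: lt_trans xs.
  have ss0 : 0 < Num.sqrt s by rewrite sqrtr_gt0.
  rewrite -EFinD -EFinM lee_fin.
  apply: (le_trans (beta_density_le_levy k0 n2 _)); first by rewrite s0.
  rewrite dE -[in s^-1](sqr_sqrtr (ltW s0)) expr2 invfM -mulrA.
  apply: ler_pM; rewrite ?mulr_ge0 ?invr_ge0 ?powR_ge0 ?(ltW ss0)//.
    by rewrite lef_pV2 ?posrE// ler_wsqrtr// ltW.
  rewrite (_ : 2^-1 - 1 = - (2^-1)); last by field.
  rewrite powRN (powR12_sqrt (ltW s0)).
  have [s2|s2] := leP s 2^-1.
    rewrite ler_wpDr ?mulr_ge0 ?powR_ge0// mulrC ler_wpM2r ?invr_ge0 ?(ltW ss0)//.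
    have h : (1 - s) `^ (d - 1) <= (1 - s) `^ (- 1).
      apply: ger_powR; last by lra.
      by apply/andP; split; lra.
    apply: (le_trans h); rewrite powR_inv1; last lra.
    rewrite -[leRHS]invrK lef_pV2 ?posrE; lra.
  rewrite ler_wpDl ?mulr_ge0 ?invr_ge0 ?(ltW ss0)// ler_wpM2r ?powR_ge0//.
  rewrite -[leRHS]invrK lef_pV2 ?posrE//.
  rewrite (le_trans (ltW s2))// -{1}(sqr_sqrtr (ltW s0)) expr2 ger_pMl//.
  by rewrite -[leRHS]sqrtr1 ler_wsqrtr// ltW.
rewrite ge0_integralZl//; last 2 first.
- exact: mg12.
- by move=> s _; exact: adde_ge0.
rewrite EFinM lee_wpmul2l ?lee_fin ?invr_ge0 ?(ltW sx0)//.
apply: (@le_trans _ _ (\int[mu]_(s in `]0%R, 1%R[) (g1 s + g2 s))%E).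
  apply: ge0_subset_integral => //.
  - exact: mg12.
  - by move=> s _; exact: adde_ge0.
  - by move=> s /=; rewrite !in_itv/= => /andP[/(lt_trans x0) -> ->].
rewrite ge0_integralD//; last 2 first.
- exact: mg1.
- exact: mg2.
under eq_integral do rewrite /g1 EFinM.
under [X in (_ + X)%E]eq_integral do rewrite /g2 EFinM.
rewrite ge0_integralZl//; last 2 first.
- by apply/measurable_EFinP/measurable_funTS; exact: measurable_powR.
- by move=> s _; rewrite lee_fin powR_ge0.
rewrite ge0_integralZl//; last 2 first.
- apply/measurable_EFinP/measurable_funTS.
  apply: (measurableT_comp (measurable_powR _)); exact: measurable_funB.
- by move=> s _; rewrite lee_fin powR_ge0.
rewrite integral_powR// integral_onem_powR// subr0 !powR1 -!EFinM -EFinD lee_fin.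
rewrite invrK mul1r div1r; lra.
Qed.

(** The constant must not depend on n nor on z. The quotient of Gamma functions
    contributes k - k / n, which compensates the term 2 / (k - k / n) of
    [integral_beta_density_le]; this is what keeps the bound finite when c comes
    close to 0. *)
Lemma beta_tail_le (C : R) : 0 <= C -> exists2 K, 0 < K &
  forall (c : R -> R) (z x : R) (n : nat), 0 <= c z <= C -> (2 <= n)%N ->
  0 < x <= 1 -> (n%:R%:E * beta_tail c n z x <= (K / Num.sqrt x)%:E)%E.
Proof.
move=> C0; pose K := (4 * C + 2) * (1 + Gamma_fun (1 + C)) * expR 1 ^+ 2.
have K0 : 0 < K.
  rewrite /K !mulr_gt0 ?exprn_gt0 ?expR_gt0//; first lra.
  by rewrite (lt_le_trans ltr01)// lerDl Gamma_fun_ge0.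
exists K => // c z x n /andP[cz0 czC] n2 /andP[x0 x1].
have sx0 : 0 < Num.sqrt x by rewrite sqrtr_gt0.
rewrite /beta_tail -/(beta_coef (c z) n).
move: cz0; rewrite le_eqVlt => /predU1P[cz0|cz0].
  rewrite -cz0 /beta_coef Gamma_fun0 mul0r mul0e mule0 lee_fin.
  by rewrite divr_ge0// ltW.
set k := c z in cz0 czC *.
rewrite muleA -EFinM natr_beta_coef//.
have d0 : 0 < k - k / n%:R.
  by rewrite subr_gt0 ltr_pdivrMr ?ltr0n ?(leq_trans _ n2)// ltr_pMr// ltr1n.
have e0 : 0 <= k / n%:R by rewrite divr_ge0// ltW.
have Ginv b : 0 <= b -> (Gamma_fun (1 + b))^-1 <= expR 1.
  move=> b0; rewrite -[leRHS]invrK -expRN lef_pV2 ?posrE ?expR_gt0 ?Gamma_fun1D_ge//.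
  by rewrite (lt_le_trans _ (Gamma_fun1D_ge b0))// expR_gt0.
have Gi0 b : 0 <= (Gamma_fun (1 + b))^-1 :> R by rewrite invr_ge0 Gamma_fun_ge0.
set Ck := _ / _.
have Ck0 : 0 <= Ck by rewrite divr_ge0 ?mulr_ge0 ?Gamma_fun_ge0// ltW.
apply: (@le_trans _ _ (Ck%:E * ((Num.sqrt x)^-1 * (4 + 2 / (k - k / n%:R)))%:E)%E).
  rewrite lee_wpmul2l ?lee_fin//; apply: integral_beta_density_le => //.
  by rewrite x0.
rewrite -EFinM lee_fin mulrCA mulrC ler_wpM2r ?invr_ge0 ?(ltW sx0)//.
rewrite /Ck invfM.
set G1 := Gamma_fun (1 + k); set Ge := (Gamma_fun (1 + k / n%:R))^-1.
set Gd := (Gamma_fun (1 + (k - k / n%:R)))^-1.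
set d := k - k / n%:R in d0 *.
rewrite (_ : d * G1 * (Ge * Gd) * (4 + 2 / d) = (4 * d + 2) * G1 * (Ge * Gd)); last first.
  by field; rewrite gt_eqF.
rewrite /K expr2; apply: ler_pM.
- by rewrite mulr_ge0 ?Gamma_fun_ge0//; lra.
- by rewrite mulr_ge0 ?Gi0.
- apply: ler_pM; rewrite ?Gamma_fun_ge0//.
  + lra.
  + by rewrite /d; lra.
  + by apply: Gamma_fun1D_le; rewrite (ltW cz0).
- by apply: ler_pM; rewrite ?Gi0 ?Ginv ?(ltW d0).
Qed.

End beta_tail_asymptotics.

(** * Generalized inverses of decreasing tails *)

Section tail_inverse.
Context {R : realType}.
Implicit Types (f : R -> \bar R) (p x y : R).

Definition tail_antitone f := forall x y, 0 <= x -> x <= y -> y <= 1 ->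
  (f y <= f x)%E.

Let S f p := [set x : R | 0 <= x <= 1 /\ (f x <= p%:E)%E].

Let has_lbound_S f p : has_lbound (S f p).
Proof. by exists 0 => x [/andP[]]. Qed.

Lemma tail_inv_le f p x : 0 <= x <= 1 -> (f x <= p%:E)%E -> tail_inv f p <= x.
Proof. by move=> x01 fx; apply: ge_inf; [exact: has_lbound_S|split]. Qed.

Lemma le_tail_inv f p x : f 1 = 0%E -> 0 <= p ->
  (forall y, 0 <= y <= 1 -> (f y <= p%:E)%E -> x <= y) -> x <= tail_inv f p.
Proof.
move=> f1 p0 h; apply: lb_le_inf.
  by exists 1; split; [rewrite ler01 lexx|rewrite f1 lee_fin].
by move=> y [y01 fy]; exact: h.
Qed.

Lemma tail_inv_le1 f p : tail_inv f p <= 1.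
Proof.
rewrite /tail_inv -/(S f p); have [->|/set0P[x Sx]] := eqVneq (S f p) set0.
  by rewrite inf0.
by apply: (@le_trans _ _ x); [exact: ge_inf|case: Sx => /andP[]].
Qed.

Lemma tail_inv_lt f p x : f 1 = 0%E -> 0 <= p -> tail_inv f p < x ->
  exists2 y, 0 <= y <= 1 /\ (f y <= p%:E)%E & y < x.
Proof.
move=> f1 p0 h.
have hi : has_inf (S f p).
  split; last exact: has_lbound_S.
  by exists 1; split; [rewrite ler01 lexx|rewrite f1 lee_fin].
have d0 : 0 < x - tail_inv f p by rewrite subr_gt0.
have [y Sy yx] := inf_adherent d0 hi.
by exists y => //; move: yx; rewrite -/(tail_inv f p); lra.
Qed.

Lemma lt_tail_inv f p x : 0 <= x < tail_inv f p -> (p%:E < f x)%E.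
Proof.
move=> /andP[x0 xt]; rewrite ltNge; apply/negP => fx.
have x1 : x <= 1 by rewrite ltW// (lt_le_trans xt) ?tail_inv_le1.
by move: xt; rewrite ltNge tail_inv_le// x0.
Qed.

Lemma tail_inv0 f p : 0 <= p -> (forall x, f x = 0%E) -> tail_inv f p = 0.
Proof.
move=> p0 f0; apply/eqP; rewrite eq_le tail_inv_ge0 andbT.
by apply: tail_inv_le; rewrite ?lexx ?ler01// f0 lee_fin.
Qed.

Lemma tail_invZ (k : R) f p : 0 < k ->
  tail_inv (fun x => k%:E * f x)%E p = tail_inv f (p / k).
Proof.
move=> k0; rewrite /tail_inv; congr inf; apply/seteqP; split => x [x01] h;
  split => //; move: h; by rewrite EFinM lee_pdivlMr// muleC.
Qed.

(** Evaluate f at (K / p) ^ 2, where the bound K / sqrt x equals p. *)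
Lemma tail_inv_le_sqr f p (K : R) : 0 < K -> 0 < p ->
  (forall x, 0 < x <= 1 -> (f x <= (K / Num.sqrt x)%:E)%E) ->
  tail_inv f p <= (K / p) ^+ 2.
Proof.
move=> K0 p0 fK; have Kp : 0 < K / p by rewrite divr_gt0.
have [h|/ltW h] := leP ((K / p) ^+ 2) 1; last first.
  exact: le_trans (tail_inv_le1 _ _) h.
apply: tail_inv_le; first by rewrite sqr_ge0.
apply: (le_trans (fK _ _)); first by rewrite exprn_gt0.
by rewrite sqrtr_sqr gtr0_norm// invf_div mulrCA mulfV ?mulr1 ?gt_eqF.
Qed.

Lemma cvge_near_lt I (F : set_system I) (FF : Filter F) (g : I -> \bar R)
    (r_ : I -> R) (l : \bar R) (r : R) :
  g i @[i --> F] --> l -> r_ i @[i --> F] --> r -> (l < r%:E)%E ->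
  \forall i \near F, (g i < (r_ i)%:E)%E.
Proof.
move=> gl rr lr.
have [q [lq qr]] : exists q : R, (l < q%:E)%E /\ q < r.
  case: l lr {gl} => [l|//|] lr.
    by exists ((l + r) / 2); move: lr; rewrite !lte_fin => lr; split; lra.
  by exists (r - 1); split; [exact: ltNyr|lra].
have h1 : \forall i \near F, (g i < q%:E)%E.
  apply: (gl [set x | (x < q%:E)%E]); apply: open_nbhs_nbhs; split => //.
  exact: open_ereal_lt_ereal.
have h2 : \forall i \near F, q < r_ i by apply: (cvgr_gt _ rr).
near=> i; apply: (@lt_trans _ _ q%:E); first by near: i.
by rewrite lte_fin; near: i.
Unshelve. all: by end_near. Qed.

Lemma cvge_near_gt I (F : set_system I) (FF : Filter F) (g : I -> \bar R)
    (r_ : I -> R) (l : \bar R) (r : R) :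
  g i @[i --> F] --> l -> r_ i @[i --> F] --> r -> (r%:E < l)%E ->
  \forall i \near F, ((r_ i)%:E < g i)%E.
Proof.
move=> gl rr lr.
have gl' : (- g i)%E @[i --> F] --> (- l)%E by apply: cvgeN.
have rr' : - r_ i @[i --> F] --> - r by apply: cvgN.
have := cvge_near_lt FF gl' rr'; rewrite EFinN lteN2 => /(_ lr).
by apply: filterS => i; rewrite EFinN lteN2.
Qed.

(** Strict monotonicity of the limit makes its inverse insensitive to small
    perturbations: a little to the right of the inverse the limit is strictly below
    p, a little to the left it is strictly above, and these strict inequalities
    pass to f_ i and p_ i eventually. Only points of ]0, 1[ are tested, since the
    limit may be infinite at 0. *)
Lemma cvg_tail_inv I (F : set_system I) (FF : Filter F)
    (f_ : I -> R -> \bar R) f (p_ : I -> R) p :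
  (forall i, tail_antitone (f_ i)) -> tail_antitone f ->
  (forall i, f_ i 1 = 0%E) -> f 1 = 0%E ->
  (forall i, 0 <= p_ i) -> 0 <= p ->
  (forall x y, 0 < x -> x < y -> y < 1 -> (f y < f x)%E) ->
  (forall x, 0 < x < 1 -> f_ i x @[i --> F] --> f x) ->
  p_ i @[i --> F] --> p ->
  tail_inv (f_ i) (p_ i) @[i --> F] --> tail_inv f p.
Proof.
move=> af_ af f_1 f1 p_0 p0 fdec f_f p_p.
set t := tail_inv f p; have t0 : 0 <= t := tail_inv_ge0 _ _.
have t1 : t <= 1 := tail_inv_le1 _ _.
have upper e : 0 < e -> \forall i \near F, tail_inv (f_ i) (p_ i) <= t + e.
  move=> e0; have [te|te] := leP 1 (t + e).
    by apply: nearW => i; exact: le_trans (tail_inv_le1 _ _) te.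
  have tte : tail_inv f p < t + e by rewrite ltrDl.
  have [y [/andP[y0 y1] fy] yte] := tail_inv_lt f1 p0 tte.
  have [x [yx xte]] : exists x, y < x /\ x < t + e.
    by exists ((y + (t + e)) / 2); split; lra.
  have fte : (f (t + e)%R < p%:E)%E.
    have fxy : (f x <= f y)%E by apply: af => //; [exact: ltW|lra].
    apply: lt_le_trans (le_trans fxy fy).
    by apply: fdec => //; exact: le_lt_trans yx.
  have te0 : 0 < t + e < 1 by rewrite te andbT; lra.
  have := cvge_near_lt FF (f_f _ te0) p_p fte.
  apply: filterS => i fi; apply: tail_inv_le; last exact: ltW.
  by apply/andP; split; lra.
have lower e : 0 < e -> \forall i \near F, t - e <= tail_inv (f_ i) (p_ i).
  move=> e0; have [te|te] := leP (t - e) 0.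
    by apply: nearW => i; exact: le_trans te (tail_inv_ge0 _ _).
  have te1 : 0 < t - e < 1 by rewrite te; lra.
  have pf : (p%:E < f (t - e)%R)%E.
    by apply: lt_tail_inv; rewrite (ltW te) ltrBlDr ltrDl.
  have := cvge_near_gt FF (f_f _ te1) p_p pf.
  apply: filterS => i fi; apply: le_tail_inv => // y /andP[y0 y1] fy.
  rewrite leNgt; apply/negP => yte.
  have te1' : t - e <= 1 by lra.
  have := lt_le_trans fi (af_ i y (t - e) y0 (ltW yte) te1').
  by rewrite ltNge fy.
apply/cvgrPdist_le => e e0.
near=> i; rewrite ler_norml; apply/andP; split.
  have : tail_inv (f_ i) (p_ i) <= t + e by near: i; exact: upper.
  by lra.
have : t - e <= tail_inv (f_ i) (p_ i) by near: i; exact: lower.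
by lra.
Unshelve. all: by end_near. Qed.

End tail_inverse.

(** * Convergence and domination of the atom masses *)

Section levy_tail_inverse.
Context {R : realType}.
Notation mu := (@lebesgue_measure R).
Variables (c : R -> R) (a0 : R).
Hypothesis a0_gt0 : 0 < a0.

Lemma levy_tailE z x : levy_tail c a0 z x =
  ((a0 * c z)%:E * \int[mu]_(s in `[x, 1%R]) (levy_kernel (c z) s)%:E)%E.
Proof. by []. Qed.

Lemma levy_tail1 z : levy_tail c a0 z 1 = 0%E.
Proof. by rewrite levy_tailE set_itv1 integral_set1 mule0. Qed.

Lemma levy_tail_eq0 z x : c z = 0 -> levy_tail c a0 z x = 0%E.
Proof. by move=> cz; rewrite levy_tailE cz mulr0 mul0e. Qed.

Lemma levy_tail_ge0 z x : 0 <= c z -> 0 <= x -> (0 <= levy_tail c a0 z x)%E.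
Proof.
move=> cz x0; rewrite levy_tailE mule_ge0 ?lee_fin ?mulr_ge0 ?(ltW a0_gt0)//.
apply: integral_ge0 => s /=; rewrite in_itv/= => /andP[xs _].
by rewrite lee_fin levy_kernel_ge0// (le_trans x0).
Qed.

Lemma levy_tail_antitone z : 0 <= c z -> tail_antitone (levy_tail c a0 z).
Proof.
move=> cz x y x0 xy y1; rewrite !levy_tailE lee_wpmul2l//.
  by rewrite lee_fin mulr_ge0// ltW.
apply: ge0_subset_integral => //.
- exact: measurable_levy_kernel.
- move=> s /=; rewrite in_itv/= => /andP[xs _].
  by rewrite lee_fin levy_kernel_ge0// (le_trans x0).
- by move=> s /=; rewrite !in_itv/= => /andP[/(le_trans xy) ->].
Qed.

Lemma integral_levy_kernel_lty (k x : R) : 0 < k -> 0 < x ->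
  (\int[mu]_(s in `[x, 1%R]) (levy_kernel k s)%:E < +oo)%E.
Proof.
move=> k0 x0; rewrite integral_levy_kernel_oo.
have [x1|x1] := leP 1 x.
  by rewrite set_itv_ge ?integral_set0// -leNgt bnd_simp.
have mp (D : set R) : measurable_fun D (fun s : R => ((1 - s) `^ (k - 1))%:E).
  apply/measurable_EFinP/measurable_funTS.
  apply: (measurableT_comp (measurable_powR _)); exact: measurable_funB.
apply: (@le_lt_trans _ _
    (\int[mu]_(s in `]x, 1%R[) (x^-1%:E * ((1 - s) `^ (k - 1))%:E))%E).
  apply: ge0_le_integral => //.
  - move=> s /=; rewrite in_itv/= => /andP[xs _].
    by rewrite lee_fin levy_kernel_ge0// ltW// (lt_trans x0).
  - exact: measurable_levy_kernel.
  - by apply: emeasurable_funM => //; exact: mp.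
  - move=> s /=; rewrite in_itv/= => /andP[xs _].
    rewrite -EFinM lee_fin ler_wpM2r ?powR_ge0// lef_pV2 ?posrE// ?ltW//.
    exact: lt_trans xs.
rewrite ge0_integralZl//; last 3 first.
- exact: mp.
- by move=> s _; rewrite lee_fin powR_ge0.
- by rewrite lee_fin invr_ge0 ltW.
by rewrite integral_onem_powR// -EFinM ltry.
Qed.

Lemma levy_tail_fin_num z x : 0 <= c z -> 0 < x ->
  levy_tail c a0 z x \is a fin_num.
Proof.
move=> cz x0; rewrite ge0_fin_numE; last by apply: levy_tail_ge0 => //; exact: ltW.
move: cz; rewrite le_eqVlt => /predU1P[cz|cz]; first by rewrite levy_tail_eq0.
rewrite levy_tailE lte_mul_pinfty ?lee_fin ?mulr_ge0 ?(ltW cz) ?(ltW a0_gt0)//.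
exact: integral_levy_kernel_lty.
Qed.

Lemma levy_tail_lt z x y : 0 < c z -> 0 < x -> x < y -> y < 1 ->
  (levy_tail c a0 z y < levy_tail c a0 z x)%E.
Proof.
move=> cz x0 xy y1; have y0 := lt_trans x0 xy.
have ak0 : 0 < a0 * c z by rewrite mulr_gt0.
rewrite !levy_tailE lte_pmul2l ?lte_fin//.
have kge0 s : `[x, 1%R]%classic s -> (0 <= (levy_kernel (c z) s)%:E)%E.
  rewrite /= in_itv/= => /andP[xs _].
  by rewrite lee_fin levy_kernel_ge0// ltW// (lt_le_trans x0).
have -> : `[x, 1%R]%classic = `[x, y[ `|` `[y, 1%R] :> set R.
  by rewrite -itv_bndbnd_setU// bnd_simp ltW.
rewrite ge0_integral_setU//=; last 3 first.
- exact: measurable_levy_kernel.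
- move=> s /= h; apply: kge0; move: h; rewrite /= !in_itv/= => -[|] /andP[? ?]; lra.
- by rewrite disj_set2E; apply/eqP/seteqP; split => // s [] /=; rewrite !in_itv/=; lra.
rewrite -[ltLHS]add0e lte_leD//.
- rewrite ge0_fin_numE; first exact: integral_levy_kernel_lty.
  by apply: integral_ge0 => s /= h; apply: kge0; move: h; rewrite /= !in_itv/=; lra.
apply: (@lt_le_trans _ _ (\int[mu]_(s in `[x, y[) (cst ((1 - y) `^ c z)%:E s))%E).
  rewrite integral_cst//= lebesgue_measure_itv/= lte_fin xy -EFinB -EFinM lte_fin.
  by rewrite mulr_gt0 ?subr_gt0// powR_gt0// subr_gt0.
apply: ge0_le_integral => //.
- by move=> s _; rewrite lee_fin powR_ge0.
- exact: measurable_levy_kernel.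
- move=> s /=; rewrite in_itv/= => /andP[xs sy]; rewrite lee_fin.
  have s0 : 0 < s by exact: lt_le_trans xs.
  have s1 : s < 1 by exact: lt_trans y1.
  rewrite /levy_kernel -[leLHS]mul1r; apply: ler_pM; rewrite ?powR_ge0//.
    by rewrite -[leLHS]invr1 lef_pV2 ?posrE// ltW.
  apply: (@le_trans _ _ ((1 - s) `^ c z)).
    by apply: ge0_ler_powR; rewrite ?nnegrE ?subr_ge0 ?ltW//; lra.
  by apply: ger_powR; [lra|rewrite gerBl].
Qed.

(** An instance of [cvg_tail_inv] in which only the level p varies. *)
Lemma continuous_levy_tail_inv z : 0 <= c z ->
  continuous (fun p : R => tail_inv (levy_tail c a0 z) (Num.max p 0)).
Proof.
move=> cz p; move: (cz); rewrite le_eqVlt => /predU1P[cz0|cz0].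
  rewrite (_ : (fun p => _) = cst 0); first exact: cst_continuous.
  apply/funext => q; apply: tail_inv0; first by rewrite le_max lexx orbT.
  by move=> x; exact: levy_tail_eq0.
apply: cvg_tail_inv.
- by move=> _; exact: levy_tail_antitone.
- exact: levy_tail_antitone.
- by move=> _; exact: levy_tail1.
- exact: levy_tail1.
- by move=> q; rewrite le_max lexx orbT.
- by rewrite le_max lexx orbT.
- by move=> x y x0 xy y1; exact: levy_tail_lt.
- by move=> x _; exact: cvg_cst.
- by apply: (@continuous_max _ _ id (cst 0)) => //; exact: cst_continuous.
Qed.

Lemma beta_tailE n z x : beta_tail c n z x =
  ((beta_coef (c z) n)%:E * \int[mu]_(s in `[x, 1%R]) (beta_density (c z) n s)%:E)%E.
Proof. by []. Qed.

Lemma beta_tail1 n z : beta_tail c n z 1 = 0%E.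
Proof. by rewrite beta_tailE set_itv1 integral_set1 mule0. Qed.

Lemma beta_tail_eq0 n z x : c z = 0 -> beta_tail c n z x = 0%E.
Proof. by move=> cz; rewrite beta_tailE cz /beta_coef Gamma_fun0 mul0r mul0e. Qed.

Lemma beta_tail_antitone n z : tail_antitone (beta_tail c n z).
Proof.
move=> x y x0 xy y1; rewrite !beta_tailE lee_wpmul2l ?lee_fin ?beta_coef_ge0//.
apply: ge0_subset_integral => //.
- exact: measurable_beta_density.
- by move=> s _; rewrite lee_fin beta_density_ge0.
- by move=> s /=; rewrite !in_itv/= => /andP[/(le_trans xy) ->].
Qed.

Lemma cvg_beta_tail z x : 0 < c z -> 0 < x < 1 ->
  ((a0 * n.+2%:R)%:E * beta_tail c n.+2 z x)%E @[n --> \oo]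
  --> levy_tail c a0 z x.
Proof.
move=> cz x01; rewrite levy_tailE.
rewrite (_ : (fun n => _) = (fun n => (a0 * (n.+2%:R * beta_coef (c z) n.+2))%:E *
  \int[mu]_(s in `[x, 1%R]) (beta_density (c z) n.+2 s)%:E)%E); last first.
  by apply/funext => n; rewrite beta_tailE muleA -EFinM mulrA.
apply: cvgeM.
- have : (\int[mu]_(s in `[x, 1%R]) (levy_kernel (c z) s)%:E)%E \is a fin_num.
    rewrite ge0_fin_numE; first by apply: integral_levy_kernel_lty => //; lra.
    apply: integral_ge0 => s /=; rewrite in_itv/= => /andP[xs _].
    by rewrite lee_fin levy_kernel_ge0//; lra.
  exact: mule_def_fin.
- apply: cvg_EFin; first by near=> n.
  by apply: cvgMr; exact: cvg_natr_beta_coef.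
- exact: cvg_integral_beta_density.
Unshelve. all: by end_near. Qed.

(** Inverting the beta tail at p / (a0 n) is inverting a0 n times the beta tail
    at p, and a0 n times the beta tail tends to the Levy tail. *)
Lemma cvg_beta_tail_inv z p : 0 <= c z -> 0 <= p ->
  tail_inv (beta_tail c n z) (p / (a0 * n%:R)) @[n --> \oo]
  --> tail_inv (levy_tail c a0 z) p.
Proof.
move=> cz p0; move: (cz); rewrite le_eqVlt => /predU1P[cz0|cz0].
  rewrite [X in _ --> X]tail_inv0//; last by move=> x; exact: levy_tail_eq0.
  rewrite (_ : (fun n => _) = cst 0); first exact: cvg_cst.
  apply/funext => n; apply: tail_inv0; last by move=> x; exact: beta_tail_eq0.
  by rewrite divr_ge0// mulr_ge0// ltW.
rewrite -(cvg_shiftn 2) /=.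
rewrite (_ : (fun n => _) = (fun n =>
  tail_inv (fun x => (a0 * n.+2%:R)%:E * beta_tail c n.+2 z x)%E p)); last first.
  apply/funext => n; have k0 : 0 < a0 * n.+2%:R by rewrite mulr_gt0.
  by rewrite addn2 (tail_invZ _ _ k0).
apply: cvg_tail_inv => //.
- move=> n x y x0 xy y1; rewrite lee_wpmul2l ?lee_fin ?mulr_ge0 ?(ltW a0_gt0)//.
  exact: beta_tail_antitone.
- exact: levy_tail_antitone.
- by move=> n; rewrite beta_tail1 mule0.
- exact: levy_tail1.
- by move=> x y x0 xy y1; exact: levy_tail_lt.
- by move=> x x01; exact: cvg_beta_tail.
- exact: cvg_cst.
Qed.

(** With p the i-th arrival time, which grows linearly in i, the right-hand side is
    summable in i and does not depend on n. *)
Lemma beta_tail_inv_le (C : R) : 0 <= C -> exists2 K, 0 < K &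
  forall z p n, 0 <= c z <= C -> 0 < p -> (2 <= n)%N ->
  tail_inv (beta_tail c n z) (p / (a0 * n%:R)) <= (K / p) ^+ 2.
Proof.
move=> C0; have [K K0 KP] := beta_tail_le C0.
exists (a0 * K); first exact: mulr_gt0.
move=> z p n czC p0 n2.
have n0 : 0 < n%:R :> R by rewrite ltr0n (leq_trans _ n2).
rewrite -tail_invZ; last exact: mulr_gt0.
apply: tail_inv_le_sqr => //; first exact: mulr_gt0.
move=> x x01; rewrite EFinM -muleA -mulrA EFinM.
by rewrite lee_wpmul2l ?lee_fin ?(ltW a0_gt0)//; exact: KP.
Qed.

End levy_tail_inverse.

(** * Joint measurability and the change of variables to jump sizes *)

Section campbell.
Context {R : realType}.
Notation mu := (@lebesgue_measure R).

(** For antitone f, the superlevel set of f above p is ]0, tail_inv f p[ up to its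
    right end point; the case distinction is about that end point. *)
Lemma integral_tail_inv (f : R -> \bar R) (p : R) (phi : R -> \bar R) :
  tail_antitone f -> f 1 = 0%E -> 0 <= p -> measurable_fun setT phi ->
  (\int[mu]_(s in `]0%R, 1%R[) (if (p%:E < f s)%E then phi s else 0) =
   \int[mu]_(s in `]0%R, tail_inv f p[) phi s)%E.
Proof.
move=> af f1 p0 mphi; set t := tail_inv f p.
have t0 : 0 <= t := tail_inv_ge0 _ _.
have t1 : t <= 1 := tail_inv_le1 _ _.
have belowP s : 0 < s < 1 -> (p%:E < f s)%E -> s <= t.
  move=> /andP[s0 s1] pfs; apply: le_tail_inv => // y /andP[y0 y1] fy.
  rewrite leNgt; apply/negP => ys; move: pfs.
  by rewrite ltNge (le_trans _ fy)//; apply: af => //; exact: ltW.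
pose B := [set s | 0 < s < 1 /\ (p%:E < f s)%E].
transitivity (\int[mu]_(s in B) phi s)%E.
  rewrite integral_mkcond [RHS]integral_mkcond; apply: eq_integral => s _.
  rewrite !patchE mem_setE in_itv/=; case: ifPn => s01; last first.
    by rewrite memNset// => -[]; rewrite (negbTE s01).
  case: ifPn => pfs; first by rewrite mem_set.
  by rewrite memNset// => -[_]; rewrite (negbTE pfs).
have [/andP[t_gt0 /andP[t_lt1 pft]]|h] := boolP [&& 0 < t, t < 1 & (p%:E < f t)%E].
  rewrite integral_itv_bndo_bndc; last exact: measurable_funTS.
  congr (integral _ _ _); apply/seteqP; split => s; rewrite /B/= in_itv/=.
    by move=> [s01 pfs]; rewrite belowP//; case/andP: s01 => ->.
  move=> /andP[s0 st]; split; first by rewrite s0 (le_lt_trans st).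
  by apply: (lt_le_trans pft); apply: af => //; exact: ltW.
congr (integral _ _ _); apply/seteqP; split => s; rewrite /B/= in_itv/=.
  move=> [s01 pfs]; case/andP: (s01) => -> s1 /=.
  rewrite lt_neqAle belowP// andbT; apply: contra h => /eqP <-.
  by rewrite andbA s01.
move=> /andP[s0 st]; split; first by rewrite s0 (lt_le_trans st).
by apply: lt_tail_inv; rewrite ltW.
Qed.

Lemma measurable_powR_fun d (T : measurableType d) (f g : T -> R) :
  measurable_fun setT f -> measurable_fun setT g ->
  measurable_fun setT (fun x => f x `^ g x).
Proof.
move=> mf mg; apply: measurable_fun_ifT.
- by apply: measurable_fun_eqr.
- rewrite (_ : (fun x => _) = (fun x => if g x == 0 then 1 else 0)); last first.
    by apply/funext => x; case: (g x == 0).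
  by apply: measurable_fun_ifT => //; exact: measurable_fun_eqr.
- apply: measurableT_comp => //; apply: measurable_funM => //.
  exact: measurableT_comp.
Qed.

Variables (c : R -> R) (a0 : R).
Hypotheses (a0_gt0 : 0 < a0) (mc : measurable_fun setT c)
  (c_ge0 : forall z, 0 <= c z).

Notation LR := (measurableTypeR R).

Lemma measurable_levy_tail : measurable_fun setT
  (fun q : R * R => levy_tail c a0 q.1 (Num.max q.2 0)).
Proof.
pose h (q : (R * R) * LR) : \bar R :=
  if (Num.max q.1.2 0 <= q.2) && (q.2 <= 1)
  then (levy_kernel (c q.1.1) q.2)%:E else 0%E.
have h0 q : (0 <= h q)%E.
  rewrite /h; case: ifPn => // /andP[+ _]; rewrite ge_max => /andP[_ s0].
  by rewrite lee_fin levy_kernel_ge0.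
have mq2 : measurable_fun setT (fun q : (R * R) * LR => q.2 : R).
  exact: measurable_snd.
have mh : measurable_fun setT h.
  apply: measurable_fun_ifT => //.
    apply: measurable_and; apply: measurable_fun_ler => //.
    apply: measurable_maxr => //.
    exact: (measurableT_comp measurable_snd measurable_fst).
  apply/measurable_EFinP; apply: measurable_funM.
    exact: (measurableT_comp (@measurable_invr R) mq2).
  apply: measurable_powR_fun; first exact: measurable_funB.
  apply: measurable_funB => //.
  apply: (measurableT_comp mc).
  exact: (measurableT_comp measurable_fst measurable_fst).
have mF := measurable_fun_fubini_tonelli_F (m2 := mu) h mh h0.
rewrite (_ : (fun q => _) =
    (fun q : R * R => (a0 * c q.1)%:E * \int[mu]_s h (q, s))%E).
  apply: emeasurable_funM => //.
  apply/measurable_EFinP; apply: measurable_funM => //.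
  exact: (measurableT_comp mc measurable_fst).
apply/funext => q; rewrite levy_tailE; congr (_ * _)%E.
rewrite integral_mkcond; apply: eq_integral => s _.
by rewrite patchE mem_setE in_itv.
Qed.

(** The inverse is the length of the superlevel set of the Levy tail, that is, an
    integral depending on parameters, and those are measurable by Tonelli. The
    maximum keeps the function continuous in p across 0. *)
Lemma measurable_tail_inv : measurable_fun setT
  (fun q : R * R => tail_inv (levy_tail c a0 q.1) (Num.max q.2 0)).
Proof.
pose h (q : (R * R) * LR) : \bar R :=
  if ((0 < q.2) && (q.2 < 1)) &&
    ((Num.max q.1.2 0)%R%:E < levy_tail c a0 q.1.1 (Num.max q.2 0)%R)%E
  then 1%E else 0%E.
have h0 q : (0 <= h q)%E by rewrite /h; case: ifP.
have mq2 : measurable_fun setT (fun q : (R * R) * LR => q.2 : R).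
  exact: measurable_snd.
have mq11 : measurable_fun setT (fun q : (R * R) * LR => q.1.1).
  exact: (measurableT_comp measurable_fst measurable_fst).
have mh : measurable_fun setT h.
  apply: measurable_fun_ifT => //.
  apply: measurable_and; first by apply: measurable_and; exact: measurable_fun_ltr.
  apply: measurable_fun_lte.
    apply/measurable_EFinP; apply: measurable_maxr => //.
    exact: (measurableT_comp measurable_snd measurable_fst).
  apply: (measurableT_comp measurable_levy_tail
    (g := fun q : (R * R) * LR => (q.1.1, q.2 : R))).
  exact: measurable_fun_pair.
have mF := measurable_fun_fubini_tonelli_F (m2 := mu) h mh h0.
rewrite (_ : (fun q => _) = fine \o (fun q : R * R => \int[mu]_s h (q, s))%E).
  apply: measurableT_comp => //.
apply/funext => -[z p] /=.
set f := levy_tail c a0 z; set p' := Num.max p 0.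
have p'0 : 0 <= p' by rewrite le_max lexx orbT.
have -> : (\int[mu]_s h (z, p, s) = \int[mu]_(s in `]0%R, 1%R[)
    (if (p'%:E < f s)%E then 1 else 0))%E.
  rewrite [RHS]integral_mkcond; apply: eq_integral => s _.
  rewrite patchE mem_setE in_itv/= /h/=.
  by case: (boolP (0 < s < 1)) => //= /andP[s0 _]; rewrite (max_idPl (ltW s0)).
rewrite (@integral_tail_inv f p' (cst 1%E))//.
- rewrite integral_cst//= mul1e lebesgue_measure_itv/= lte_fin.
  case: ifPn => [_|]; first by rewrite -EFinB subr0.
  by rewrite -leNgt => h1; apply/eqP; rewrite eq_le h1 tail_inv_ge0.
- exact: levy_tail_antitone.
- exact: levy_tail1.
Qed.

Lemma integral_rate_expR (u t : R) : 0 <= u -> 0 <= t ->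
  (\int[mu]_(s in `]0%R, t[) (u * expR (- (u * s)))%:E =
   (1 - expR (- (u * t)))%:E)%E.
Proof.
move=> u0; rewrite le_eqVlt => /predU1P[<-|t0].
  by rewrite set_itv_ge ?bnd_simp// integral_set0 mulr0 oppr0 expR0 subrr.
have dexp (s : R) :
    is_derive s 1 (fun s : R => - expR (- (u * s))) (u * expR (- (u * s))).
  have h1 := is_derive_expR (- (u * s)).
  have h2 : is_derive s 1 (fun s : R => - (u * s)) (- u).
    have h3 : derivable (fun s : R => u * s) s 1 by apply: derivableM.
    split; first exact: derivableN.
    rewrite deriveN; last exact: h3.
    rewrite deriveM; [|exact: derivable_cst|exact: derivable_id].
    by rewrite derive_cst scaler0 addr0 derive_id -[_ *: _]/(_ * _) mulr1.
  have := @is_derive1_comp _ expR (fun s => - (u * s)) s _ _ h1 h2 => h.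
  split; first by apply: derivableN; exact: ex_derive.
  rewrite deriveN; last exact: ex_derive.
  by rewrite (@derive_val _ _ _ _ _ _ _ h) mulrN opprK mulrC.
have cexp : continuous (fun s : R => expR (- (u * s))).
  move=> s; apply: continuous_comp; last exact: continuous_expR.
  by apply: cvgN; apply: cvgMr.
rewrite (@integral_ge0_FTC_oo _ _ (fun s => - expR (- (u * s))))//.
- by rewrite mulr0 oppr0 expR0; congr EFin; ring.
- by move=> s _; rewrite mulr_ge0 ?expR_ge0.
- by move=> s _; apply: cvgMr; exact: cexp.
- by move=> s _; rewrite derive1E; apply: derive_val.
- by apply: cvgN; apply: cvg_at_right_filter; exact: cexp.
- by apply: cvgN; apply: cvg_at_left_filter; exact: cexp.
Qed.

(** The image of Lebesgue measure under p |-> tail_inv f p is the measure with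
    tail f. Without constructing the image measure: write 1 - exp (- u t) as the
    integral of its derivative over ]0, t[, exchange with the integral in p, then
    exchange once more with the integral that defines the tail. *)
Lemma campbell_levy_tail (z u : R) : 0 <= u ->
  (\int[mu]_(p in `]0%R, +oo[)
     (1 - expR (- (u * tail_inv (levy_tail c a0 z) p)))%:E =
   \int[mu]_(s in `]0%R, 1%R[)
     ((1 - expR (- (u * s))) * (a0 * c z * levy_kernel (c z) s))%:E)%E.
Proof.
move=> u0; pose f := levy_tail c a0 z.
pose phi (s : R) : \bar R := (u * expR (- (u * s)))%:E.
have phi0 s : (0 <= phi s)%E by rewrite lee_fin mulr_ge0 ?expR_ge0.
have mphi : measurable_fun setT phi.
  apply/measurable_EFinP; apply: measurable_funM => //.
  by apply: measurableT_comp => //; apply: measurableT_comp.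
pose G (s : R) : \bar R := (a0 * c z * levy_kernel (c z) s)%:E.
have mG (D : set R) : measurable_fun D G.
  apply/measurable_EFinP; apply: measurable_funM => //.
  by apply/measurable_EFinP; exact: measurable_levy_kernel.
pose h (q : LR * LR) : \bar R :=
  if ((0 < q.1) && ((0 < q.2) && (q.2 < 1))) && ((q.1 : R)%:E < f (Num.max q.2 0)%R)%E
  then phi q.2 else 0%E.
have h0 q : (0 <= h q)%E by rewrite /h; case: ifP.
have m1 : measurable_fun setT (fun q : LR * LR => q.1 : R) by exact: measurable_fst.
have m2 : measurable_fun setT (fun q : LR * LR => q.2 : R) by exact: measurable_snd.
have mh : measurable_fun setT h.
  apply: measurable_fun_ifT => //; last exact: (measurableT_comp mphi m2).
  apply: measurable_and.
    apply: measurable_and; first exact: measurable_fun_ltr.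
    by apply: measurable_and; exact: measurable_fun_ltr.
  apply: measurable_fun_lte; first exact/measurable_EFinP.
  apply: (measurableT_comp measurable_levy_tail
    (g := fun q : LR * LR => (z, q.2 : R))).
  exact: measurable_fun_pair.
transitivity (\int[mu]_p \int[mu]_s h (p, s))%E.
  rewrite integral_mkcond; apply: eq_integral => p _.
  rewrite patchE mem_setE in_itv/= andbT; case: ifPn => p0; last first.
    by apply/esym/integral0_eq => s _; rewrite /h/= (negbTE p0).
  rewrite -integral_rate_expR ?tail_inv_ge0//.
  rewrite -(@integral_tail_inv f p phi) ?(ltW p0)//; last 2 first.
  - exact: levy_tail_antitone.
  - exact: levy_tail1.
  rewrite integral_mkcond; apply: eq_integral => s _.
  rewrite patchE mem_setE in_itv/= /h/= p0/=; case: ifPn => //= /andP[s0 _].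
  by rewrite (max_idPl (ltW s0)).
rewrite (fubini_tonelli h)//.
transitivity (\int[mu]_(s in `]0%R, 1%R[) (phi s * f s))%E.
  rewrite [RHS]integral_mkcond; apply: eq_integral => s _.
  rewrite patchE mem_setE in_itv/=; case: ifPn => s01; last first.
    by apply: integral0_eq => p _; rewrite /h/= (negbTE s01) andbF.
  case/andP: (s01) => s0 s1.
  have ffin : f s \is a fin_num by exact: levy_tail_fin_num.
  have fs0 : (0 <= f s)%E by apply: levy_tail_ge0 => //; exact: ltW.
  transitivity (\int[mu]_(p in `]0%R, fine (f s)[) (cst (phi s) p))%E.
    rewrite [RHS]integral_mkcond; apply: eq_integral => p _.
    rewrite patchE mem_setE in_itv/= /h/= s01 andbT (max_idPl (ltW s0)).
    by rewrite -[in f s](fineK ffin) lte_fin.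
  rewrite integral_cst//= lebesgue_measure_itv/= lte_fin.
  case: ifPn => [_|]; first by rewrite -EFinB subr0 fineK.
  rewrite -leNgt => fle.
  have -> : f s = 0%E.
    by rewrite -(fineK ffin); congr EFin; apply/eqP; rewrite eq_le fle fine_ge0.
  by rewrite !mule0.
transitivity (\int[mu]_(s in `]0%R, 1%R[)
    (phi s * \int[mu]_(r in `]0%R, 1%R[ `&` `]s, +oo[) G r))%E.
  apply: eq_integral => s; rewrite inE/= in_itv/= => /andP[s0 s1].
  congr (_ * _)%E; rewrite /f levy_tailE integral_levy_kernel_oo.
  have -> : `]0%R, 1%R[ `&` `]s, +oo[ = `]s, 1%R[%classic :> set R.
    apply/seteqP; split => r /=; rewrite !in_itv/= ?andbT.
      by move=> [/andP[_ ->] ->].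
    by move=> /andP[sr ->]; rewrite (lt_trans s0 sr) sr.
  rewrite -ge0_integralZl//.
  - exact: measurable_levy_kernel.
  - move=> r /=; rewrite in_itv/= => /andP[sr _].
    by rewrite lee_fin levy_kernel_ge0// ltW// (lt_trans s0).
  - by rewrite lee_fin mulr_ge0// ltW.
rewrite -(@tonelli_triangle _ `]0%R, 1%R[%classic G phi)//.
- apply: eq_integral => r; rewrite inE/= in_itv/= => /andP[r0 r1].
  have -> : `]0%R, 1%R[ `&` `]-oo, r[ = `]0%R, r[%classic :> set R.
    apply/seteqP; split => s /=; rewrite !in_itv/= ?andbT.
      by move=> [/andP[-> _] ->].
    by move=> /andP[-> sr]; rewrite (lt_trans sr r1) sr.
  by rewrite /phi integral_rate_expR ?(ltW r0)// -EFinM mulrC.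
- exact: measurable_funTS.
- move=> r /=; rewrite in_itv/= => /andP[r0 r1].
  by rewrite lee_fin mulr_ge0// ?levy_kernel_ge0 ?mulr_ge0// ltW.
Qed.

(** From 1 - exp (- u s) <= u s: the first moment of the jump intensity is a0
    when c z > 0, since (1 - s) ^ (c z - 1) integrates to 1 / c z, and 0 otherwise. *)
Lemma campbell_levy_tail_le (z u : R) : 0 <= u ->
  (\int[mu]_(p in `]0%R, +oo[)
     (1 - expR (- (u * tail_inv (levy_tail c a0 z) p)))%:E <= (u * a0)%:E)%E.
Proof.
move=> u0; rewrite campbell_levy_tail//.
have := c_ge0 z; rewrite le_eqVlt => /predU1P[cz|cz].
  rewrite integral0_eq ?lee_fin ?mulr_ge0 ?(ltW a0_gt0)// => s _.
  by rewrite -cz mulr0 mul0r mulr0.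
have mp (D : set R) : measurable_fun D (fun s : R => ((1 - s) `^ (c z - 1))%:E).
  apply/measurable_EFinP/measurable_funTS.
  apply: (measurableT_comp (measurable_powR _)); exact: measurable_funB.
apply: (@le_trans _ _ (\int[mu]_(s in `]0%R, 1%R[)
    ((u * a0 * c z)%:E * ((1 - s) `^ (c z - 1))%:E))%E).
  apply: ge0_le_integral => //.
  - move=> s /=; rewrite in_itv/= => /andP[s0 s1].
    rewrite lee_fin mulr_ge0//.
      by rewrite subr_ge0 expR_le1 oppr_le0 mulr_ge0// ltW.
    by rewrite !mulr_ge0 ?powR_ge0 ?invr_ge0 ?(ltW a0_gt0) ?(ltW s0).
  - apply/measurable_EFinP; apply: measurable_funM.
      apply: measurable_funB => //; apply: measurableT_comp => //.
      by apply: measurableT_comp => //; apply: measurable_funM.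
    apply: measurable_funM => //.
    by apply/measurable_EFinP; exact: measurable_levy_kernel.
  - by apply: emeasurable_funM => //; exact: mp.
  - move=> s /=; rewrite in_itv/= => /andP[s0 s1].
    rewrite -EFinM lee_fin /levy_kernel.
    apply: (@le_trans _ _ (u * s * (a0 * c z * (s^-1 * (1 - s) `^ (c z - 1))))).
      rewrite ler_wpM2r ?mulr_ge0 ?powR_ge0 ?invr_ge0 ?(ltW a0_gt0) ?(ltW s0)//.
      by rewrite lerBlDl -lerBlDr; have := expR_ge1Dx (- (u * s)); lra.
    rewrite le_eqVlt; apply/orP; left; apply/eqP.
    by field; rewrite gt_eqF.
rewrite ge0_integralZl//; last 3 first.
- exact: mp.
- by move=> s _; rewrite lee_fin powR_ge0.
- by rewrite lee_fin !mulr_ge0 ?(ltW a0_gt0).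
rewrite integral_onem_powR// subr0 powR1 -EFinM lee_fin.
by rewrite div1r mulfK// gt_eqF.
Qed.

End campbell.

(** * Integrating out one member of an independent family *)

Section integral_density.
Context d (T : measurableType d) (R : realType).
Variables (mu nu : {measure set T -> \bar R}) (g : T -> R).
Hypotheses (mg : measurable_fun setT g) (g0 : forall x, 0 <= g x).
Hypothesis nuE : forall A, measurable A -> nu A = (\int[mu]_(x in A) (g x)%:E)%E.

Import HBNNSimple.

Let integral_density_nnsfun (h : {nnsfun T >-> R}) :
  (\int[nu]_x (h x)%:E = \int[mu]_x ((h x)%:E * (g x)%:E))%E.
Proof.
under [LHS]eq_integral do rewrite fimfunE -fsumEFin//.
rewrite [LHS]ge0_integral_fsum//; last 2 first.
  - by move=> r; exact/measurable_EFinP/measurableT_comp.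
  - by move=> r x _; rewrite EFinM nnfun_muleindic_ge0.
have hE x : ((h x)%:E * (g x)%:E = \sum_(r \in range h)
    ((r * \1_(h @^-1` [set r]) x)%:E * (g x)%:E))%E.
  rewrite -ge0_mule_fsuml; last first.
    by move=> r; rewrite EFinM nnfun_muleindic_ge0.
  by rewrite fsumEFin// -fimfunE.
under [RHS]eq_integral do rewrite hE.
rewrite [RHS]ge0_integral_fsum//; last 2 first.
  - by move=> r; apply: emeasurable_funM; apply/measurable_EFinP => //; exact: measurableT_comp.
  - by move=> r x _; rewrite mule_ge0 ?lee_fin// -lee_fin EFinM nnfun_muleindic_ge0.
apply: eq_fsbigr => r; rewrite inE => -[x0 _ hx0].
rewrite integralZl_indic_nnsfun//= integral_indic// setIT nuE//.
rewrite [in LHS]integral_mkcond -ge0_integralZl//; last 3 first.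
- apply/(measurable_restrictT (EFin \o g)) => //.
  exact/measurable_funTS/measurable_EFinP.
- by move=> x _; apply: erestrict_ge0 => y _; rewrite lee_fin.
- by rewrite lee_fin -hx0.
apply: eq_integral => x _; rewrite EFinM patchE indicE.
by case: (x \in _); rewrite ?mule1// !mule0 mul0e.
Qed.

(** Monotone approximation by simple functions, for which the identity is the
    hypothesis on nu. *)
Lemma ge0_integral_density (f : T -> \bar R) : measurable_fun setT f ->
  (forall x, (0 <= f x)%E) -> (\int[nu]_x f x = \int[mu]_x (f x * (g x)%:E))%E.
Proof.
move=> mf f0; pose f_ := nnsfun_approx measurableT mf.
have f_f x : (f_ n x)%:E @[n --> \oo] --> f x by exact: cvg_nnsfun_approx.
transitivity (lim ((\int[nu]_x (f_ n x)%:E)%E @[n --> \oo])).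
  rewrite -monotone_convergence//=.
  - by apply: eq_integral => x _; apply/esym/cvg_lim.
  - by move=> n; exact/measurable_EFinP/measurable_funTS.
  - by move=> n x _; rewrite lee_fin.
  - by move=> x _ m n mn; rewrite lee_fin; exact/lefP/nd_nnsfun_approx.
transitivity (lim ((\int[mu]_x ((f_ n x)%:E * (g x)%:E))%E @[n --> \oo])).
  by apply: congr_lim; apply/funext => n; exact: integral_density_nnsfun.
rewrite -monotone_convergence//=.
- apply: eq_integral => x _; apply/cvg_lim => //.
  by apply: cvgeZr.
- by move=> n; apply: emeasurable_funM; apply/measurable_EFinP => //; exact: measurable_funTS.
- by move=> n x _; rewrite mule_ge0// lee_fin.
- move=> x _ m n mn; rewrite lee_wpmul2r ?lee_fin//; exact/lefP/nd_nnsfun_approx.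
Qed.

End integral_density.

Section freezing.
Context d (T : measurableType d) (R : realType) (P : probability T R).
Context (I : choiceType) (X : I -> T -> R).
Hypothesis mX : forall i, measurable_fun setT (X i).
Hypothesis indepX : mutually_independent P X.

(** A pi-system generating the sigma-algebra of the variables indexed by S. That
    sigma-algebra stands for the past in the conditioning arguments below. *)
Definition cylinders (S : set I) : set (set T) :=
  [set D | exists J : {fset I}, [set` J] `<=` S /\
    exists2 C : I -> set R, (forall i, measurable (C i)) &
      D = \bigcap_(i in [set` J]) (X i @^-1` C i)].

Lemma measurable_preimageX i (B : set R) : measurable B ->
  measurable (X i @^-1` B).
Proof. by move=> mB; rewrite -[_ @^-1` _]setTI; exact: mX. Qed.

Lemma cylinders_measurable S : cylinders S `<=` measurable.
Proof.
move=> D [J [_ [C mC ->]]]; apply: fin_bigcap_measurable => //.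
by move=> i _; exact: measurable_preimageX.
Qed.

Lemma cylindersT S : cylinders S setT.
Proof.
exists fset0; split=> //; exists (fun=> setT) => //.
by apply/seteqP; split.
Qed.

Lemma cylindersI S : setI_closed (cylinders S).
Proof.
move=> _ _ [J1 [J1S [C1 mC1 ->]]] [J2 [J2S [C2 mC2 ->]]].
exists (J1 `|` J2)%fset; split.
  by move=> i /=; rewrite inE => /orP[/J1S|/J2S].
exists (fun i => (if i \in J1 then C1 i else setT) `&`
  (if i \in J2 then C2 i else setT)).
  by move=> i; apply: measurableI; case: ifP.
apply/seteqP; split => w.
  move=> [h1 h2] i _; split; case: ifPn => // iJ; [exact: h1|exact: h2].
move=> h; split => i iJ.
  by have := h i; rewrite /= inE iJ => /(_ isT) [].
by have := h i; rewrite /= inE iJ orbT => /(_ isT) [].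
Qed.

Lemma cylinders_preimage S i (B : set R) : S i -> measurable B ->
  cylinders S (X i @^-1` B).
Proof.
move=> Si mB; exists [fset i]%fset; split.
  by move=> j /=; rewrite inE => /eqP ->.
exists (fun=> B) => //; apply/seteqP; split => w.
  by move=> h j /=; rewrite inE => /eqP ->.
by move=> /(_ i); rewrite /= inE; apply.
Qed.

(** Both sides are finite measures in D that agree on cylinders, hence on the
    generated sigma-algebra. *)
Lemma cylinders_indep S j D (B : set R) : ~ S j -> measurable B ->
  <<s cylinders S >> D ->
  (P (D `&` X j @^-1` B) = P D * P (X j @^-1` B))%E.
Proof.
move=> Sj mB.
have mXB := measurable_preimageX j mB.
have k0 : 0 <= fine (P (X j @^-1` B)) by exact: fine_ge0.
pose m1 : {measure set T -> \bar R} := mrestr P mXB.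
pose m2 : {measure set T -> \bar R} := mscale (NngNum k0) P.
have m2E A : m2 A = (P A * P (X j @^-1` B))%E.
  by rewrite /m2/= /mscale/= fineK ?fin_num_measure// muleC.
rewrite -m2E.
apply: (@g_sigma_algebra_measure_unique _ R T (cylinders S)
  (@cylinders_measurable S) (fun=> setT) _ _ m1 m2).
- by move=> _; exact: cylindersT.
- by rewrite bigcup_const//; exists 0%N.
- exact: cylindersI.
- move=> _ [J [JS [C mC ->]]]; rewrite m2E /m1/= /mrestr.
  have jJ : j \notin J by apply/negP => /JS.
  pose C' i := if i == j then B else C i.
  have mC' i : measurable (C' i) by rewrite /C'; case: ifP.
  have h1 := @indepX (j |` J)%fset _ mC'.
  have h2 := @indepX J _ mC.
  have C'j : C' j = B by rewrite /C' eqxx.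
  rewrite big_fsetU1//= C'j in h1.
  rewrite (_ : _ `&` _ = \bigcap_(i in [set` (j |` J)%fset]) (X i @^-1` C' i)).
    rewrite h1 h2 muleC; congr (_ * _)%E; apply: eq_big_seq => i iJ.
    by rewrite /C' ifN//; apply: contraNneq jJ => <-.
  apply/seteqP; split => w.
    move=> [h Bw] i /=; rewrite !inE /C'; case: eqP => [-> _|_ /=]; first exact: Bw.
    exact: h.
  move=> h; split => [i iJ|].
    have := h i; rewrite /= !inE iJ orbT /C' ifN; first exact.
    by apply: contraNneq jJ => <-.
  by have := h j; rewrite /= !inE eqxx /C' eqxx; exact.
- by move=> _; rewrite /m1/= /mrestr setTI (le_lt_trans (probability_le1 _ _))// ltry.
Qed.

Notation past S := (g_sigma_algebraType (cylinders S)).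

Lemma measurable_past S i : S i -> measurable_fun setT (X i : past S -> R).
Proof.
move=> Si _ B mB; rewrite setTI; apply: sub_sigma_algebra.
exact: cylinders_preimage.
Qed.

(** Conditioning on the past of a function of the past and of one more independent
    variable: that variable can be integrated out with the past held fixed. The
    function takes the whole sample point as first argument, which is harmless
    because it is measurable for the past only. *)
Lemma integral_freezing S j (nu : probability R R)
    (phi : past S * R -> \bar R) : ~ S j ->
  (forall B, measurable B -> nu B = P (X j @^-1` B)) ->
  measurable_fun setT phi -> (forall q, (0 <= phi q)%E) ->
  (\int[P]_w phi (w : past S, X j w) = \int[P]_w \int[nu]_v phi (w : past S, v))%E.
Proof.
move=> Sj nuE mphi phi0.
pose idp : T -> past S := id.
have midp : measurable_fun setT idp.
  move=> _ B mB; rewrite setTI.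
  exact: (smallest_sub (@sigma_algebra_measurable _ T) (@cylinders_measurable S)).
pose pX w := (idp w, X j w).
have mpX : measurable_fun setT pX by exact: measurable_fun_pair.
pose idm : {mfun T >-> past S} := HB.pack idp (isMeasurableFun.Build _ _ _ _ _ midp).
pose pXm : {mfun T >-> (past S * R)%type} := HB.pack pX (isMeasurableFun.Build _ _ _ _ _ mpX).
pose P' := distribution P idm.
pose Q := distribution P pXm.
have QE A : measurable A -> (P' \x nu)%E A = Q A.
  apply: product_measure_unique => A' B mA mB.
  rewrite /Q/= /distribution/pushforward/= nuE//.
  rewrite (_ : pX @^-1` _ = A' `&` X j @^-1` B)//.
  exact: (@cylinders_indep S j A' B Sj mB mA).
transitivity (\int[Q]_q phi q)%E.
  by rewrite ge0_integral_pushforward.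
rewrite (eq_measure_integral (P' \x nu)%E); last by move=> A mA _; exact/esym/QE.
rewrite fubini_tonelli1// ge0_integral_pushforward//.
- exact: measurable_fun_fubini_tonelli_F.
- by move=> w _; exact: integral_ge0.
Qed.

End freezing.

(** * Exponential waiting times and a renewal identity *)

Section exponential_integrals.
Context {R : realType}.
Notation mu := (@lebesgue_measure R).

Lemma cvg_expR I (F : set_system I) (FF : Filter F) (u : I -> R) (l : R) :
  u i @[i --> F] --> l -> expR (u i) @[i --> F] --> expR l.
Proof. by move=> ul; exact: (cvg_comp _ _ ul (@continuous_expR R l)). Qed.

Lemma integral_expR_rate (r : R) : 0 < r ->
  (\int[mu]_(s in `]0%R, +oo[) (expR (- (r * s)))%:E = r^-1%:E)%E.
Proof.
move=> r0; have := integral_exponential_pdf r0.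
have -> : (\int[mu]_x (exponential_pdf r x)%:E =
    \int[mu]_(x in `[0%R, +oo[) (r%:E * (expR (- (r * x)))%:E))%E.
  rewrite [RHS]integral_mkcond; apply: eq_integral => x _.
  rewrite /exponential_pdf !patchE; case: ifPn => // _.
  by rewrite EFinM mulNr.
have me (D : set R) : measurable_fun D (fun s : R => (expR (- (r * s)))%:E).
  apply/measurable_EFinP/measurable_funTS/measurableT_comp => //.
  by apply: measurableT_comp => //; exact: measurable_funM.
rewrite ge0_integralZl//; last 2 first.
- exact: me.
- by rewrite lee_fin ltW.
rewrite integral_itv_obnd_cbnd; last exact: me.
set J := (\int[mu]_(_ in _) _)%E => h.
have := congr1 (fun y => r^-1%:E * y)%E h.
by rewrite muleA -EFinM mulVf ?gt_eqF// mul1e mule1.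
Qed.

(** X is transported to the copy of the line that carries Lebesgue measure, where
    its law has the exponential density. *)
Lemma integral_exponential_law d (T : measurableType d) (P : probability T R)
    (X : {RV P >-> R}) (g : R -> \bar R) :
  (forall B, measurable B -> distribution P X B = exponential_prob 1 B) ->
  measurable_fun setT g -> (forall v, (0 <= g v)%E) ->
  (\int[P]_w g (X w) =
   \int[mu]_(v in `]0%R, +oo[) (g v * (expR (- v))%:E))%E.
Proof.
move=> XE mg g0; pose X' : T -> measurableTypeR R := X.
have mX' : measurable_fun setT X' by exact: measurable_funPT X.
pose Xm : {mfun T >-> measurableTypeR R} :=
  HB.pack X' (isMeasurableFun.Build _ _ _ _ _ mX').
pose nu := distribution P Xm.
have nuE A : measurable A ->
    nu A = (\int[mu]_(x in A) (exponential_pdf 1 x)%:E)%E.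
  by move=> mA; rewrite -[RHS]/(exponential_prob 1 A) -XE.
transitivity (\int[nu]_v g v)%E; first by rewrite ge0_integral_pushforward.
rewrite (@ge0_integral_density _ _ _ mu nu _ _ _ nuE)//; last 2 first.
- exact: measurable_exponential_pdf.
- by move=> x; apply: exponential_pdf_ge0.
have mge (D : set R) : measurable_fun D (fun v => (g v * (expR (- v))%:E)%E).
  apply: measurable_funTS; apply: emeasurable_funM => //.
  by apply/measurable_EFinP; exact: measurableT_comp.
rewrite integral_itv_obnd_cbnd; last exact: mge.
rewrite [RHS]integral_mkcond; apply: eq_integral => x _.
rewrite /exponential_pdf !patchE; case: ifPn => _; last by rewrite mule0.
by rewrite mul1r mulN1r.
Qed.

End exponential_integrals.

Section renewal_equation.
Context {R : realType}.
Notation mu := (@lebesgue_measure R).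
Variable k : R -> R.
Hypotheses (k_cont : continuous k) (k_ge0 : forall x, 0 <= k x)
  (k_le1 : forall x, k x <= 1).
Hypothesis k_fin : (\int[mu]_(x in `[(-1)%R, +oo[) (k x)%:E < +oo)%E.

Let mk (D : set R) : measurable_fun D (EFin \o k).
Proof.
apply/measurable_EFinP; apply: measurable_funTS.
exact: continuous_measurable_fun.
Qed.

(** The integrals start at -1, not at 0, so that the derivative of the cumulative
    rate exists in the two-sided sense at every time that matters, 0 included. *)
Definition cumulative_rate (x : R) := \int[mu]_(t in `[(-1)%R, x]) k t.
Definition total_rate := \int[mu]_(t in `[(-1)%R, +oo[) k t.

Local Notation K := cumulative_rate.
Local Notation kappa := total_rate.

Let k_int : mu.-integrable `[(-1)%R, +oo[ (EFin \o k).
Proof.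
apply/integrableP; split; first exact: mk.
by under eq_integral do rewrite /= ger0_norm//.
Qed.

Let k_intx (x : R) : mu.-integrable `[(-1)%R, x] (EFin \o k).
Proof.
apply: integrableS k_int => //.
by move=> y /=; rewrite !in_itv/= => /andP[->].
Qed.

(** The probability that an inhomogeneous Poisson process of rate k has no point
    after time x. *)
Definition survival (x : R) := expR (K x - kappa).

Let K_derivable (x : R) : -1 < x -> derivable K x 1 /\ K^`()%classic x = k x.
Proof.
move=> x1; have xx1 : x < x + 1 by rewrite ltrDl.
have ckx : {for x, continuous k} by exact: k_cont.
have [dK KE] := @continuous_FTC1_closed R k (-1) x (x + 1) xx1 (k_intx _) x1 ckx.
by split; [exact: dK|exact: KE].
Qed.

Let K_is_derive (x : R) : -1 < x -> is_derive x 1 K (k x).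
Proof. by move=> /K_derivable[dK <-]; rewrite derive1E; split. Qed.

Let K_le (x y : R) : x <= y -> K x <= K y.
Proof.
move=> xy; apply: fine_le.
- exact: integrable_fin_num (k_intx x).
- exact: integrable_fin_num (k_intx y).
- apply: ge0_subset_integral => //; first exact: mk.
    by move=> t _; rewrite lee_fin.
  by move=> t /=; rewrite !in_itv/= => /andP[-> /le_trans]; exact.
Qed.

Let K_le_kappa (x : R) : K x <= kappa.
Proof.
apply: fine_le.
- exact: integrable_fin_num (k_intx x).
- exact: integrable_fin_num k_int.
- apply: ge0_subset_integral => //; first exact: mk.
    by move=> t _; rewrite lee_fin.
  by move=> t /=; rewrite !in_itv/= => /andP[->].
Qed.

Lemma measurable_survival : measurable_fun setT survival.
Proof.
apply: (measurableT_comp (@measurable_expR R)); apply: measurable_funB => //.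
by apply: nondecreasing_measurable => // x y; exact: K_le.
Qed.

Lemma survival_ge0 x : 0 <= survival x. Proof. exact: expR_ge0. Qed.

Lemma survival_le1 x : survival x <= 1.
Proof. by rewrite /survival expR_le1 subr_le0. Qed.

Lemma survival_cvgy (u : R^nat) : u n @[n --> \oo] --> +oo ->
  survival (u n) @[n --> \oo] --> (1 : R).
Proof.
move=> uy; rewrite -expR0.
suff Ku : K (u n) - kappa @[n --> \oo] --> (0 : R).
  exact: cvg_expR.
rewrite -[X in _ --> X](subrr kappa); apply: cvgB; last exact: cvg_cst.
have hn : K n%:R @[n --> \oo] --> kappa.
  apply: fine_cvg; rewrite /total_rate /Rintegral fineK; last exact: integrable_fin_num k_int.
  have -> : `[(-1)%R, +oo[%classic = \bigcup_n `[(-1)%R, n%:R]%classic :> set R.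
    apply/seteqP; split => x /=; rewrite ?in_itv/= ?andbT.
      move=> x1; exists (Num.truncn `|x|).+1 => //=; rewrite in_itv/= x1/=.
      by rewrite (le_trans (ler_norm x))// ltW// truncnS_gt.
    by move=> [n _ /=]; rewrite in_itv/= => /andP[].
  apply: ge0_nondecreasing_set_cvg_integral.
  - move=> m n mn; apply/subsetPset => x /=; rewrite !in_itv/= => /andP[-> h].
    by rewrite (le_trans h)// ler_nat.
  - by move=> n; exact: measurable_itv.
  - by move=> n; exact: mk.
  - by move=> n x _; rewrite lee_fin.
apply/cvgrPdist_le => e e0.
move/cvgrPdist_le : hn => /(_ e e0) [N _ /(_ N (leqnn N))] /=.
rewrite ger0_norm ?subr_ge0// => hN.
have uN : \forall n \near \oo, N%:R <= u n by move/cvgryPge : uy; apply.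
apply: filterS uN => n Nu.
rewrite ger0_norm ?subr_ge0//; apply: le_trans hN.
by rewrite lerD2l lerN2 K_le.
Qed.

Lemma survival0 :
  (survival 0)%:E = expeR (- \int[mu]_(x in `]0%R, +oo[) (k x)%:E)%E.
Proof.
have k0int : mu.-integrable `]0%R, +oo[ (EFin \o k).
  apply: integrableS k_int => //.
  by move=> y /=; rewrite !in_itv/= !andbT => /ltW; apply: le_trans; rewrite lerN10.
have kfin : (\int[mu]_(x in `]0%R, +oo[) (k x)%:E)%E \is a fin_num.
  exact: integrable_fin_num k0int.
rewrite -(fineK kfin) -EFinN /= /survival; congr (expR _)%:E.
suff -> : kappa = K 0 + fine (\int[mu]_(x in `]0%R, +oo[) (k x)%:E)%E.
  by rewrite opprD addrA subrr sub0r.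
apply: EFin_inj; rewrite EFinD !fineK//; last 2 first.
- exact: integrable_fin_num (k_intx 0).
- exact: integrable_fin_num k_int.
have -> : `[(-1)%R, +oo[%classic = `[(-1)%R, 0%R] `|` `]0%R, +oo[ :> set R.
  by rewrite -itv_bndbnd_setU// bnd_simp lerN10.
rewrite ge0_integral_setU//=.
- exact: mk.
- by move=> x _; rewrite lee_fin.
- rewrite disj_set2E; apply/eqP/seteqP; split => // x [] /=.
  by rewrite !in_itv/= andbT => /andP[_ h1] h2; move: h1; rewrite leNgt h2.
Qed.

(** Look at the first arrival after g in a unit rate Poisson process: it comes after
    an exponential delay v, is not selected with probability 1 - k (g + v), and the
    process starts afresh from g + v. Analytically, the integrand is the derivative
    of - exp (- v) * survival (g + v). *)
Lemma renewal_equation (g : R) : 0 <= g ->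
  (\int[mu]_(v in `]0%R, +oo[)
     (((1 - k (g + v)) * survival (g + v))%:E * (expR (- v))%:E) =
   (survival g)%:E)%E.
Proof.
move=> g0; pose Q v := - expR (K (g + v) - kappa - v).
pose q v := (1 - k (g + v)) * survival (g + v) * expR (- v).
have gv v : 0 <= v -> -1 < g + v.
  by move=> v0; rewrite (@lt_le_trans _ _ 0) ?ltrN10// addr_ge0.
have dKg (v : R) : 0 <= v -> is_derive v 1 (fun v : R => K (g + v)) (k (g + v)).
  move=> v0; have h1 := K_is_derive (gv v v0).
  have h2 : is_derive v 1 (fun v : R => g + v) 1.
    split; first exact: derivableD.
    by rewrite deriveD// derive_cst derive_id add0r.
  have := @is_derive1_comp _ K (fun v : R => g + v) v _ _ h1 h2.
  by rewrite mulr1.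
have dQ (v : R) : 0 <= v -> is_derive v 1 Q (q v).
  move=> v0; have h1 := dKg v v0.
  have h2 : is_derive v 1 (fun v : R => K (g + v) - kappa - v) (k (g + v) - 1).
    have d1 : derivable (fun v : R => K (g + v)) v 1 by exact: ex_derive.
    have d2 : derivable (fun v : R => K (g + v) - kappa) v 1.
      by apply: derivableB; [exact: d1|exact: derivable_cst].
    split; first by apply: derivableB; [exact: d2|exact: derivable_id].
    rewrite deriveB; [|exact: d2|exact: derivable_id].
    rewrite deriveB; [|exact: d1|exact: derivable_cst].
    by rewrite derive_cst subr0 derive_id (@derive_val _ _ _ _ _ _ _ h1).
  have h3 := is_derive_expR (K (g + v) - kappa - v).
  have := @is_derive1_comp _ expR (fun v => K (g + v) - kappa - v) v _ _ h3 h2.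
  move=> h4; split; first by apply: derivableN; exact: ex_derive.
  rewrite deriveN; last exact: ex_derive.
  rewrite (@derive_val _ _ _ _ _ _ _ h4) /q /survival expRD; ring.
have cKg (v : R) : 0 <= v -> {for v, continuous (fun v : R => K (g + v))}.
  move=> v0; apply: differentiable_continuous; apply/derivable1_diffP.
  by have h1 := dKg v v0; exact: ex_derive.
have cq (v : R) : 0 <= v -> {for v, continuous q}.
  move=> v0; apply: cvgM; first apply: cvgM.
  - apply: cvgB; first exact: cvg_cst.
    apply: (@cvg_comp _ _ _ (fun v : R => g + v) k); last exact: k_cont.
    by apply: cvgD; [exact: cvg_cst|exact: cvg_id].
  - by apply: cvg_expR; apply: cvgB; [exact: cKg|exact: cvg_cst].
  - by apply: cvg_expR; apply: cvgN; exact: cvg_id.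
transitivity (\int[mu]_(v in `[0%R, +oo[) (q v)%:E)%E.
  rewrite -integral_itv_obnd_cbnd.
    by apply: eq_integral => v _; rewrite -EFinM.
  apply/measurable_EFinP; apply: open_continuous_measurable_fun => //.
  by move=> v; rewrite inE/= in_itv/= andbT => v0; apply: cq; exact: ltW.
rewrite (@ge0_continuous_FTC2y _ q Q 0 0)//.
- by rewrite /Q addr0 subr0 EFinN oppeK add0e.
- by move=> v _; rewrite /q !mulr_ge0 ?expR_ge0 ?survival_ge0// subr_ge0.
- apply: continuous_in_subspaceT => v; rewrite inE/= in_itv/= andbT.
  exact: cq.
- rewrite -[X in _ --> X]oppr0; apply: cvgN.
  apply: (@squeeze_cvgr _ _ _ _ (cst 0) (fun v => expR (- v))).
  + apply: nearW => v; rewrite expR_ge0/= ler_expR.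
    by rewrite gerDr subr_le0.
  + exact: cvg_cst.
  + exact: cvgr_expR.
- by move=> v /ltW v0; have h := dQ v v0; exact: ex_derive.
- apply: cvg_at_right_filter.
  apply: cvgN; apply: cvg_expR; apply: cvgB; last exact: cvg_id.
  by apply: cvgB; [exact: cKg|exact: cvg_cst].
- move=> v; rewrite in_itv/= andbT => /ltW v0; rewrite derive1E.
  by have h := dQ v v0; exact: derive_val.
Qed.

End renewal_equation.

(** * Laplace functional of a marked Poisson process *)

Section marked_poisson.
Context d (T : measurableType d) (R : realType) (P : probability T R).
Notation mu := (@lebesgue_measure R).
Variables theta E : nat -> {RV P >-> R}.
Hypothesis theta_law : forall i (B : set R), measurable B ->
  distribution P (theta i) B = distribution P (theta 0%N) B.
Hypothesis E_law : forall i (B : set R), measurable B ->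
  distribution P (E i) B = exponential_prob 1 B.

Let X (j : nat + nat) : T -> R :=
  match j with inl i => theta i : T -> R | inr i => E i : T -> R end.

Hypothesis indep : mutually_independent P X.

Let mX j : measurable_fun setT (X j).
Proof. by case: j => i; exact: measurable_funPT. Qed.

(** Indexed so that time 0 is 0, which starts the recursion; the arrival times
    are the values at successors. *)
Definition partial_time (n : nat) (w : T) : R := \sum_(i < n) E i w.

Lemma partial_timeS n w : partial_time n.+1 w = partial_time n w + E n w.
Proof. by rewrite /partial_time big_ord_recr. Qed.

Lemma partial_time0 w : partial_time 0 w = 0.
Proof. by rewrite /partial_time big_ord0. Qed.

Lemma ae_exponential_gt0 : {ae P, forall w i, 0 < E i w}.
Proof.
apply: ae_foralln => i.
have mA : measurable (`]-oo, 0%R]%classic : set R) by exact: measurable_itv.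
exists (E i @^-1` `]-oo, 0%R]%classic); split.
- by rewrite -[_ @^-1` _]setTI; exact: (measurable_funPT (E i)).
- rewrite -[LHS]/(distribution P (E i) _) E_law// /exponential_prob.
  rewrite -integral_itv_bndo_bndc; last first.
    by apply/measurable_EFinP/measurable_funTS; exact: measurable_exponential_pdf.
  apply: integral0_eq => x /=; rewrite in_itv/= => x0.
  by rewrite lt0_exponential_pdf.
- by move=> w /= h; rewrite in_itv/= leNgt; exact/negP.
Qed.

Lemma ae_partial_time_ge0 : {ae P, forall w n, 0 <= partial_time n w}.
Proof.
apply: filterS ae_exponential_gt0 => w Ew n.
by apply: sumr_ge0 => i _; exact: ltW.
Qed.

Let pastE n : set (nat + nat) :=
  [set j | match j with inl i => (i < n)%N | inr i => (i < n)%N end].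
Let pastT n : set (nat + nat) :=
  [set j | match j with inl i => (i < n)%N | inr i => (i <= n)%N end].

Local Notation past S := (g_sigma_algebraType (cylinders X S)).

Lemma freeze_E (S : set (nat + nat)) n (phi : past S * R -> \bar R) :
  ~ S (inr n) -> measurable_fun setT phi -> (forall q, (0 <= phi q)%E) ->
  (\int[P]_w phi (w : past S, E n w) =
   \int[P]_w \int[mu]_(v in `]0%R, +oo[)
     (phi (w : past S, v) * (expR (- v))%:E))%E.
Proof.
move=> Sn mphi phi0.
rewrite (@integral_freezing _ _ _ P _ X mX indep S (inr n) (distribution P (E 0%N)))//.
  apply: eq_integral => w _.
  rewrite ge0_integral_pushforward//=.
    apply: (integral_exponential_law (E_law 0)) => //.
    exact: measurableT_comp.
  exact: measurableT_comp.
by move=> B mB; exact: (etrans (E_law 0%N mB) (esym (E_law n mB))).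
Qed.

Lemma freeze_theta (S : set (nat + nat)) n (phi : past S * R -> \bar R) :
  ~ S (inl n) -> measurable_fun setT phi -> (forall q, (0 <= phi q)%E) ->
  (\int[P]_w phi (w : past S, theta n w) =
   \int[P]_w \int[distribution P (theta 0%N)]_z phi (w : past S, z))%E.
Proof.
move=> Sn mphi phi0.
rewrite (@integral_freezing _ _ _ P _ X mX indep S (inl n) (distribution P (theta 0%N)))//.
by move=> B mB; exact: (esym (theta_law n mB)).
Qed.

Lemma measurable_partial_time (S : set (nat + nat)) n :
  (forall i, (i < n)%N -> S (inr i)) ->
  measurable_fun setT (partial_time n : past S -> R).
Proof.
move=> Si; rewrite /partial_time.
have h (i : 'I_n) : measurable_fun setT (E i : past S -> R).
  exact: (@measurable_past _ _ _ _ X S (inr (nat_of_ord i)) (Si i (ltn_ord i))).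
exact: (@measurable_sum _ (past S) R setT _ _ (fun i : 'I_n => E i : past S -> R)).
Qed.

Lemma expectation_expR_partial_time n :
  (\int[P]_w (expR (- (3 * partial_time n w)))%:E = ((4^-1) ^+ n)%:E)%E.
Proof.
elim: n => [|n IH].
  under eq_integral do rewrite partial_time0 mulr0 oppr0 expR0.
  by rewrite integral_cst// mul1e; exact: probability_setT.
have mS : measurable_fun setT (partial_time n : past (pastE n) -> R).
  by apply: measurable_partial_time.
pose phi (q : past (pastE n) * R) :=
  (expR (- (3 * partial_time n q.1)) * expR (- (3 * q.2)))%:E.
have mphi : measurable_fun setT phi.
  apply/measurable_EFinP; apply: measurable_funM.
    apply: (measurableT_comp (@measurable_expR R)); apply: measurable_funN.
    apply: measurable_funM => //.
    exact: (measurableT_comp mS measurable_fst).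
  apply: (measurableT_comp (@measurable_expR R)); apply: measurable_funN.
  exact: measurable_funM.
transitivity (\int[P]_w phi (w : past (pastE n), E n w))%E.
  apply: eq_integral => w _; rewrite /phi/= partial_timeS.
  by rewrite mulrDr opprD expRD.
rewrite freeze_E//; last 2 first.
- by rewrite /pastE/= ltnn.
- by move=> q; rewrite lee_fin mulr_ge0 ?expR_ge0.
transitivity (\int[P]_w ((expR (- (3 * partial_time n w)))%:E * (4^-1)%:E))%E.
  apply: eq_integral => w _; rewrite /phi/=.
  under eq_integral => v _.
    rewrite -EFinM -mulrA -expRD -opprD.
    rewrite (_ : 3 * v + v = 4 * v); last by ring.
    rewrite EFinM; over.
  rewrite ge0_integralZl//.
  - by rewrite integral_expR_rate.
  - apply/measurable_EFinP/measurable_funTS.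
    apply: (measurableT_comp (@measurable_expR R)); apply: measurable_funN.
    exact: measurable_funM.
rewrite ge0_integralZr//.
- by rewrite IH -EFinM exprSr.
- apply/measurable_EFinP.
  apply: (measurableT_comp (@measurable_expR R)); apply: measurable_funN.
  apply: measurable_funM => //.
  exact: (@measurable_sum _ T R setT _ _ (fun i : 'I_n => E i : T -> R)).
Qed.

Lemma measurable_partial_timeT n : measurable_fun setT (partial_time n).
Proof. exact: (@measurable_sum _ T R setT _ _ (fun i : 'I_n => E i : T -> R)). Qed.

(** The expectation of exp (- 3 S_n) is 4 ^ (- n), so the sum of
    2 ^ n * exp (- 3 S_n) has finite expectation and converges almost surely.
    Boundedness of its terms already forces S_n to grow at least linearly. *)
Lemma ae_partial_time_growth : {ae P, forall w, exists2 l : R, 0 < l &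
  \forall n \near \oo, l * n%:R <= partial_time n w}.
Proof.
pose G n w := (2 ^+ n * expR (- (3 * partial_time n w)))%:E.
have G0 n w : (0 <= G n w)%E by rewrite lee_fin mulr_ge0 ?expR_ge0.
have mexp n : measurable_fun setT (fun w => (expR (- (3 * partial_time n w)))%:E).
  apply/measurable_EFinP.
  apply: (measurableT_comp (@measurable_expR R)); apply: measurable_funN.
  by apply: measurable_funM => //; exact: measurable_partial_timeT.
have mG n : measurable_fun setT (G n).
  rewrite (_ : G n = (fun w => (2 ^+ n)%:E * (expR (- (3 * partial_time n w)))%:E)%E).
    exact: emeasurable_funM.
  by apply/funext => w; rewrite /G EFinM.
have mSG : measurable_fun setT (fun w => \sum_(n <oo) G n w)%E.
  by apply: ge0_emeasurable_sum.
have intG : (\int[P]_w \sum_(n <oo) G n w = (2 : R)%:E)%E.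
  rewrite integral_nneseries//.
  transitivity (\sum_(n <oo) ((2 / (2 ^ (n + 1))%:R : R)%:E))%E.
    apply: eq_eseriesr => n _; rewrite /G.
    under eq_integral do rewrite EFinM.
    rewrite ge0_integralZl//.
    rewrite expectation_expR_partial_time -EFinM; congr EFin.
    rewrite -exprMn addn1 expnS natrM natrX.
    rewrite (_ : 2 * 4^-1 = 2^-1 :> R); last by field.
    by rewrite exprVn; field; rewrite expf_neq0.
  apply/cvg_lim => //.
  have := @cvg_geometric_eseries_half R 2 0.
  by rewrite expr0 divr1.
have : P.-integrable setT (fun w => \sum_(n <oo) G n w)%E.
  apply/integrableP; split => //.
  under eq_integral do rewrite gee0_abs ?nneseries_ge0//.
  by rewrite intG ltry.
move/(integrable_ae measurableT); apply: filterS => w /(_ I) fin.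
pose K := fine (\sum_(n <oo) G n w)%E.
have GK n : 2 ^+ n * expR (- (3 * partial_time n w)) <= K.
  rewrite -lee_fin /K fineK//.
  apply: le_trans (nneseries_lim_ge n.+1 _) => //.
  by rewrite big_nat_recr//= leeDr// sume_ge0.
have K0 : 0 < K.
  by rewrite (lt_le_trans _ (GK 0%N))// partial_time0 mulr0 oppr0 expR0 mulr1.
have ln20 : 0 < ln 2 :> R by rewrite ln_gt0// ltr1n.
(* The slope of the exact bound is ln 2 / 3; half of it absorbs ln K. *)
exists (ln 2 / 6); first by rewrite divr_gt0.
have Sn n : n%:R * ln 2 - 3 * partial_time n w <= ln K.
  rewrite -ler_expR expRD expRM_natl !lnK ?posrE//; exact: GK.
near=> n.
have h : 2 * ln K / ln 2 <= n%:R.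
  by near: n; exact: nbhs_infty_ger.
have : 2 * ln K <= n%:R * ln 2 by rewrite -ler_pdivrMr.
by have := Sn n; lra.
Unshelve. all: by end_near. Qed.

Lemma cvg_expRN_nneseries (a : nat -> R) : (forall i, 0 <= a i) ->
  (expR (- \sum_(i < n) a i))%:E @[n --> \oo] -->
  expeR (- \sum_(i <oo) (a i)%:E)%E.
Proof.
move=> a0.
set L := (\sum_(i <oo) (a i)%:E)%E.
have L0 : (0 <= L)%E by apply: nneseries_ge0 => i _ _; rewrite lee_fin.
have : (\sum_(i < n) a i)%:E @[n --> \oo] --> L.
  rewrite (_ : (fun n => _) = (fun n => \sum_(0 <= i < n) (a i)%:E)%E).
    by apply: is_cvg_nneseries => i _ _; rewrite lee_fin.
  by apply/funext => n; rewrite big_mkord -sumEFin.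
move: L L0 => [l| |]// _.
  move=> /fine_cvg h; apply: cvg_EFin; first by near=> n.
  by apply: cvg_expR; apply: cvgN.
move=> /cvgeyPge h; rewrite /= /expeR/=.
apply: cvg_EFin; first by near=> n.
have ac : (fun n => \sum_(i < n) a i) @ \oo --> +oo.
  apply/cvgryPge => A; have := h A; apply: filterS => n.
  by rewrite lee_fin.
exact: (cvg_comp _ _ ac (@cvgr_expR R)).
Unshelve. all: by end_near. Qed.

Variable f : R * R -> R.
Hypotheses (mf : measurable_fun setT f) (f_ge0 : forall q, 0 <= f q)
  (f_cont : forall z, continuous (fun x => f (z, x))).

Let Pi := distribution P (theta 0%N).

Hypothesis f_fin : (\int[mu]_(x in `]0%R, +oo[)
  \int[Pi]_z (1 - expR (- f (z, x)))%:E < +oo)%E.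

(** Weighting every point (theta_i, S_i) by exp (- f) amounts to deleting a point
    at time x with this probability; the Laplace functional is the probability that
    no point is deleted. *)
Definition hit_rate (x : R) : R := fine (\int[Pi]_z (1 - expR (- f (z, x)))%:E)%E.

Let gap_ge0 q : 0 <= 1 - expR (- f q).
Proof. by rewrite subr_ge0 expR_le1 oppr_le0. Qed.

Let gap_le1 q : 1 - expR (- f q) <= 1.
Proof. by rewrite gerBl expR_ge0. Qed.

Let mgap x : measurable_fun setT (fun z => (1 - expR (- f (z, x)))%:E).
Proof.
apply/measurable_EFinP; apply: measurable_funB => //.
apply: (measurableT_comp (@measurable_expR R)); apply: measurable_funN.
exact: (@measurable_fun_pair1 _ _ _ _ _ _ f x mf).
Qed.

Let int_gap_le1 x : (\int[Pi]_z (1 - expR (- f (z, x)))%:E <= 1)%E.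
Proof.
apply: (@le_trans _ _ (\int[Pi]_z (cst 1%E z))%E).
  by apply: ge0_le_integral => // z _; rewrite lee_fin.
by rewrite integral_cst// mul1e; apply: probability_le1.
Qed.

Let hit_rateE x : (hit_rate x)%:E = (\int[Pi]_z (1 - expR (- f (z, x)))%:E)%E.
Proof.
rewrite /hit_rate fineK// ge0_fin_numE; first exact: le_lt_trans (ltry 1).
by apply: integral_ge0 => z _; rewrite lee_fin.
Qed.

Let hit_rate_ge0 x : 0 <= hit_rate x.
Proof. by apply: fine_ge0; apply: integral_ge0 => z _; rewrite lee_fin. Qed.

Let hit_rate_le1 x : hit_rate x <= 1.
Proof. by rewrite -lee_fin hit_rateE. Qed.

Let hit_rate_cont : continuous hit_rate.
Proof.
move=> x; apply/(@cvg_nbhsP _ R^o) => u ux.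
suff : (\int[Pi]_z (1 - expR (- f (z, u n)))%:E @[n --> \oo] -->
    \int[Pi]_z (1 - expR (- f (z, x)))%:E)%E.
  rewrite -hit_rateE; under eq_fun do rewrite -hit_rateE.
  by move/fine_cvg.
apply: (@dominated_cvg _ _ _ Pi setT measurableT
  (fun n z => (1 - expR (- f (z, u n)))%:E) (fun z => (1 - expR (- f (z, x)))%:E)
  (cst 1%E)) => //.
- move=> z _; apply: cvg_EFin; first by near=> n.
  apply: cvgB; first exact: cvg_cst.
  apply: cvg_expR; apply: cvgN.
  by apply: (@cvg_comp _ _ _ u (fun x => f (z, x)) _ (nbhs x)) => //; exact: f_cont.
- by apply: finite_measure_integrable_cst.
- by move=> n z _; rewrite gee0_abs ?lee_fin.
Unshelve. all: by end_near. Qed.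

Let hit_rate_fin : (\int[mu]_(x in `[(-1)%R, +oo[) (hit_rate x)%:E < +oo)%E.
Proof.
have mh (D : set R) : measurable_fun D (fun x => (hit_rate x)%:E).
  apply/measurable_EFinP; apply: measurable_funTS.
  exact: continuous_measurable_fun.
have -> : `[(-1)%R, +oo[%classic = `[(-1)%R, 0%R] `|` `]0%R, +oo[ :> set R.
  by rewrite -itv_bndbnd_setU// bnd_simp lerN10.
rewrite ge0_integral_setU//=; last 3 first.
- exact: mh.
- by move=> x _; rewrite lee_fin.
- rewrite disj_set2E; apply/eqP/seteqP; split => // x [] /=.
  by rewrite !in_itv/= andbT => /andP[_ h1] h2; move: h1; rewrite leNgt h2.
rewrite lte_add_pinfty//; last by under eq_integral do rewrite hit_rateE.
apply: (@le_lt_trans _ _ (\int[mu]_(x in `[(-1)%R, 0%R]) (cst 1%E x))%E).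
  apply: ge0_le_integral => //.
  - by move=> x _; rewrite lee_fin.
  - exact: mh.
  - by move=> x _; rewrite lee_fin.
by rewrite integral_cst//= lebesgue_measure_itv/= lte_fin ltrN10 mul1e -EFinB ltry.
Qed.

Let int_expRNf x : (\int[Pi]_z (expR (- f (z, x)))%:E = (1 - hit_rate x)%:E)%E.
Proof.
have mexp : measurable_fun setT (fun z => (expR (- f (z, x)))%:E).
  apply/measurable_EFinP.
  apply: (measurableT_comp (@measurable_expR R)); apply: measurable_funN.
  exact: (@measurable_fun_pair1 _ _ _ _ _ _ f x mf).
have h : (\int[Pi]_z ((expR (- f (z, x)))%:E + (1 - expR (- f (z, x)))%:E) = 1)%E.
  under eq_integral do rewrite -EFinD addrC subrK.
  by rewrite integral_cst// mul1e; exact: probability_setT.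
move: h; rewrite ge0_integralD//; last first.
  by move=> z _; rewrite lee_fin.
rewrite -hit_rateE => h.
have : (\int[Pi]_z (expR (- f (z, x)))%:E)%E \is a fin_num.
  rewrite ge0_fin_numE; last by apply: integral_ge0.
  have : (\int[Pi]_z (expR (- f (z, x)))%:E <= 1)%E by rewrite -h leeDl// lee_fin.
  by move/le_lt_trans; apply; exact: ltry.
move: h => /[swap] /fineK <-; rewrite -EFinD => -[h].
by rewrite -h addrK.
Qed.

Let hit_sum n w : R := \sum_(i < n) f (theta i w, partial_time i.+1 w).

Let Y n w : R := expR (- hit_sum n w).

Let hit_sum_ge0 n w : 0 <= hit_sum n w.
Proof. exact: sumr_ge0. Qed.

Let measurable_hit_sum (S : set (nat + nat)) n :
  (forall i, (i < n)%N -> S (inr i) /\ S (inl i)) ->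
  measurable_fun setT (hit_sum n : past S -> R).
Proof.
move=> Si.
have h (i : 'I_n) : measurable_fun setT
    (fun w : past S => f (theta i w, partial_time i.+1 w)).
  apply: (measurableT_comp mf (g := fun w : past S => (theta i w, partial_time i.+1 w))).
  apply: measurable_fun_pair.
    have Sli : S (inl (nat_of_ord i)) by have [] := Si i (ltn_ord i).
    exact: (@measurable_past _ _ _ _ X S (inl (nat_of_ord i)) Sli).
  apply: measurable_partial_time => j; rewrite ltnS => ji.
  by have [] := Si j (leq_ltn_trans ji (ltn_ord i)).
exact: (@measurable_sum _ (past S) R setT _ _
  (fun (i : 'I_n) (w : past S) => f (theta i w, partial_time i.+1 w))).
Qed.

Let measurable_Y (S : set (nat + nat)) n :
  (forall i, (i < n)%N -> S (inr i) /\ S (inl i)) ->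
  measurable_fun setT (Y n : past S -> R).
Proof.
move=> Si; apply: (measurableT_comp (@measurable_expR R)).
by apply: measurable_funN; exact: measurable_hit_sum.
Qed.

Let measurable_YT n : measurable_fun setT (Y n).
Proof.
apply: (measurableT_comp (@measurable_expR R)); apply: measurable_funN.
apply: (@measurable_sum _ T R setT _ _
  (fun (i : 'I_n) w => f (theta i w, partial_time i.+1 w))) => i.
apply: (measurableT_comp mf (g := fun w => (theta i w, partial_time i.+1 w))).
by apply: measurable_fun_pair => //; exact: measurable_partial_timeT.
Qed.

Let surv := survival hit_rate.

Let msurv : measurable_fun setT surv.
Proof. exact: (measurable_survival hit_rate_cont hit_rate_ge0 hit_rate_fin). Qed.

Let surv_ge0 x : 0 <= surv x.
Proof. exact: survival_ge0. Qed.

Let surv_le1 x : surv x <= 1.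
Proof. exact: (survival_le1 hit_rate_cont hit_rate_ge0 hit_rate_fin). Qed.

(** Integrate out theta_n, which replaces its factor by 1 - hit_rate; then integrate
    out the n-th waiting time, and the renewal identity restores the survival
    function one step earlier. *)
Lemma hit_martingale n :
  (\int[P]_w (Y n w * surv (partial_time n w))%:E = (surv 0)%:E)%E.
Proof.
elim: n => [|n <-].
  under eq_integral do rewrite /Y /hit_sum big_ord0 oppr0 expR0 mul1r partial_time0.
  rewrite integral_cst// [X in (_ * X)%E](_ : _ = 1%E) ?mule1//.
  exact: probability_setT.
have pT i : (i < n)%N -> pastT n (inr i) /\ pastT n (inl i).
  by move=> ni; split => //; exact: ltnW.
have pE i : (i < n)%N -> pastE n (inr i) /\ pastE n (inl i) by [].
(* Stage 1: the waiting time n is known, the mark n is not. *)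
pose phi1 (q : past (pastT n) * R) :=
  (Y n q.1 * surv (partial_time n.+1 q.1) * expR (- f (q.2, partial_time n.+1 q.1)))%:E.
have mS1 : measurable_fun setT (partial_time n.+1 : past (pastT n) -> R).
  by apply: measurable_partial_time.
have mphi1 : measurable_fun setT phi1.
  apply/measurable_EFinP; apply: measurable_funM.
    apply: measurable_funM.
      exact: (measurableT_comp (measurable_Y pT) measurable_fst).
    exact: (measurableT_comp msurv (measurableT_comp mS1 measurable_fst)).
  apply: (measurableT_comp (@measurable_expR R)); apply: measurable_funN.
  apply: (measurableT_comp mf
    (g := fun q : past (pastT n) * R => (q.2, partial_time n.+1 q.1))).
  apply: measurable_fun_pair => //.
  exact: (measurableT_comp mS1 measurable_fst).
transitivity (\int[P]_w phi1 (w : past (pastT n), theta n w))%E.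
  apply: eq_integral => w _; rewrite /phi1/= /Y /hit_sum big_ord_recr/=.
  by rewrite opprD expRD; congr EFin; ring.
rewrite freeze_theta//; last 2 first.
- by rewrite /pastT/= ltnn.
- by move=> q; rewrite lee_fin !mulr_ge0 ?expR_ge0.
(* Stage 2: nothing about step n is known. *)
pose phi2 (q : past (pastE n) * R) :=
  (Y n q.1 * ((1 - hit_rate (partial_time n q.1 + q.2)) *
     surv (partial_time n q.1 + q.2)))%:E.
have mS : measurable_fun setT (partial_time n : past (pastE n) -> R).
  by apply: measurable_partial_time.
have mSv : measurable_fun setT (fun q : past (pastE n) * R => partial_time n q.1 + q.2).
  apply: measurable_funD => //.
  exact: (measurableT_comp mS measurable_fst).
have mphi2 : measurable_fun setT phi2.
  apply/measurable_EFinP; apply: measurable_funM.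
    exact: (measurableT_comp (measurable_Y pE) measurable_fst).
  apply: measurable_funM.
    apply: measurable_funB => //.
    apply: (measurableT_comp _ mSv); exact: continuous_measurable_fun.
  exact: (measurableT_comp msurv mSv).
transitivity (\int[P]_w phi2 (w : past (pastE n), E n w))%E.
  apply: eq_integral => w _; rewrite /phi1/= /phi2/= -partial_timeS.
  under eq_integral do rewrite EFinM.
  rewrite ge0_integralZl//.
  - by rewrite int_expRNf -EFinM; congr EFin; ring.
  - apply/measurable_EFinP.
    apply: (measurableT_comp (@measurable_expR R)); apply: measurable_funN.
    exact: (@measurable_fun_pair1 _ _ _ _ _ _ f _ mf).
  - by rewrite lee_fin mulr_ge0 ?expR_ge0.
rewrite freeze_E//; last 2 first.
- by rewrite /pastE/= ltnn.
- by move=> q; rewrite lee_fin !mulr_ge0 ?expR_ge0// subr_ge0.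
pose J (g : R) := (\int[mu]_(v in `]0%R, +oo[)
  (((1 - hit_rate (g + v)) * surv (g + v))%:E * (expR (- v))%:E))%E.
have mJ : measurable_fun setT J.
  pose h (q : R * measurableTypeR R) : \bar R := if 0 < q.2 then
    (((1 - hit_rate (q.1 + q.2)) * surv (q.1 + q.2))%:E * (expR (- q.2))%:E)%E
    else 0%E.
  have h0 q : (0 <= h q)%E.
    rewrite /h; case: ifP => // _.
    by rewrite mule_ge0 ?lee_fin ?expR_ge0// mulr_ge0// subr_ge0.
  have m2 : measurable_fun setT (fun q : R * measurableTypeR R => q.2 : R).
    exact: measurable_snd.
  have m12 : measurable_fun setT (fun q : R * measurableTypeR R => q.1 + q.2).
    exact: measurable_funD.
  have mh : measurable_fun setT h.
    apply: measurable_fun_ifT => //; first exact: measurable_fun_ltr.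
    apply: emeasurable_funM; apply/measurable_EFinP.
      apply: measurable_funM; last exact: (measurableT_comp msurv m12).
      apply: measurable_funB => //.
      by apply: (measurableT_comp _ m12); exact: continuous_measurable_fun.
    by apply: (measurableT_comp (@measurable_expR R)); exact: measurable_funN.
  rewrite (_ : J = (fun g => \int[mu]_v h (g, v))%E).
    exact: (measurable_fun_fubini_tonelli_F (m2 := mu) h mh h0).
  apply/funext => g; rewrite /J [LHS]integral_mkcond; apply: eq_integral => v _.
  by rewrite patchE mem_setE in_itv/= andbT.
have mrenew (g : R) (D : set R) : measurable_fun D (fun v =>
    ((1 - hit_rate (g + v)) * surv (g + v))%:E * (expR (- v))%:E)%E.
  apply: measurable_funTS; apply: emeasurable_funM; apply/measurable_EFinP.
    have mg : measurable_fun setT (fun v : R => g + v) by exact: measurable_funD.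
    apply: measurable_funM; last exact: (measurableT_comp msurv mg).
    apply: measurable_funB => //.
    by apply: (measurableT_comp _ mg); exact: continuous_measurable_fun.
  exact: measurableT_comp.
transitivity (\int[P]_w ((Y n w)%:E * J (partial_time n w)))%E.
  apply: eq_integral => w _; rewrite -ge0_integralZl//.
  - by apply: eq_integral => v _; rewrite /phi2/= EFinM muleA.
  - exact: mrenew.
  - by move=> v _; rewrite mule_ge0 ?lee_fin ?expR_ge0// mulr_ge0// subr_ge0.
  - by rewrite lee_fin expR_ge0.
apply: ae_eq_integral => //.
- apply: emeasurable_funM; first exact/measurable_EFinP.
  by apply: (measurableT_comp mJ); exact: measurable_partial_timeT.
- apply/measurable_EFinP; apply: measurable_funM; first exact: measurable_YT.
  by apply: (measurableT_comp msurv); exact: measurable_partial_timeT.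
- apply: filterS ae_partial_time_ge0 => w Sw _.
  by rewrite /J renewal_equation// -EFinM.
Qed.

(** Let n grow in [hit_martingale]: the arrival times tend to infinity, where the
    survival function tends to 1, and only the Laplace functional remains. *)
Theorem laplace_marked_poisson :
  (\int[P]_w expeR (- \sum_(i <oo) (f (theta i w, partial_time i.+1 w))%:E) =
   expeR (- \int[mu]_(x in `]0%R, +oo[)
     \int[distribution P (theta 0%N)]_z (1 - expR (- f (z, x)))%:E))%E.
Proof.
under [X in _ = expeR (- X)]eq_integral do rewrite -hit_rateE.
rewrite -(survival0 hit_rate_cont hit_rate_ge0 hit_rate_fin) -/surv.
have Ycvg w : (Y n w)%:E @[n --> \oo] -->
    expeR (- \sum_(i <oo) (f (theta i w, partial_time i.+1 w))%:E)%E.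
  exact: (@cvg_expRN_nneseries (fun i => f (theta i w, partial_time i.+1 w))).
have mlim : measurable_fun setT (fun w =>
    expeR (- \sum_(i <oo) (f (theta i w, partial_time i.+1 w))%:E)%E).
  apply: (@emeasurable_fun_cvg _ T R setT (fun n w => (Y n w)%:E)) => //.
  by move=> n; exact/measurable_EFinP.
have := @dominated_convergence _ T R P setT measurableT
  (fun n w => (Y n w * surv (partial_time n w))%:E)
  (fun w => expeR (- \sum_(i <oo) (f (theta i w, partial_time i.+1 w))%:E)%E)
  (cst 1%E).
case => //.
- move=> n; apply/measurable_EFinP; apply: measurable_funM.
    exact: measurable_YT.
  by apply: (measurableT_comp msurv); exact: measurable_partial_timeT.
- apply: filterS ae_partial_time_growth => w [l l0 lS] _.
  have Sy : partial_time n w @[n --> \oo] --> +oo.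
    apply/cvgryPge => A; near=> n.
    apply: (@le_trans _ _ (l * n%:R)); last by near: n.
    rewrite mulrC -ler_pdivrMr//; near: n; exact: nbhs_infty_ger.
  have -> : (fun n => (Y n w * surv (partial_time n w))%:E) =
      (fun n => (Y n w)%:E * (surv (partial_time n w))%:E)%E.
    by apply/funext => n; rewrite EFinM.
  rewrite -[X in _ --> X]mule1; apply: cvgeM; last 2 first.
  - exact: Ycvg.
  - apply: cvg_EFin; first by near=> n.
    exact: (survival_cvgy hit_rate_cont hit_rate_ge0 hit_rate_fin).
  have : (0 <= \sum_(i <oo) (f (theta i w, partial_time i.+1 w))%:E)%E.
    by apply: nneseries_ge0 => i _ _; rewrite lee_fin.
  by case: (\sum_(i <oo) _)%E => [r| |]//= _; apply: mule_def_fin.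
- by apply: finite_measure_integrable_cst.
- apply: aeW => w n _; rewrite gee0_abs ?lee_fin ?mulr_ge0 ?expR_ge0//.
  by rewrite -[leRHS]mulr1 ler_pM ?expR_ge0// expR_le1 oppr_le0.
move=> _ _ h.
have : (\int[P]_w (Y n w * surv (partial_time n w))%:E)%E @[n --> \oo] --> (surv 0)%:E.
  by under eq_fun do rewrite hit_martingale; exact: cvg_cst.
exact: cvg_unique h.
Unshelve. all: by end_near. Qed.
End marked_poisson.

(** * Independence from joint moments *)

Section step_powers.
Context {R : realType}.

(** Polynomials in y with values in [0, 1] that approximate the indicator of
    y < a. The exponent is about n / a ^ n: exponent times y ^ n tends to 0 or to
    +oo according to whether y < a or not, and the factor n settles the case
    y = a. *)
Definition step_power (a : R) (n : nat) (y : R) : R :=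
  (1 - y ^+ n) ^+ (Num.truncn (n%:R * a^-1 ^+ n)).

Lemma bernoulli_le (u : R) k : 0 <= u <= 1 -> 1 - k%:R * u <= (1 - u) ^+ k.
Proof.
move=> /andP[u0 u1]; elim: k => [|k IH]; first by rewrite mul0r subr0.
rewrite exprS; apply: (@le_trans _ _ ((1 - u) * (1 - k%:R * u))).
  rewrite -natr1 mulrDl mul1r -subr_ge0.
  rewrite (_ : _ - _ = k%:R * (u * u)); last by ring.
  by rewrite !mulr_ge0.
by rewrite ler_wpM2l// subr_ge0.
Qed.

Lemma step_power_ge0 a n (y : R) : 0 <= y <= 1 -> 0 <= step_power a n y.
Proof.
by move=> /andP[y0 y1]; rewrite exprn_ge0// subr_ge0 exprn_ile1.
Qed.

Lemma step_power_le1 a n (y : R) : 0 <= y <= 1 -> step_power a n y <= 1.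
Proof.
move=> /andP[y0 y1]; rewrite exprn_ile1// ?subr_ge0 ?exprn_ile1//.
by rewrite lerBlDr lerDl exprn_ge0.
Qed.

Lemma cvg_natr_expr (r : R) : 0 <= r < 1 -> n%:R * r ^+ n @[n --> \oo] --> (0 : R).
Proof.
move=> /andP[r0 r1].
have [->|rn0] := eqVneq r 0.
  apply: cvg_near_cst; near=> n.
  by rewrite expr0n gtn_eqF ?mulr0//; near: n; exists 1%N.
have rp : 0 < r by rewrite lt0r rn0.
pose l := - ln r.
have l0 : 0 < l by rewrite /l oppr_gt0 ln_lt0// rp.
have rE n : r ^+ n = expR (- (n%:R * l)).
  by rewrite /l mulrN opprK expRM_natl lnK ?posrE.
have h : (4 / l ^+ 2) * n%:R^-1 @[n --> \oo] --> (0 : R).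
  rewrite -[X in _ --> X](mulr0 (4 / l ^+ 2)); apply: cvgMr.
  by apply/gtr0_cvgV0; [near=> n; rewrite ltr0n; near: n; exists 1%N|exact: cvgr_idn].
apply: (@squeeze_cvgr _ _ _ _ (fun=> 0) (fun n => (4 / l ^+ 2) * n%:R^-1)); last 2 first.
- exact: cvg_cst.
- exact: h.
near=> n; rewrite mulr_ge0 ?exprn_ge0//=.
have n0 : 0 < (n%:R : R) by rewrite ltr0n; near: n; exists 1%N.
rewrite rE expRN.
have e0 : (n%:R * l / 2) ^+ 2 <= expR (n%:R * l).
  rewrite [X in expR X](_ : _ = 2%:R * (n%:R * l / 2)); last by field.
  rewrite expRM_natl.
  rewrite lerXn2r ?nnegrE ?expR_ge0//; first by rewrite divr_ge0// mulr_ge0// ltW.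
  by apply: le_trans (expR_ge1Dx _); rewrite lerDr.
rewrite ler_pdivrMr ?expR_gt0//; apply: le_trans (ler_wpM2l _ e0).
  rewrite [leRHS](_ : _ = n%:R)//; field.
  by rewrite !gt_eqF.
by rewrite mulr_ge0 ?invr_ge0 ?ler0n// divr_ge0// exprn_ge0// ltW.
Unshelve. all: by end_near.
Qed.

Lemma cvg_step_power (a y : R) : 0 < a -> 0 <= y <= 1 ->
  step_power a n y @[n --> \oo] --> ((y < a)%R%:R : R).
Proof.
move=> a0 y01; have /andP[y0 y1] := y01.
have [ya|ay] := ltP y a.
  have h : 1 - n%:R * (y / a) ^+ n @[n --> \oo] --> (1 : R).
    rewrite -[X in _ --> X]subr0; apply: cvgB; first exact: cvg_cst.
    by apply: cvg_natr_expr; rewrite divr_ge0 ?(ltW a0)//= ltr_pdivrMr// mul1r.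
  apply: (@squeeze_cvgr _ _ _ _ (fun n => 1 - n%:R * (y / a) ^+ n) (fun=> 1)).
  - near=> n; rewrite step_power_le1// andbT.
    apply: le_trans (bernoulli_le _ _); last by rewrite exprn_ge0// exprn_ile1.
    rewrite lerD2l lerN2 exprMn (mulrC (y ^+ n)) mulrA ler_wpM2r ?exprn_ge0//.
    by rewrite truncn_le mulr_ge0// exprn_ge0// invr_ge0 ltW.
  - exact: h.
  - exact: cvg_cst.
have h : expR (- (n%:R - 1)) @[n --> \oo] --> (0 : R).
  apply: (@cvg_comp _ _ _ (fun n => (n%:R - 1 : R)) (fun x => expR (- x)) _ +oo).
    apply/cvgryPge => A; near=> n; rewrite lerBrDr; near: n; exact: nbhs_infty_ger.
  exact: cvgr_expR.
apply: (@squeeze_cvgr _ _ _ _ (fun=> 0) (fun n => expR (- (n%:R - 1)))); last 2 first.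
- exact: cvg_cst.
- exact: h.
near=> n; rewrite step_power_ge0//=.
rewrite /step_power; set k := Num.truncn _.
have yn : 0 <= y ^+ n <= 1 by rewrite exprn_ge0// exprn_ile1.
apply: (@le_trans _ _ (expR (- (k%:R * y ^+ n)))).
  rewrite -mulrN expRM_natl lerXn2r ?nnegrE ?expR_ge0//.
    by case/andP: yn => *; rewrite subr_ge0.
  exact: le_trans (expR_ge1Dx _).
rewrite ler_expR lerN2.
have kn : n%:R * a^-1 ^+ n - 1 <= k%:R.
  by rewrite lerBlDr natr1 ltW// truncnS_gt.
apply: (@le_trans _ _ ((n%:R * a^-1 ^+ n - 1) * y ^+ n)); last first.
  by rewrite ler_wpM2r//; case/andP: yn.
rewrite mulrBl mul1r; apply: lerB; last by case/andP: yn.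
rewrite -mulrA -exprMn -[leLHS]mulr1 ler_wpM2l//.
by rewrite exprn_ege1// mulrC ler_pdivlMr// mul1r.
Unshelve. all: by end_near.
Qed.

End step_powers.

Section decoupling.
Context d (T : measurableType d) (R : realType) (P : probability T R).

Lemma integral_unit_fin (D : set T) (h : T -> R) : measurable D ->
  measurable_fun setT h ->
  (forall w, 0 <= h w <= 1) -> (\int[P]_(w in D) (h w)%:E)%E \is a fin_num.
Proof.
move=> mD mh h01; rewrite ge0_fin_numE; last first.
  by apply: integral_ge0 => w _; rewrite lee_fin; case/andP: (h01 w).
apply: (@le_lt_trans _ _ (\int[P]_(w in D) 1%E)%E).
  apply: ge0_le_integral => //.
  - by move=> w _; rewrite lee_fin; case/andP: (h01 w).
  - exact/measurable_EFinP/measurable_funTS.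
  - by move=> w _; rewrite lee_fin; case/andP: (h01 w).
by rewrite integral_cst// mul1e (le_lt_trans (probability_le1 _ mD))// ltry.
Qed.

(** Moments determine the law of a variable with values in [0, 1], in a form
    weighted by Z: the hypothesis extends to polynomials in V, by [step_power] to
    the events V < a, and by Dynkin induction to all events. *)
Lemma moment_decoupling (Z V : T -> R) :
  measurable_fun setT Z -> measurable_fun setT V ->
  (forall w, 0 <= Z w <= 1) -> (forall w, 0 <= V w <= 1) ->
  (forall m, \int[P]_w (Z w * V w ^+ m)%:E =
     \int[P]_w (Z w)%:E * \int[P]_w (V w ^+ m)%:E)%E ->
  forall B : set R, measurable B ->
  (\int[P]_(w in V @^-1` B) (Z w)%:E = \int[P]_w (Z w)%:E * P (V @^-1` B))%E.
Proof.
move=> mZ mV Z01 V01 mom.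
have Z0 w : 0 <= Z w by case/andP: (Z01 w).
have V0 w : 0 <= V w by case/andP: (V01 w).
have V1 w : V w <= 1 by case/andP: (V01 w).
have mX m : measurable_fun setT (fun w => V w ^+ m).
  exact: (measurable_funX m mV).
have mY n k : measurable_fun setT (fun w => (1 - V w ^+ n) ^+ k).
  exact/measurable_funX/measurable_funB.
have Vn w n : 0 <= V w ^+ n <= 1 by rewrite exprn_ge0// exprn_ile1.
have Y01 w n k : 0 <= (1 - V w ^+ n) ^+ k <= 1.
  case/andP: (Vn w n) => a b.
  by rewrite exprn_ge0 ?subr_ge0// exprn_ile1// ?subr_ge0// lerBlDr lerDl.
pose z := (\int[P]_w (Z w)%:E)%E.
have zfin : z \is a fin_num by exact: integral_unit_fin.
have z0 : (0 <= z)%E by apply: integral_ge0 => w _; rewrite lee_fin.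
have M01 (a b : R) : 0 <= a <= 1 -> 0 <= b <= 1 -> 0 <= a * b <= 1.
  move=> /andP[a0 a1] /andP[b0 b1]; rewrite mulr_ge0//=.
  by rewrite -[leRHS]mulr1 ler_pM.
(* By induction on the exponent k, in an additive form: all integrands stay
   nonnegative and no signed integral is needed. *)
have step n k : forall m, (\int[P]_w (Z w * (V w ^+ m * (1 - V w ^+ n) ^+ k))%:E =
    z * \int[P]_w (V w ^+ m * (1 - V w ^+ n) ^+ k)%:E)%E.
  elim: k => [|k IH] m.
    under eq_integral do rewrite expr0 mulr1.
    by under [in RHS]eq_integral do rewrite expr0 mulr1.
  pose U j := fun w => V w ^+ j * (1 - V w ^+ n) ^+ k.
  pose U' := fun w => V w ^+ m * (1 - V w ^+ n) ^+ k.+1.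
  have UE w : U m w = U' w + U (m + n)%N w.
    rewrite /U /U' exprS exprD; set x := V w ^+ m; set y := V w ^+ n.
    by ring.
  have mU j : measurable_fun setT (U j) by exact: measurable_funM.
  have mU' : measurable_fun setT U' by exact: measurable_funM.
  have U01 w j : 0 <= U j w <= 1 by exact: M01.
  have U'01 w : 0 <= U' w <= 1 by exact: M01.
  have U0 w j : 0 <= U j w by case/andP: (U01 w j).
  have U'0 w : 0 <= U' w by case/andP: (U'01 w).
  have e1 : (\int[P]_w (Z w * U m w)%:E = \int[P]_w (Z w * U' w)%:E +
      \int[P]_w (Z w * U (m + n)%N w)%:E)%E.
    rewrite -ge0_integralD//.
    - by apply: eq_integral => w _; rewrite -EFinD -mulrDr UE.
    - by move=> w _; rewrite lee_fin mulr_ge0.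
    - by apply/measurable_EFinP; exact: measurable_funM.
    - by move=> w _; rewrite lee_fin mulr_ge0.
    - by apply/measurable_EFinP; exact: measurable_funM.
  have e2 : (\int[P]_w (U m w)%:E = \int[P]_w (U' w)%:E +
      \int[P]_w (U (m + n)%N w)%:E)%E.
    rewrite -ge0_integralD//.
    - by apply: eq_integral => w _; rewrite -EFinD UE.
    - by move=> w _; rewrite lee_fin.
    - exact/measurable_EFinP.
    - by move=> w _; rewrite lee_fin.
    - exact/measurable_EFinP.
  have f1 : (\int[P]_w (Z w * U (m + n)%N w)%:E)%E \is a fin_num.
    by apply: integral_unit_fin => //; [exact: measurable_funM|move=> w; exact: M01].
  move: e1; rewrite IH e2 IH ge0_muleDr; last 2 first.
  - by apply: integral_ge0 => w _; rewrite lee_fin.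
  - by apply: integral_ge0 => w _; rewrite lee_fin.
  move/eqP; rewrite -IH; rewrite eq_sym => /eqP.
  by move/(congr1 (fun x => x - \int[P]_w (Z w * U (m + n)%N w)%:E)%E); rewrite !addeK.
have stepa n a : (\int[P]_w (Z w * step_power a n (V w))%:E =
    z * \int[P]_w (step_power a n (V w))%:E)%E.
  have := step n (Num.truncn (n%:R * a^-1 ^+ n)) 0%N.
  under eq_integral do rewrite expr0 mul1r.
  by under [in X in _ = X -> _]eq_integral do rewrite expr0 mul1r.
have mW a n : measurable_fun setT (fun w => step_power a n (V w)) by exact: mY.
have I01 a w : 0 <= ((V w < a)%R%:R : R) <= 1 by case: (V w < a); rewrite ?ler01 ?lexx.
have memV a w : (w \in V @^-1` `]-oo, a[) = (V w < a).
  by apply/idP/idP; rewrite inE/= in_itv.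
have mI a : measurable_fun setT (fun w => (V w < a)%R%:R : R).
  have -> : (fun w => (V w < a)%R%:R : R) = \1_(V @^-1` `]-oo, a[).
    by apply/funext => w; rewrite indicE memV.
  by apply: measurable_indic; rewrite -[X in measurable X]setTI; exact: mV.
have dct (Y : T -> R) a : 0 < a -> measurable_fun setT Y -> (forall w, 0 <= Y w <= 1) ->
   (\int[P]_w (Y w * step_power a n (V w))%:E)%E @[n --> \oo] -->
   (\int[P]_w (Y w * (V w < a)%R%:R)%:E)%E.
  move=> a0 mYY YY.
  have := @dominated_convergence _ T R P setT measurableT
    (fun n w => (Y w * step_power a n (V w))%:E)
    (fun w => (Y w * (V w < a)%R%:R)%:E) (cst 1%E).
  case => //.
  - by move=> n; apply/measurable_EFinP; exact: measurable_funM.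
  - by apply/measurable_EFinP; exact: measurable_funM.
  - apply: aeW => w _; apply: cvg_EFin; first by near=> n.
    by apply: cvgMr; exact: cvg_step_power.
  - exact: finite_measure_integrable_cst.
  - apply: aeW => w n _.
    have /andP[y0 y1] : 0 <= Y w * step_power a n (V w) <= 1.
      by apply: M01 => //; rewrite step_power_ge0// step_power_le1.
    by rewrite gee0_abs lee_fin.
have EI (Y : T -> R) a : (\int[P]_w (Y w * (V w < a)%R%:R)%:E =
    \int[P]_(w in V @^-1` `]-oo, a[) (Y w)%:E)%E.
  rewrite [RHS]integral_mkcond; apply: eq_integral => w _.
  rewrite patchE memV; case: (V w < a); first by rewrite mulr1.
  by rewrite mulr0.
have base a : (\int[P]_(w in V @^-1` `]-oo, a[) (Z w)%:E =
    z * P (V @^-1` `]-oo, a[))%E.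
  have mB : measurable (V @^-1` `]-oo, a[).
    by rewrite -[X in measurable X]setTI; exact: mV.
  have [a0|a0] := leP a 0.
    have -> : V @^-1` `]-oo, a[ = set0.
      apply/seteqP; split => w //=; rewrite in_itv/= => h.
      by have := V0 w; rewrite leNgt (lt_le_trans h).
    by rewrite integral_set0 measure0 mule0.
  have h1 := dct Z a a0 mZ Z01.
  have h2 := dct (fun=> 1) a a0 (@measurable_cst _ _ _ _ _ _)
    (fun=> (introT andP (conj ler01 (lexx _)))).
  rewrite EI in h1; rewrite EI integral_cst// mul1e in h2.
  have h3 : (\int[P]_w (Z w * step_power a n (V w))%:E)%E @[n --> \oo] -->
     (z * P (V @^-1` `]-oo, a[))%E.
    rewrite (_ : (fun n => _) = (fun n => z * \int[P]_w (1 * step_power a n (V w))%:E)%E).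
      by apply: cvgeZl.
    apply/funext => n; rewrite stepa; congr (_ * _)%E.
    by apply: eq_integral => w _; rewrite mul1r.
  exact: (cvg_unique _ h1 h3).
have mVB B : measurable B -> measurable (V @^-1` B).
  by move=> mB; rewrite -[X in measurable X]setTI; exact: mV.
have mZe (D : set T) : measurable_fun D (fun w => (Z w)%:E).
  exact/measurable_EFinP/measurable_funTS.
have Zint B : measurable B -> (\int[P]_(w in V @^-1` B) (Z w)%:E)%E \is a fin_num.
  by move=> mB; apply: integral_unit_fin => //; exact: mVB.
move=> B mB; apply: (@dynkin_induction _ R (@RGenInftyO.G R)
  (fun B => (\int[P]_(w in V @^-1` B) (Z w)%:E = z * P (V @^-1` B))%E)) => //.
- exact: RGenInftyO.measurableE.
- move=> _ _ [x ->] [y ->]; exists (Num.min x y).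
  by apply/seteqP; split => w /=; rewrite !in_itv/= lt_min => /andP.
- by rewrite preimage_setT probability_setT mule1.
- by move=> _ [x ->]; exact: base.
- move=> S mS SE; rewrite (_ : V @^-1` (~` S) = ~` (V @^-1` S))// probability_setC; last exact: mVB.
  have PS : P (V @^-1` S) \is a fin_num by rewrite fin_num_measure//; exact: mVB.
  have -> : (z * (1 - P (V @^-1` S)) = z - z * P (V @^-1` S))%E.
    by rewrite muleBr ?mule1// fin_num_adde_defr// fin_numN.
  rewrite -SE.
  have -> : z = (\int[P]_(w in V @^-1` S) (Z w)%:E + \int[P]_(w in ~` (V @^-1` S)) (Z w)%:E)%E.
    rewrite -ge0_integral_setU//.
    - by rewrite setUv.
    - exact: mVB.
    - exact/measurableC/mVB.
    - by move=> w _; rewrite lee_fin.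
    - by apply/disj_setPCl.
  by rewrite addeAC subee ?add0e// Zint.
- move=> F mF tF FE; rewrite preimage_bigcup.
  have tVF : trivIset setT (fun n => V @^-1` F n).
    apply/trivIsetP => i j _ _ ij; rewrite -preimage_setI.
    by move/trivIsetP : tF => ->//; rewrite preimage_set0.
  rewrite ge0_integral_bigcup//; last 2 first.
  - by move=> k; exact: mVB.
  - by move=> w _; rewrite lee_fin.
  rewrite measure_bigcup//; last by move=> k _; exact: mVB.
  rewrite -(fineK zfin) -nneseriesZl// fineK//.
  rewrite [RHS](eq_eseriesl (Q := xpredT)); last by move=> n; rewrite in_setT.
  by apply: eq_eseriesr => n _.
- suff <- : @measurable _ R = <<s @RGenInftyO.G R >> by [].
  exact: RGenInftyO.measurableE.
Unshelve. all: by end_near.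
Qed.

End decoupling.

Section independence.
Context d (T : measurableType d) (R : realType) (P : probability T R).
Context (I : choiceType) (V : I -> T -> R).
Hypothesis mV : forall i, measurable_fun setT (V i).
Hypothesis V01 : forall i w, 0 <= V i w <= 1.
Hypothesis momV : forall (s : seq I) (u : I -> nat), uniq s ->
  (\int[P]_w (\prod_(i <- s) V i w ^+ u i)%:E =
   \prod_(i <- s) \int[P]_w (V i w ^+ u i)%:E)%E.

Let V0 i w : 0 <= V i w. Proof. by case/andP: (V01 i w). Qed.
Let V1 i w : V i w <= 1. Proof. by case/andP: (V01 i w). Qed.

Let mixed_moments (C : I -> set R) (s1 s2 : seq I) (u : I -> nat) :
  (forall i, measurable (C i)) -> uniq (s1 ++ s2) ->
  (\int[P]_w (\prod_(i <- s1) \1_(C i) (V i w) * \prod_(i <- s2) V i w ^+ u i)%:E =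
   \prod_(i <- s1) P (V i @^-1` C i) *
   \prod_(i <- s2) \int[P]_w (V i w ^+ u i)%:E)%E.
Proof.
move=> mC; elim: s1 s2 u => [|a s1 IH] s2 u.
  move=> us; rewrite big_nil mul1e -momV//.
  by apply: eq_integral => w _; rewrite big_nil mul1r.
rewrite cat_cons cons_uniq mem_cat negb_or => /andP[/andP[as1 as2] us].
pose Z w := \prod_(i <- s1) \1_(C i) (V i w) * \prod_(i <- s2) V i w ^+ u i : R.
have mind i : measurable_fun setT (fun w => \1_(C i) (V i w) : R).
  by apply: measurableT_comp => //; exact: measurable_indic.
have mZ : measurable_fun setT Z.
  apply: measurable_funM; first by apply: measurable_prod => i _.
  by apply: measurable_prod => i _; exact: measurable_funX.
have prod01 (s : seq I) (h : I -> R) : (forall i, 0 <= h i <= 1) ->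
    0 <= \prod_(i <- s) h i <= 1.
  move=> h01; rewrite prodr_ge0 /=; last by move=> i _; case/andP: (h01 i).
  by apply: prodr_ile1.
have Z01 w : 0 <= Z w <= 1.
  have /andP[a0 a1] : 0 <= \prod_(i <- s1) (\1_(C i) (V i w) : R) <= 1.
    by apply: prod01 => i; rewrite indicE; case: (_ \in _); rewrite ?ler01 ?lexx.
  have /andP[b0 b1] : 0 <= \prod_(i <- s2) (V i w ^+ u i) <= 1.
    by apply: prod01 => i; rewrite exprn_ge0// exprn_ile1.
  by rewrite /Z mulr_ge0//= -[leRHS]mulr1 ler_pM.
have key m : (\int[P]_w (Z w * V a w ^+ m)%:E =
    \int[P]_w (Z w)%:E * \int[P]_w (V a w ^+ m)%:E)%E.
  rewrite IH//.
  pose u' i := if i == a then m else u i.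
  have := IH (a :: s2) u'.
  rewrite uniq_catC cat_cons cons_uniq mem_cat negb_or as1 as2 uniq_catC us.
  move=> /(_ isT) h.
  have u's2 (w : T) i : i \in s2 -> V i w ^+ u' i = V i w ^+ u i.
    by rewrite /u' => is2; case: eqP => // ia; rewrite -ia is2 in as2.
  rewrite big_cons /u' eqxx in h.
  transitivity (\int[P]_w (\prod_(i <- s1) \1_(C i) (V i w) *
      \prod_(i <- a :: s2) V i w ^+ u' i)%:E)%E.
    apply: eq_integral => w _; rewrite /Z -mulrA big_cons /u' eqxx.
    by rewrite [in RHS](eq_big_seq _ (u's2 w)) (mulrC (V a w ^+ m)).
  rewrite h -muleA; congr (_ * _)%E; rewrite muleC; congr (_ * _)%E.
  apply: eq_big_seq => i is2; apply: eq_integral => w _.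
  by have := u's2 w i is2; rewrite /u' => ->.
transitivity (\int[P]_(w in V a @^-1` C a) (Z w)%:E)%E; last first.
  rewrite (moment_decoupling mZ (mV a) Z01 (V01 a) key (mC a)).
  by rewrite big_cons -muleA -(IH s2 u us) muleC.
rewrite [RHS]integral_mkcond; apply: eq_integral => w _.
rewrite big_cons patchE indicE /Z.
have -> : (w \in V a @^-1` C a) = (V a w \in C a) by apply/idP/idP; rewrite !inE.
by case: (_ \in _); rewrite ?mul1r ?mul0r.
Qed.

(** Turn the factors V_i ^ u_i into indicators one at a time, each time by
    [moment_decoupling] with the remaining product as weight. *)
Lemma moments_independent : mutually_independent P V.
Proof.
move=> J C mC.
have := @mixed_moments C (enum_fset J) [::] (fun=> 0%N) mC.
rewrite cats0 big_nil mule1 => /(_ (fset_uniq _)) <-.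
have mB : measurable (\bigcap_(i in [set` J]) V i @^-1` C i).
  apply: fin_bigcap_measurable => // i _.
  by rewrite -[X in measurable X]setTI; exact: mV.
rewrite -[in LHS](setIT (\bigcap_(i in _) _)) -integral_indic//.
apply: eq_integral => w _; rewrite big_nil mulr1 indicE; congr (_%:E).
case: (boolP (w \in _)); rewrite ?inE.
  move=> h; rewrite big_seq big1// => i iJ.
  by rewrite indicE mem_set//; exact: h.
move/negP; rewrite inE => h; apply/esym/eqP; rewrite prodf_seq_eq0.
apply/hasP; apply: contrapT => k; apply: h => i iJ /=.
apply: contrapT => nC; apply: k; exists i => //=.
by rewrite indicE memNset.
Qed.

Lemma mutually_independent_comp d' (T' : measurableType d') (g : R -> T') :
  measurable_fun setT g -> mutually_independent P V ->
  mutually_independent P (fun i => g \o V i).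
Proof.
move=> mg h J C mC.
have := h J (fun i => g @^-1` C i).
apply => i; rewrite -[X in measurable X]setTI; exact: mg.
Qed.

End independence.

(** * Weighted sums of jumps of the series *)

Section tonelli_lebesgue.
Context d (T : measurableType d) (R : realType).
Notation mu := (@lebesgue_measure R).

Variables (i : interval R) (f : T * measurableTypeR R -> \bar R).
Hypotheses (mf : measurable_fun setT f) (f0 : forall q, (0 <= f q)%E).

Let h (q : T * measurableTypeR R) : \bar R := if q.2 \in i then f q else 0%E.

Let h0 q : (0 <= h q)%E. Proof. by rewrite /h; case: ifP. Qed.

Let mh : measurable_fun setT h.
Proof.
have mi' : measurable_fun setT (fun s : measurableTypeR R => s \in i).
  apply: (@measurable_fun_bool _ _ _ _ true).
  by rewrite setTI (_ : _ @^-1` _ = [set` i]).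
apply: measurable_fun_ifT => //.
exact: (measurableT_comp mi' measurable_snd).
Qed.

Let hE z : (\int[mu]_s h (z, s) = \int[mu]_(s in [set` i]) f (z, s))%E.
Proof.
rewrite [RHS]integral_mkcond; apply: eq_integral => s _.
by rewrite patchE mem_setE.
Qed.

Lemma measurable_integral_itv :
  measurable_fun setT (fun z => \int[mu]_(s in [set` i]) f (z, s))%E.
Proof.
under eq_fun do rewrite -hE.
exact: (measurable_fun_fubini_tonelli_F (m2 := mu) h mh h0).
Qed.

Lemma tonelli_lebesgue (nu : {sigma_finite_measure set T -> \bar R}) :
  (\int[nu]_z \int[mu]_(s in [set` i]) f (z, s) =
   \int[mu]_(s in [set` i]) \int[nu]_z f (z, s))%E.
Proof.
transitivity (\int[nu]_z \int[mu]_s h (z, s))%E.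
  by apply: eq_integral => z _; exact/esym/hE.
rewrite (@fubini_tonelli _ _ _ _ _ nu mu h mh h0).
rewrite [RHS]integral_mkcond; apply: eq_integral => s _.
rewrite patchE mem_setE; case: ifP => si; first by apply: eq_integral => z _; rewrite /h/= si.
by apply: integral0_eq => z _; rewrite /h/= si.
Qed.

End tonelli_lebesgue.

Lemma measurable_expeR (R : realType) : measurable_fun setT (@expeR R).
Proof.
have mx (a : \bar R) : measurable_fun setT (fun x : \bar R => x == a).
  apply: (@measurable_fun_bool _ _ _ _ true).
  rewrite setTI (_ : _ @^-1` _ = [set a]); first exact: emeasurable_set1.
  by apply/seteqP; split => x /eqP.
rewrite (_ : @expeR R = fun x => if x == +oo%E then +oo%E else
    if x == -oo%E then 0%E else (expR (fine x))%:E).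
  apply: measurable_fun_ifT => //; apply: measurable_fun_ifT => //.
  by apply/measurable_EFinP; exact: measurableT_comp.
by apply/funext; case.
Qed.

Section weighted_jumps.
Context d (T : measurableType d) (R : realType) (P : probability T R).
Notation mu := (@lebesgue_measure R).
Notation LR := (measurableTypeR R).
Variables theta E : nat -> {RV P >-> R}.
Hypothesis theta_law : forall i (B : set R), measurable B ->
  distribution P (theta i) B = distribution P (theta 0%N) B.
Hypothesis E_law : forall i (B : set R), measurable B ->
  distribution P (E i) B = exponential_prob 1 B.
Hypothesis indep : mutually_independent P (fun j : nat + nat =>
  match j with inl i => theta i : T -> R | inr i => E i : T -> R end).
Variables (c : R -> R) (a0 : R).
Hypotheses (a0_gt0 : 0 < a0) (mc : measurable_fun setT c) (c_ge0 : forall z, 0 <= c z).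

Notation Pi := (distribution P (theta 0%N)).
Notation jump q := (tail_inv (levy_tail c a0 q.1) (Num.max q.2 0)).

(** The integral of v against the random series, on the almost sure event that no
    arrival time is negative. *)
Definition weighted_jumps (v : R -> R) (w : T) : \bar R :=
  (\sum_(i <oo) (v (theta i w) * jump (theta i w, arrival E i w))%:E)%E.

Definition laplace_exponent (v : R -> R) : \bar R :=
  (\int[mu]_(x in `]0%R, +oo[) \int[Pi]_z (1 - expR (- (v z * jump (z, x))))%:E)%E.

Lemma laplace_exponent_ge0 (v : R -> R) : (forall z, 0 <= v z) ->
  (0 <= laplace_exponent v)%E.
Proof.
move=> v0; apply: integral_ge0 => x _; apply: integral_ge0 => z _.
by rewrite lee_fin subr_ge0 expR_le1 oppr_le0 mulr_ge0// tail_inv_ge0.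
Qed.

Section one_weight.
Variable v : R -> R.
Hypotheses (mv : measurable_fun setT v) (v_ge0 : forall z, 0 <= v z).

Lemma weighted_jumps_ge0 w : (0 <= weighted_jumps v w)%E.
Proof.
by apply: nneseries_ge0 => i _ _; rewrite lee_fin mulr_ge0// tail_inv_ge0.
Qed.

Let mjump : measurable_fun setT (fun q : R * R => v q.1 * jump q).
Proof.
apply: measurable_funM; first exact: (measurableT_comp mv measurable_fst).
exact: (measurable_tail_inv a0_gt0 mc c_ge0).
Qed.

Lemma measurable_weighted_jumps : measurable_fun setT (weighted_jumps v).
Proof.
have marr i : measurable_fun setT (fun w => arrival E i w).
  by apply: measurable_sum => j; exact: measurable_funPT (E j).
apply: ge0_emeasurable_sum => //.
  by move=> i w _ _; rewrite lee_fin mulr_ge0// tail_inv_ge0.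
move=> i _; apply/measurable_EFinP.
apply: (measurableT_comp mjump (g := fun w => (theta i w, arrival E i w))).
by apply: measurable_fun_pair => //; exact: measurable_funPT (theta i).
Qed.

Let hit (q : R * LR) : \bar R := (1 - expR (- (v q.1 * jump (q.1, q.2 : R))))%:E.

Lemma measurable_hit : measurable_fun setT hit.
Proof.
apply/measurable_EFinP; apply: measurable_funB => //.
apply: (measurableT_comp (@measurable_expR R)); apply: measurable_funN.
apply: (measurableT_comp mjump (g := fun q : R * LR => (q.1, q.2 : R))).
by apply: measurable_fun_pair => //; exact: measurable_snd.
Qed.

Let mhit := measurable_hit.

Let hit_ge0 q : (0 <= hit q)%E.
Proof.
by rewrite lee_fin subr_ge0 expR_le1 oppr_le0 mulr_ge0// tail_inv_ge0.
Qed.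

Let swapE z : (\int[mu]_(x in `]0%R, +oo[)
     (1 - expR (- (v z * tail_inv (levy_tail c a0 z) x)))%:E =
  \int[mu]_(x in `]0%R, +oo[) hit (z, x))%E.
Proof.
apply: eq_integral => x.
by rewrite inE/= in_itv/= andbT => x0; rewrite /hit/= (max_idPl (ltW x0)).
Qed.

Let laplace_exponent_swap : laplace_exponent v =
  (\int[Pi]_z \int[mu]_(x in `]0%R, +oo[)
     (1 - expR (- (v z * tail_inv (levy_tail c a0 z) x)))%:E)%E.
Proof.
under eq_integral do rewrite swapE.
by rewrite (tonelli_lebesgue _ mhit hit_ge0).
Qed.

(** Campbell's change of variables for a fixed mark, between two applications of
    Tonelli. *)
Lemma laplace_exponentE : laplace_exponent v =
  (\int[mu]_(s in `]0%R, 1%R[) \int[Pi]_z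
     ((1 - expR (- (v z * s))) * (a0 * c z * levy_kernel (c z) s))%:E)%E.
Proof.
pose k (q : R * LR) : \bar R := ((1 - expR (- (v q.1 * Num.max q.2 0))) *
  (a0 * c q.1 * levy_kernel (c q.1) (Num.max q.2 0)))%:E.
have m1 : measurable_fun setT (fun q : R * LR => q.1) by exact: measurable_fst.
have m2 : measurable_fun setT (fun q : R * LR => Num.max (q.2 : R) 0).
  by apply: measurable_maxr => //; exact: measurable_snd.
have mc1 := measurableT_comp mc m1.
have mk : measurable_fun setT k.
  apply/measurable_EFinP; apply: measurable_funM.
    apply: measurable_funB => //; apply: (measurableT_comp (@measurable_expR R)).
    by apply: measurable_funN; apply: measurable_funM => //; exact: (measurableT_comp mv m1).
  apply: measurable_funM; first exact: measurable_funM.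
  apply: measurable_funM; first exact: (measurableT_comp (@measurable_invr R) m2).
  by apply: measurable_powR_fun; exact: measurable_funB.
have k0 q : (0 <= k q)%E.
  have s0 : 0 <= Num.max (q.2 : R) 0 by rewrite le_max lexx orbT.
  rewrite lee_fin mulr_ge0//.
    by rewrite subr_ge0 expR_le1 oppr_le0 mulr_ge0.
  by rewrite mulr_ge0 ?levy_kernel_ge0// mulr_ge0// ltW.
transitivity (\int[Pi]_z \int[mu]_(s in `]0%R, 1%R[) k (z, s))%E.
  rewrite laplace_exponent_swap; apply: eq_integral => z _.
  apply: (etrans (campbell_levy_tail a0_gt0 mc c_ge0 z (v_ge0 z))).
  apply: eq_integral => s.
  by rewrite inE/= in_itv/= => /andP[s0 _]; rewrite /k/= (max_idPl (ltW s0)).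
rewrite (tonelli_lebesgue _ mk k0).
apply: eq_integral => s.
rewrite inE/= in_itv/= => /andP[s0 _]; apply: eq_integral => z _.
by rewrite /k/= (max_idPl (ltW s0)).
Qed.

Lemma laplace_exponent_lty M : (forall z, v z <= M) -> (laplace_exponent v < +oo)%E.
Proof.
move=> vM; have M0 : 0 <= M by exact: le_trans (vM 0).
rewrite laplace_exponent_swap.
apply: (@le_lt_trans _ _ (\int[Pi]_z (M * a0)%:E)%E); last first.
  rewrite integral_cst//; rewrite [X in (_ * X)%E](_ : _ = 1%E) ?mule1 ?ltry//.
  exact: probability_setT.
apply: ge0_le_integral => //.
- move=> z _; apply: integral_ge0 => x _.
  by rewrite lee_fin subr_ge0 expR_le1 oppr_le0 mulr_ge0// tail_inv_ge0.
- rewrite (_ : (fun z => _) = (fun z => \int[mu]_(x in `]0%R, +oo[) hit (z, x))%E).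
    exact: (measurable_integral_itv _ mhit hit_ge0).
  exact/funext/swapE.
- move=> z _; apply: (le_trans (campbell_levy_tail_le a0_gt0 mc c_ge0 z (v_ge0 z))).
  by rewrite lee_fin ler_wpM2r// ltW.
Qed.

(** The marked Poisson formula for f (z, x) = v z * M_z ^ (-1) (x), with M_z the
    Levy tail. *)
Lemma laplace_weighted_jumps M : (forall z, v z <= M) ->
  (\int[P]_w expeR (- weighted_jumps v w) = expeR (- laplace_exponent v))%E.
Proof.
move=> vM.
apply: (laplace_marked_poisson theta_law E_law indep mjump).
- by move=> q; rewrite mulr_ge0// tail_inv_ge0.
- move=> z x; apply: (@cvgM R R (nbhs x) _ (fun=> v z) (fun x => jump (z, x))).
    exact: cvg_cst.
  exact: (continuous_levy_tail_inv a0_gt0 (c_ge0 z)).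
- exact: (laplace_exponent_lty vM).
Qed.

End one_weight.

(** Where one of two numbers a, b is 0,
    1 - exp (- (a + b)) = (1 - exp (- a)) + (1 - exp (- b)). This additivity is the
    analytic source of the independence of the masses of disjoint sets. *)
Lemma laplace_exponentD (v1 v2 : R -> R) :
  measurable_fun setT v1 -> measurable_fun setT v2 ->
  (forall z, 0 <= v1 z) -> (forall z, 0 <= v2 z) -> (forall z, v1 z * v2 z = 0) ->
  (laplace_exponent (fun z => (v1 z + v2 z)%R) =
   laplace_exponent v1 + laplace_exponent v2)%E.
Proof.
move=> m1 m2 p1 p2 v12.
have mhit (v : R -> R) : measurable_fun setT v ->
    measurable_fun setT (fun q : R * LR => (1 - expR (- (v q.1 * jump (q.1, q.2 : R))))%:E).
  by move=> mv; exact: measurable_hit.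
have hit0 (v : R -> R) z x : (forall z, 0 <= v z) -> (0 <= (1 - expR (- (v z * jump (z, x))))%:E)%E.
  by move=> p; rewrite lee_fin subr_ge0 expR_le1 oppr_le0 mulr_ge0// tail_inv_ge0.
have mG (v : R -> R) (D : set R) : measurable_fun setT v -> (forall z, 0 <= v z) ->
    measurable_fun D (fun x => \int[Pi]_z (1 - expR (- (v z * jump (z, x))))%:E)%E.
  move=> mv p; apply: measurable_funTS.
  have h : measurable_fun setT (fun x : LR =>
      \int[Pi]_z (1 - expR (- (v z * jump (z, x : R))))%:E)%E.
    apply: (measurable_fun_fubini_tonelli_G (m1 := Pi) (fun q : R * LR =>
      (1 - expR (- (v q.1 * jump (q.1, q.2 : R))))%:E)); first exact: mhit.
    by move=> q; exact: hit0.
  exact: h.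
have mF (v : R -> R) (x : R) : measurable_fun setT v ->
    measurable_fun setT (fun z => (1 - expR (- (v z * jump (z, x))))%:E)%E.
  move=> mv; apply: (measurableT_comp (mhit v mv) (g := fun z => (z, x : LR))).
  exact: measurable_fun_pair.
rewrite /laplace_exponent -ge0_integralD//; last 4 first.
- by move=> x _; apply: integral_ge0 => z _; exact: hit0.
- exact: mG.
- by move=> x _; apply: integral_ge0 => z _; exact: hit0.
- exact: mG.
apply: eq_integral => x _; rewrite -ge0_integralD//; last 4 first.
- by move=> z _; exact: hit0.
- exact: mF.
- by move=> z _; exact: hit0.
- exact: mF.
apply: eq_integral => z _; rewrite -EFinD; congr (_%:E).
have /eqP := v12 z; rewrite mulf_eq0 => /orP[/eqP ->|/eqP ->].
- by rewrite add0r mul0r oppr0 expR0 subrr add0r.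
- by rewrite addr0 mul0r oppr0 expR0 subrr addr0.
Qed.

Lemma weighted_jumpsD (v1 v2 : R -> R) w :
  (forall z, 0 <= v1 z) -> (forall z, 0 <= v2 z) ->
  (weighted_jumps (fun z => (v1 z + v2 z)%R) w =
   weighted_jumps v1 w + weighted_jumps v2 w)%E.
Proof.
move=> p1 p2; rewrite /weighted_jumps -nneseriesD//; last 2 first.
- by move=> i _ _; rewrite lee_fin mulr_ge0// tail_inv_ge0.
- by move=> i _ _; rewrite lee_fin mulr_ge0// tail_inv_ge0.
by apply: eq_eseriesr => i _; rewrite mulrDl EFinD.
Qed.

Lemma weighted_jumpsZ (k : R) (v : R -> R) w : (forall z, 0 <= v z) ->
  (weighted_jumps (fun z => (k * v z)%R) w = k%:E * weighted_jumps v w)%E.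
Proof.
move=> p; rewrite /weighted_jumps -nneseriesZl//; last first.
  by move=> i _; rewrite lee_fin mulr_ge0// tail_inv_ge0.
by apply: eq_eseriesr => i _; rewrite -mulrA EFinM.
Qed.

(** Joint moments of the variables exp (- A (B_k)) are Laplace transforms of the
    weighted sum with weight u_k on B_k; the exponent splits over k because the B_k
    are disjoint, so the moments factor. The masses themselves, possibly infinite,
    are measurable functions of these variables. *)
Lemma weighted_jumps_independent (B : nat -> set R) :
  (forall k, measurable (B k)) -> trivIset setT B ->
  mutually_independent P (fun k => weighted_jumps (\1_(B k))).
Proof.
move=> mB tB; pose W k := weighted_jumps (\1_(B k)).
pose V k w := fine (expeR (- W k w)).
have b0 k z : 0 <= \1_(B k) z :> R by rewrite indicE.
have mb k : measurable_fun setT (\1_(B k) : R -> R) by exact: measurable_indic.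
have W0 k w : (0 <= W k w)%E by exact: weighted_jumps_ge0.
have VE k w : (V k w)%:E = expeR (- W k w).
  by rewrite /V; have := W0 k w; case: (W k w) => // r _; rewrite /= expR0.
have V01 k w : 0 <= V k w <= 1.
  rewrite -!lee_fin VE expeR_ge0/= -expeR0 lee_expeR oppe_le0; exact: W0.
have mV k : measurable_fun setT (V k).
  rewrite (_ : V k = fine \o (fun w => expeR (- W k w))); last by [].
  apply: measurableT_comp => //.
  apply: (measurableT_comp (@measurable_expeR R)).
  apply: (measurableT_comp (@oppe_measurable R setT)).
  exact: measurable_weighted_jumps.
pose weight (u : nat -> nat) (s : seq nat) z : R := \sum_(k <- s) (u k)%:R * \1_(B k) z.
have ws0 u s z : 0 <= weight u s z by apply: sumr_ge0 => k _; rewrite mulr_ge0.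
have wu0 (u : nat -> nat) k z : 0 <= (u k)%:R * \1_(B k) z :> R by rewrite mulr_ge0.
have mwu (u : nat -> nat) k : measurable_fun setT (fun z => (u k)%:R * \1_(B k) z : R).
  exact: measurable_funM.
have mws u s : measurable_fun setT (weight u s).
  by apply: measurable_sum => k; exact: mwu.
have weight_cons u a s : weight u (a :: s) = (fun z => (u a)%:R * \1_(B a) z + weight u s z).
  by apply/funext => z; rewrite /weight big_cons.
have prodE u s w : (\prod_(k <- s) V k w ^+ u k)%:E = expeR (- weighted_jumps (weight u s) w).
  elim: s => [|a s IH].
    rewrite big_nil /weighted_jumps eseries0 ?oppe0 ?expeR0// => i _ _.
    by rewrite /weight big_nil mul0r.
  rewrite big_cons weight_cons weighted_jumpsD//.
  rewrite oppeD ?ge0_adde_def ?inE ?weighted_jumps_ge0// expeRD -IH EFinM.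
  congr (_ * _)%E; rewrite weighted_jumpsZ//.
  rewrite EFin_expe VE -/(W a w); have := W0 a w.
  case: (W a w) => [r| |]// _.
    by rewrite -EFinM -!EFinN/= -EFin_expe -expRM_natl mulrN.
  case: (u a) => [|n]; first by rewrite mul0e oppe0 expeR0 expe0.
  by rewrite expeS gt0_muley ?lte_fin//= mul0e.
have lapE u s : uniq s -> expeR (- laplace_exponent (weight u s)) =
    (\prod_(k <- s) expeR (- laplace_exponent (fun z => ((u k)%:R * \1_(B k) z)%R)))%E.
  elim: s => [_|a s IH].
    rewrite big_nil /laplace_exponent integral0_eq ?oppe0 ?expeR0// => x _.
    apply: integral0_eq => z _.
    by rewrite /weight big_nil mul0r oppr0 expR0 subrr.
  rewrite cons_uniq => /andP[as_ us].
  rewrite big_cons weight_cons laplace_exponentD//; last first.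
    move=> z; rewrite indicE; case: (boolP (z \in B a)) => [|_]; last by rewrite mulr0 mul0r.
    rewrite inE => Baz; rewrite /weight big_seq big1 ?mulr0// => k ks.
    rewrite indicE memNset ?mulr0// => Bkz.
    have ka : k = a by apply: (tB k a) => //; exists z.
    by move: as_; rewrite -ka ks.
  rewrite oppeD ?ge0_adde_def ?inE//.
    apply: (etrans (expeRD _ _)).
    exact: (congr1 (fun x => _ * x)%E (IH us)).
  - by apply: laplace_exponent_ge0.
  - exact: laplace_exponent_ge0.
have bound u s : exists M, forall z, weight u s z <= M.
  exists (\sum_(k <- s) (u k)%:R) => z; apply: ler_sum => k _.
  by rewrite ler_piMr// indicE; case: (_ \in _).
have momV (s : seq nat) (u : nat -> nat) : uniq s ->
  (\int[P]_w (\prod_(k <- s) V k w ^+ u k)%:E =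
   \prod_(k <- s) \int[P]_w (V k w ^+ u k)%:E)%E.
  move=> us; under eq_integral do rewrite prodE.
  have [M wM] := bound u s.
  rewrite (laplace_weighted_jumps (mws u s) (ws0 u s) wM) lapE//.
  apply: eq_bigr => k _.
  have [M' wM'] := bound u [:: k].
  have wE : weight u [:: k] = (fun z => (u k)%:R * \1_(B k) z).
    by apply/funext => z; rewrite /weight big_seq1.
  rewrite -wE -(laplace_weighted_jumps (mws u [:: k]) (ws0 u [:: k]) wM').
  by apply: eq_integral => w _; rewrite -prodE big_seq1.
(* The inverse of x |-> exp (- x) on [0, +oo]. *)
pose g (x : R) : \bar R := if x == 0 then +oo%E else (- ln x)%:E.
have mg : measurable_fun setT g.
  apply: measurable_fun_ifT => //; first exact: measurable_fun_eqr.
  by apply/measurable_EFinP; apply: measurable_funN; exact: measurable_ln.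
have gV k : g \o V k = W k.
  apply/funext => w; rewrite /g/= /V; have := W0 k w.
  case: (W k w) => [r| |]//= _; last by rewrite eqxx.
  by rewrite gt_eqF ?expR_gt0// expRK opprK.
have -> : (fun k => weighted_jumps (\1_(B k))) = (fun k => g \o V k).
  by apply/funext => k; rewrite gV.
apply: (mutually_independent_comp mg).
exact: (moments_independent mV V01 momV).
Qed.

End weighted_jumps.

(** * The series is a beta process *)

Section piecewise_continuous.
Context (R : realType) (c : R -> R).
Hypothesis hc : piecewise_continuous_halfline c.
Variable t0 : R.

Let Fin : set R := [set z | 0 < z <= t0 /\ ~ {for z, continuous c}] `|` [set 0; t0].

Let finF : finite_set Fin.
Proof.
by case: hc => h _ _; rewrite finite_setU; split; [exact: h|exact: finite_set2].
Qed.

(** On [0, t0], c is continuous on an open set with finite complement. *)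
Lemma measurable_piecewise_continuous :
  measurable_fun (`[0%R, t0]%classic : set R) c.
Proof.
have mfin (S : set R) : finite_set S -> measurable S.
  by move=> fS; apply: countable_measurable => //; exact: finite_set_countable.
have mU : measurable_fun (`]0%R, t0[%classic `\` Fin) c.
  apply: open_continuous_measurable_fun.
    rewrite setDE; apply: openI; first exact: interval_open.
    apply: closed_openC; apply: (proj1 accessible_finite_set_closed) finF; exact/hausdorff_accessible/Rhausdorff.
  move=> z; rewrite inE => -[/=]; rewrite in_itv/= => /andP[z0 zt] nF.
  apply: contrapT => ncont; apply: nF; left; split => //.
  by rewrite z0 ltW.
have mF : measurable_fun Fin c.
  by move=> _ Y mY; apply: mfin; exact: finite_setIl.
have mUF : measurable (`]0%R, t0[%classic `\` Fin).
  by apply: measurableD => //; exact: mfin.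
have := (measurable_funU c mUF (mfin _ finF)).2 (conj mU mF).
apply: measurable_funS.
  by apply: measurableU => //; exact: mfin.
move=> z /=; rewrite in_itv/= => /andP[z0 zt].
have [Fz|nFz] := pselect (Fin z); [by right|left; split => //].
rewrite in_itv/= !lt_neqAle z0 zt !andbT; apply/andP; split.
  by apply/eqP => zE; apply: nFz; right; left.
by apply/eqP => zE; apply: nFz; right; right.
Qed.

(** One-sided limits bound c near every point, and [0, t0] is compact. *)
Lemma piecewise_continuous_bounded :
  exists C, forall z, 0 <= z <= t0 -> c z <= C.
Proof.
case: hc => _ hr hl.
have lbd (F : set_system R) (FF : ProperFilter F) : cvg (c x @[x --> F]) ->
    exists M, \forall x \near F, c x <= M.
  move=> /cvg_ex[l cl]; exists (l + 1).
  by apply: (cvgr_le l cl); rewrite ltrDl.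
have /compact_near_coveringP : compact (`[0, t0]%classic : set R) by exact: segment_compact.
move=> /(_ R (pinfty_nbhs R) (fun C z => 0 <= z <= t0 -> c z <= C) _).
case.
  move=> z /=; rewrite in_itv/= => /andP[z0 zt].
  have [M1 h1] := lbd _ _ (hr z z0).
  have [M2 h2] : exists M, \forall x \near z^'-, 0 <= x -> c x <= M.
    move: z0; rewrite le_eqVlt => /predU1P[z0|z0].
      exists 0; rewrite -z0; near=> x => x0.
      have : x < 0 by near: x; exact: nbhs_left_lt.
      by rewrite ltNge x0.
    have [M h] := lbd _ _ (hl z z0).
    by exists M; apply: filterS h.
  pose M := Num.max (c z) (Num.max M1 M2).
  (* Only x >= 0 is claimed: nothing is known about c on the left of 0. *)
  have hM : \forall x \near z, 0 <= x -> c x <= M.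
    move: h1 h2; rewrite !near_withinE => h1 h2.
    near=> x => x0; rewrite !le_max.
    have [xz|xz|->] := ltgtP x z; last by rewrite lexx.
    - apply/orP; right; apply/orP; right; move: xz x0.
      by near: x.
    - apply/orP; right; apply/orP; left; move: xz.
      by near: x.
  exists ([set x | 0 <= x -> c x <= M], [set C | M <= C]).
    split; first exact: hM.
    exact: (nbhs_pinfty_ge (num_real M)).
  move=> [x C] /= [h MC] /andP[x0 _].
  exact: le_trans (h x0) MC.
move=> C [Creal h]; exists (C + 1) => z zt.
by apply: (h (C + 1)) => //; rewrite ?ltrDl//= in_itv.
Unshelve. all: by end_near.
Qed.

End piecewise_continuous.

Section ae_independence.
Context d (T : measurableType d) (R : realType) (P : probability T R).

Lemma ae_eq_measure (S S' : set T) : measurable S -> measurable S' ->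
  {ae P, forall w, S w <-> S' w} -> P S = P S'.
Proof.
move=> mS mS' SS'.
rewrite -[S]setIT -[S']setIT -!integral_indic//.
apply: ae_eq_integral => //.
- exact/measurable_EFinP/measurable_indic.
- exact/measurable_EFinP/measurable_indic.
apply: filterS SS' => w h _; congr (_%:E); rewrite !indicE.
by congr (nat_of_bool _)%:R; apply/idP/idP; rewrite !inE => /h.
Qed.

(** The masses and the weighted sums of jumps only agree almost surely, because of
    negative arrival times. *)
Lemma ae_eq_mutually_independent d' (T' : measurableType d')
    (X Y : nat -> T -> T') :
  (forall i, measurable_fun setT (X i)) -> (forall i, measurable_fun setT (Y i)) ->
  (forall i, {ae P, forall w, X i w = Y i w}) ->
  mutually_independent P X -> mutually_independent P Y.
Proof.
move=> mX mY XY iX J C mC.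
have mp (Z : nat -> T -> T') i : (forall i, measurable_fun setT (Z i)) ->
    measurable (Z i @^-1` C i).
  by move=> mZ; rewrite -[X in measurable X]setTI; exact: mZ.
have e i : P (Y i @^-1` C i) = P (X i @^-1` C i).
  apply: ae_eq_measure; [exact: mp|exact: mp|].
  by apply: filterS (XY i) => w /= ->.
under eq_bigr do rewrite e.
rewrite -iX//; apply: ae_eq_measure.
- by apply: fin_bigcap_measurable => // i _; exact: mp.
- by apply: fin_bigcap_measurable => // i _; exact: mp.
apply: filterS (ae_foralln XY) => w h.
by split => k i iJ /=; [rewrite h|rewrite -h]; exact: k.
Qed.

End ae_independence.

Lemma beta_seriesE d (T : measurableType d) (R : realType) (c : R -> R) (a0 : R)
    (theta E : nat -> T -> R) (w : T) (B : set R) :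
  beta_series c a0 theta E w B =
  (\sum_(i <oo) (\1_B (theta i w) *
     tail_inv (levy_tail c a0 (theta i w)) (arrival E i w))%:E)%E.
Proof.
rewrite /beta_series /= /mseries; apply: eq_eseriesr => i _.
by rewrite /= /mscale/= diracE indicE -EFinM mulrC.
Qed.

Section beta_process_series.
Context d (T : measurableType d) (R : realType) (P : probability T R).
Notation mu := (@lebesgue_measure R).
Variables (c : R -> R) (a0 t0 : R) (eta : {measure set R -> \bar R}).
Variables theta E : nat -> {RV P >-> R}.
Hypothesis a0_gt0 : 0 < a0.
Hypothesis hc : piecewise_continuous_halfline c.
Hypothesis c_ge0 : forall z, 0 <= z -> 0 <= c z.
Hypothesis theta_law : forall i (B : set R), measurable B ->
  distribution P (theta i) B = ((a0^-1)%:E * eta (B `&` `[0%R, t0]))%E.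
Hypothesis E_law : forall i (B : set R), measurable B ->
  distribution P (E i) B = exponential_prob 1 B.
Hypothesis indep : mutually_independent P (fun j : nat + nat =>
  match j with inl i => theta i : T -> R | inr i => E i : T -> R end).

Notation Pi := (distribution P (theta 0%N)).

(** The marks lie in [0, t0]; outside, c may fail to be measurable or nonnegative,
    and 0 is a safe value. *)
Let ct (z : R) : R := if z \in `[0, t0] then c z else 0.

Let mct : measurable_fun setT ct.
Proof.
have := (measurable_restrictT c (measurable_itv `[0%R, t0])).1
  (measurable_piecewise_continuous hc (t0 := t0)).
rewrite (_ : _ \_ _ = ct)//; apply/funext => z.
by rewrite /ct patchE mem_setE.
Qed.

Let ct_ge0 z : 0 <= ct z.
Proof.
rewrite /ct; case: ifPn => //; rewrite in_itv/= => /andP[z0 _]; exact: c_ge0.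
Qed.

Let same_law i (B : set R) : measurable B -> distribution P (theta i) B = Pi B.
Proof. by move=> mB; rewrite !theta_law. Qed.

Let tail_inv_ct z p : z \in `[0, t0] ->
  tail_inv (levy_tail ct a0 z) p = tail_inv (levy_tail c a0 z) p.
Proof.
move=> zt; have -> // : levy_tail ct a0 z = levy_tail c a0 z.
by apply/funext => x; rewrite /levy_tail /ct zt.
Qed.

Lemma ae_theta_itv : {ae P, forall w i, 0 <= theta i w <= t0}.
Proof.
apply: ae_foralln => i.
have mA : measurable (~` `[0%R, t0]%classic : set R) by exact: measurableC.
exists (theta i @^-1` (~` `[0%R, t0])); split.
- by rewrite -[_ @^-1` _]setTI; exact: (measurable_funPT (theta i)).
- rewrite -[LHS]/(distribution P (theta i) _) theta_law// setICl measure0.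
  by rewrite mule0.
- by move=> w /= h; rewrite in_itv/=.
Qed.

Let ae_seriesE (B : set R) : B `<=` `[0%R, t0] ->
  {ae P, forall w, weighted_jumps theta E ct a0 (\1_B) w = beta_series c a0 theta E w B}.
Proof.
move=> Bt; apply: filterS (ae_partial_time_ge0 E_law) => w Ew.
rewrite beta_seriesE; apply: eq_eseriesr => i _; congr (_%:E).
rewrite indicE; case: (boolP (_ \in B)) => [|_]; last by rewrite !mul0r.
rewrite inE => /Bt tB; rewrite /= tail_inv_ct//; congr (_ * tail_inv _ _).
exact/max_idPl/(Ew i.+1).
Qed.

Lemma measurable_beta_series (B : set R) : measurable B -> B `<=` `[0%R, t0] ->
  measurable_fun setT (fun w => beta_series c a0 theta E w B).
Proof.
move=> mB Bt; under eq_fun do rewrite beta_seriesE.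
apply: ge0_emeasurable_sum => //.
  by move=> i w _ _; rewrite lee_fin mulr_ge0// ?tail_inv_ge0// indicE.
move=> i _; apply/measurable_EFinP.
have mth := measurable_funPT (theta i).
have marr : measurable_fun setT (fun w => arrival E i w).
  by apply: measurable_sum => j; exact: measurable_funPT (E j).
have mb : measurable_fun setT (\1_B : R -> R) by exact: measurable_indic.
(* At a negative level no x qualifies, and the infimum of the empty set is 0;
   taking the maximum with 0 there would give the value at level 0. *)
rewrite (_ : (fun w => _) = fun w => if arrival E i w < 0 then 0 else
    \1_B (theta i w) * tail_inv (levy_tail ct a0 (theta i w)) (Num.max (arrival E i w) 0)).
  apply: measurable_fun_ifT => //; first exact: measurable_fun_ltr.
  apply: measurable_funM; first exact: (measurableT_comp mb mth).
  apply: (measurableT_comp (measurable_tail_inv a0_gt0 mct ct_ge0)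
     (g := fun w => (theta i w, arrival E i w))).
  exact: measurable_fun_pair.
apply/funext => w; rewrite indicE; case: (boolP (_ \in B)) => [|_]; last first.
  by rewrite !mul0r; case: ifP.
rewrite inE => /Bt tB; rewrite !mul1r tail_inv_ct//.
case: ifPn => [neg|]; last by rewrite -leNgt => pos; rewrite (max_idPl pos).
rewrite /tail_inv (_ : [set _ | _] = set0) ?inf0//.
apply/seteqP; split => x //= [/andP[x0 _]].
rewrite leNgt => /negP; apply.
apply: (@lt_le_trans _ _ 0%E); first by rewrite lte_fin.
apply: levy_tail_ge0 => //.
by apply: c_ge0; move: tB; rewrite /= in_itv/= => /andP[].
Qed.

(** Tonelli needs a sigma-finite measure, which the mark law is and eta need not
    be: exchanges of integrals are done with the mark law, and translated here. *)
Lemma integral_law (t : R) (f : R -> \bar R) : 0 <= t <= t0 ->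
  measurable_fun setT f -> (forall z, (0 <= f z)%E) ->
  (\int[Pi]_(z in `[0%R, t]) f z = (a0^-1)%:E * \int[eta]_(z in `[0%R, t]) f z)%E.
Proof.
move=> /andP[_ tt] mf f0.
have k0 : 0 <= a0^-1 by rewrite invr_ge0 ltW.
rewrite (eq_measure_integral (mscale (NngNum k0) eta)); last first.
  move=> A mA AD; apply: (etrans (theta_law 0%N mA)).
  rewrite /mscale/= setIidl//.
  by move=> z /AD /=; rewrite !in_itv/= => /andP[-> /= /le_trans]; apply.
rewrite ge0_integral_mscale//; exact: measurable_funTS.
Qed.

Lemma laplace_exponent_levy (t u : R) : 0 <= t <= t0 -> 0 <= u ->
  laplace_exponent theta ct a0 (fun z => u * \1_(`[0%R, t]%classic) z) =
  (\int[mu]_(s in `]0%R, 1%R[) ((1 - expR (- (u * s)))%:E * levy_density c eta t s))%E.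
Proof.
move=> tt u0; have /andP[t0' tt'] := tt.
have mv : measurable_fun setT (fun z => u * \1_(`[0%R, t]%classic) z : R).
  by apply: measurable_funM => //; exact: measurable_indic.
have v0 z : 0 <= u * \1_(`[0%R, t]%classic) z :> R by rewrite mulr_ge0// indicE.
rewrite (laplace_exponentE theta a0_gt0 mct ct_ge0 mv v0).
apply: eq_integral => s; rewrite inE/= in_itv/= => /andP[s0 s1].
have mk : measurable_fun setT (fun z => (ct z * levy_kernel (ct z) s)%:E).
  apply/measurable_EFinP; apply: measurable_funM => //; rewrite /levy_kernel.
  apply: measurable_funM => //.
  by apply: measurable_powR_fun => //; exact: measurable_funB.
have kk z : (0 <= (ct z * levy_kernel (ct z) s)%:E)%E.
  by rewrite lee_fin mulr_ge0// levy_kernel_ge0// ltW.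
have e0 : (0 <= 1 - expR (- (u * s)))%R.
  by rewrite subr_ge0 expR_le1 oppr_le0 mulr_ge0// ltW.
transitivity (\int[Pi]_(z in `[0%R, t])
   (((1 - expR (- (u * s))) * a0)%:E * (ct z * levy_kernel (ct z) s)%:E))%E.
  rewrite [RHS]integral_mkcond; apply: eq_integral => z _.
  rewrite patchE indicE; case: (z \in _); last first.
    by rewrite mulr0 mul0r oppr0 expR0 subrr mul0r.
  by rewrite mulr1 -EFinM !mulrA.
rewrite ge0_integralZl//; last 2 first.
- exact: measurable_funTS.
- by rewrite lee_fin mulr_ge0// ltW.
rewrite integral_law// muleA -EFinM -mulrA divff ?gt_eqF// mulr1.
congr (_ * _)%E; rewrite /levy_density; apply: eq_integral => z.
rewrite inE/= in_itv/= => /andP[z0 zt]; congr (_%:E).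
have -> : ct z = c z by rewrite /ct in_itv/= z0 (le_trans zt).
by rewrite /levy_kernel mulrA.
Qed.

(** On the almost sure event that arrival times are nonnegative and marks lie in
    [0, t0], the mass of B is the weighted sum of jumps for the indicator of B.
    Independence is then [weighted_jumps_independent], and the Laplace transform is
    [laplace_weighted_jumps] with the exponent rewritten by [laplace_exponent_levy]. *)
Theorem beta_process_beta_series : beta_process P c eta t0 (beta_series c a0 theta E).
Proof.
split.
- exact: measurable_beta_series.
- apply: filterS ae_theta_itv => w th; rewrite beta_seriesE.
  apply: eseries0 => i _ _; rewrite indicE memNset ?mul0r//= in_itv/=.
  by move=> h; apply: h; exact: th.
- move=> B mB Bt tB.
  apply: (@ae_eq_mutually_independent _ _ _ _ _ _
    (fun k w => weighted_jumps theta E ct a0 (\1_(B k)) w)).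
  + move=> k; apply: (measurable_weighted_jumps theta E a0_gt0 mct ct_ge0).
      exact: measurable_indic.
    by move=> z; rewrite indicE.
  + by move=> k; exact: measurable_beta_series.
  + by move=> k; exact: ae_seriesE.
  + exact: (weighted_jumps_independent same_law E_law indep a0_gt0 mct ct_ge0 mB tB).
- move=> t u tt u0; have /andP[t0' tt'] := tt.
  rewrite -laplace_exponent_levy//.
  have mv : measurable_fun setT (fun z => u * \1_(`[0%R, t]%classic) z : R).
    by apply: measurable_funM => //; exact: measurable_indic.
  have v0 z : 0 <= u * \1_(`[0%R, t]%classic) z :> R by rewrite mulr_ge0// indicE.
  have vu z : u * \1_(`[0%R, t]%classic) z <= u.
    by rewrite ler_piMr// indicE; case: (_ \in _).
  rewrite -(laplace_weighted_jumps same_law E_law indep a0_gt0 mct ct_ge0 mv v0 vu).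
  have Bt : `[0%R, t]%classic `<=` `[0%R, t0].
    by move=> z /=; rewrite !in_itv/= => /andP[-> /= /le_trans]; apply.
  apply: ae_eq_integral => //.
  + apply: (measurableT_comp (@measurable_expeR R)).
    apply: (measurableT_comp (@oppe_measurable R setT)); apply: measurable_funeM.
    apply: measurable_beta_series => //; exact: Bt.
  + apply: (measurableT_comp (@measurable_expeR R)).
    apply: (measurableT_comp (@oppe_measurable R setT)).
    exact: (measurable_weighted_jumps theta E a0_gt0 mct ct_ge0).
  apply: filterS (ae_seriesE Bt) => w wE _; congr (expeR (- _))%E.
  rewrite -wE weighted_jumpsZ// => z; by rewrite indicE.
Qed.

End beta_process_series.

(** * Vague convergence *)

Section tannery.
Context (R : realType).

(** Dominated convergence for the counting measure; the upper end of the sum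
    grows with n, so the terms are extended by 0. *)
Lemma tannery (a : nat -> nat -> R) (b D : nat -> R) :
  (forall i, a n i @[n --> \oo] --> b i) ->
  (\forall n \near \oo, forall i, 0 <= a n i <= D i) ->
  (\sum_(i <oo) (D i)%:E < +oo)%E ->
  (\sum_(i < n) (a n i)%:E)%E @[n --> \oo] --> (\sum_(i <oo) (b i)%:E)%E.
Proof.
move=> ab [N _ aD] Dfin.
have b0 i : 0 <= b i.
  apply: (cvgr_to_ge (ab i)); exists N => // n Nn.
  by have /andP[] := aD n Nn i.
have D0 i : 0 <= D i by have /andP[/le_trans h /h] := aD N (leqnn N) i.
pose f n i : \bar R := if (i < n + N)%N then (a (n + N)%N i)%:E else 0%E.
have f0 n i : (0 <= f n i)%E.
  by rewrite /f; case: ifP => // _; rewrite lee_fin; case/andP: (aD (n + N)%N (leq_addl _ _) i).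
have fE n : (\sum_(i <oo) f n i = \sum_(i < n + N) (a (n + N)%N i)%:E)%E.
  rewrite (nneseries_split 0 (n + N)) // add0n [X in (_ + X)%E]eseries0 ?adde0; last first.
    by move=> i ni _; rewrite /f ltnNge ni.
  by rewrite big_mkord; apply: eq_bigr => i _; rewrite /f ltn_ord.
have h := @dominated_cvg _ _ R (@counting nat R) setT measurableT f
  (fun i => (b i)%:E) (fun i => (D i)%:E).
have fI : (fun n => \int[counting]_i f n i)%E =
    (fun n => (\sum_(i < n + N) (a (n + N)%N i)%:E)%E).
  by apply/funext => n; rewrite ge0_integral_count.
rewrite fI ge0_integral_count// in h.
rewrite -(cvg_shiftn N); apply: h => //.
- move=> i _.
  apply: (@cvg_trans _ ((a (n + N)%N i)%:E @[n --> \oo])).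
    apply: near_eq_cvg; near=> n; rewrite /f ifT//.
    by apply: (@leq_trans n); [near: n; exists i.+1|exact: leq_addr].
  apply: cvg_EFin; first by near=> n.
  by have := ab i; rewrite -(cvg_shiftn N).
- apply/integrableP; split => //.
  by under eq_integral do rewrite gee0_abs ?lee_fin//; rewrite ge0_integral_count.
- move=> n i _; rewrite gee0_abs// /f; case: ifP => _; last by rewrite lee_fin.
  by rewrite lee_fin; case/andP: (aD (n + N)%N (leq_addl _ _) i).
Unshelve. all: by end_near.
Qed.

(** Comparison with the telescoping sum of 2 (1 / m - 1 / (m + 1)). *)
Lemma nneseries_inv_sqr_lty (K l : R) (gamma : nat -> R) : 0 < l ->
  (\forall n \near \oo, l * n.+1%:R <= gamma n) ->
  (\sum_(i <oo) ((K / gamma i) ^+ 2)%:E < +oo)%E.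
Proof.
move=> l0 [N _ gl].
rewrite (nneseries_split 0 N); last by move=> k _; rewrite lee_fin sqr_ge0.
rewrite add0n lte_add_pinfty//.
  by rewrite sumEFin ltry.
pose M := (K / l) ^+ 2 * 2.
have M0 : 0 <= M by rewrite mulr_ge0// sqr_ge0.
have partial m : \sum_(N <= i < m) (K / gamma i) ^+ 2 <= M * (1 - m.+1%:R^-1).
  elim: m => [|m IH].
    by rewrite big_geq// invr1 subrr mulr0.
  have [Nm|Nm] := leqP N m; last first.
    by rewrite big_geq// mulr_ge0// subr_ge0 invf_le1// ler1n.
  rewrite big_nat_recr//=; apply: le_trans (lerD IH _) _; first exact: lexx.
  have gm := gl m Nm.
  have lm : 0 < l * m.+1%:R by rewrite mulr_gt0.
  have g0 : 0 < gamma m by exact: lt_le_trans gm.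
  apply: (@le_trans _ _ (M * (1 - m.+1%:R^-1) + (K / l) ^+ 2 * (m.+1%:R ^+ 2)^-1)).
    rewrite lerD2l -exprVn -exprMn -!mulrA !exprMn ler_wpM2l ?sqr_ge0//.
    rewrite -exprMn -invfM lerXn2r ?nnegrE ?invr_ge0 ?(ltW g0) ?(ltW lm)//.
    by rewrite lef_pV2.
  have key : (m.+1%:R ^+ 2)^-1 <= 2 * (m.+1%:R^-1 - m.+2%:R^-1) :> R.
    have x0 : 0 < (m.+1%:R : R) by rewrite ltr0n.
    rewrite -(natr1 m.+1); set x : R := m.+1%:R in x0 *.
    rewrite (_ : 2 * _ = 2 / (x * (x + 1))); last first.
      by field; rewrite !gt_eqF// addr_gt0.
    rewrite ler_pdivlMr ?mulr_gt0 ?addr_gt0// expr2 mulrC ler_pdivrMr ?mulr_gt0//.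
    have x1 : 1 <= x by rewrite ler1n.
    nra.
  apply: le_trans (lerD (lexx _) (ler_wpM2l (sqr_ge0 (K / l)) key)) _.
  by rewrite le_eqVlt /M; apply/orP; left; apply/eqP; ring.
apply: (@le_lt_trans _ _ M%:E); last exact: ltry.
apply: lime_le; first by apply: is_cvg_nneseries => i _ _; rewrite lee_fin sqr_ge0.
near=> m; rewrite sumEFin lee_fin; apply: le_trans (partial m) _.
by rewrite ler_piMr// lerBlDr lerDl invr_ge0.
Unshelve. all: by end_near.
Qed.

End tannery.

Section vague_convergence.
Context d (T : measurableType d) (R : realType).
Variables (c : R -> R) (a0 t0 C : R) (theta E : nat -> T -> R) (w : T).
Hypothesis a0_gt0 : 0 < a0.
Hypothesis c_ge0 : forall z, 0 <= z -> 0 <= c z.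
Hypothesis c_le : forall z, 0 <= z <= t0 -> c z <= C.
Hypothesis theta_itv : forall i, 0 <= theta i w <= t0.
Hypothesis arrival_gt0 : forall i, 0 < arrival E i w.
Variable l : R.
Hypothesis l_gt0 : 0 < l.
Hypothesis arrival_growth : \forall n \near \oo, l * n.+1%:R <= arrival E n w.

Lemma dist_fun_finite_beta_sum n t :
  dist_fun (finite_beta_sum c a0 theta E n w) t =
  (\sum_(i < n) (\1_(`]-oo, t]%classic) (theta i w) *
    tail_inv (beta_tail c n (theta i w)) (arrival E i w / (a0 * n%:R)))%:E)%E.
Proof.
rewrite /dist_fun /finite_beta_sum /= /msum; apply: eq_bigr => i _.
by rewrite /= /mscale/= diracE indicE -EFinM mulrC.
Qed.

Let c_itv i : 0 <= c (theta i w) <= C.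
Proof. by have /andP[z0 zt] := theta_itv i; rewrite c_ge0// c_le ?z0. Qed.

Let C_ge0 : 0 <= C. Proof. by have /andP[/le_trans] := c_itv 0; apply. Qed.

(** Everything is deterministic once the sample point has linearly growing arrival
    times and marks in [0, t0]. The distribution functions converge at every t, not
    only at continuity points. *)
Lemma vague_cvg_beta : vague_cvg (fun n => finite_beta_sum c a0 theta E n w)
  (beta_series c a0 theta E w).
Proof.
have [K K0 tailK] := beta_tail_inv_le c a0_gt0 C_ge0.
pose D i := (K / arrival E i w) ^+ 2.
have Dfin : (\sum_(i <oo) (D i)%:E < +oo)%E by exact: nneseries_inv_sqr_lty arrival_growth.
have ind01 t i : 0 <= (\1_(`]-oo, t]%classic) (theta i w) : R) <= 1.
  by rewrite indicE; case: (_ \in _); rewrite ?ler01 ?lexx.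
have term_cvg t i : \1_(`]-oo, t]%classic) (theta i w) *
      tail_inv (beta_tail c n (theta i w)) (arrival E i w / (a0 * n%:R)) @[n --> \oo] -->
    \1_(`]-oo, t]%classic) (theta i w) * tail_inv (levy_tail c a0 (theta i w)) (arrival E i w).
  apply: cvgMr; apply: cvg_beta_tail_inv => //; last exact: ltW.
  by case/andP: (c_itv i).
have term_le t : \forall n \near \oo, forall i, 0 <= \1_(`]-oo, t]%classic) (theta i w) *
      tail_inv (beta_tail c n (theta i w)) (arrival E i w / (a0 * n%:R)) <= D i.
  exists 2%N => // n n2 i; have /andP[i0 i1] := ind01 t i.
  rewrite mulr_ge0 ?tail_inv_ge0//=.
  apply: le_trans (tailK (theta i w) (arrival E i w) n (c_itv i) (arrival_gt0 i) n2).
  by rewrite ler_piMl// tail_inv_ge0.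
have before0 t i : t < 0 -> \1_(`]-oo, t]%classic) (theta i w) = 0 :> R.
  move=> t0'; rewrite indicE memNset//= in_itv/=; apply/negP; rewrite -ltNge.
  by apply: lt_le_trans t0' _; case/andP: (theta_itv i).
have cvgD t : dist_fun (finite_beta_sum c a0 theta E n w) t @[n --> \oo] -->
    dist_fun (beta_series c a0 theta E w) t.
  rewrite (_ : (fun n => _) = (fun n => \sum_(i < n) (\1_(`]-oo, t]%classic) (theta i w) *
      tail_inv (beta_tail c n (theta i w)) (arrival E i w / (a0 * n%:R)))%:E)%E); last first.
    by apply/funext => n; exact: dist_fun_finite_beta_sum.
  by rewrite /dist_fun beta_seriesE; exact: tannery (term_cvg t) (term_le t) Dfin.
split.
- move=> n; split.
    by move=> t; rewrite dist_fun_finite_beta_sum sumEFin ltry.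
  apply: cvg_near_cst; near=> t; rewrite dist_fun_finite_beta_sum big1// => i _.
  rewrite before0 ?mul0r//; near: t; exact: nbhs_ninfty_lt.
- split.
    move=> t; apply: le_lt_trans Dfin; rewrite /dist_fun beta_seriesE.
    apply: lee_nneseries => i _.
      by have /andP[i0 i1] := ind01 t i; rewrite lee_fin mulr_ge0 ?tail_inv_ge0.
    rewrite lee_fin; apply: (cvgr_to_le (term_cvg t i)).
    by apply: filterS (term_le t) => n /(_ i)/andP[].
  apply: cvg_near_cst; near=> t; rewrite /dist_fun beta_seriesE eseries0// => i _ _.
  rewrite before0 ?mul0r//; near: t; exact: nbhs_ninfty_lt.
- by move=> t _; exact: cvgD.
Unshelve. all: by end_near.
Qed.

End vague_convergence.

(** * The limit theorem *)

Theorem theorem8 (R : realType) (d : measure_display) (T : measurableType d)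
  (P : probability T R) (A0 : R -> \bar R) (c : R -> R) (t0 : R)
  (eta : {measure set R -> \bar R}) (theta E : nat -> {RV P >-> R})
  (hA0 : continuous_cumulative_hazard A0)
  (hc : piecewise_continuous_halfline c)
  (hc0 : forall z, 0 <= z -> 0 <= c z)
  (ht0 : 0 < t0) (hA0t0 : (A0 t0 < +oo)%E)
  (heta : forall t, 0 <= t -> eta `[0, t]%classic = A0 t)
  (htheta : forall i (B : set R), measurable B ->
     distribution P (theta i) B =
     (((fine (A0 t0))^-1)%:E * eta (B `&` `[0%R, t0]))%E)
  (hE : forall i (B : set R), measurable B ->
     distribution P (E i) B = exponential_prob 1 B)
  (hindep : mutually_independent P (fun j : nat + nat =>
     match j with inl i => theta i : T -> R | inr i => E i : T -> R end)) :
  let a0 := fine (A0 t0) in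
  let A := beta_series c a0 theta E in
  beta_process P c eta t0 A /\
  {ae P, forall w, vague_cvg (fun n => finite_beta_sum c a0 theta E n w) (A w)}.
Proof.
move=> a0 A.
have A0fin : A0 t0 \is a fin_num.
  by rewrite ge0_fin_numE// -heta// ltW.
have a0E : A0 t0 = a0%:E by rewrite /a0 fineK.
have a0_gt0 : 0 < a0.
  rewrite lt0r; apply/andP; split; last first.
    by rewrite -lee_fin -a0E -heta// ltW.
  (* Otherwise the inverse of a0 is 0 too, and the law of the marks has mass 0. *)
  apply/eqP => a00.
  have := htheta 0%N setT measurableT.
  rewrite setTI -/a0 a00 invr0 mul0e.
  have -> : distribution P (theta 0%N) setT = 1%E by exact: probability_setT.
  by case => /eqP; rewrite oner_eq0.
have growth := ae_partial_time_growth hE hindep.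
have [C cC] := piecewise_continuous_bounded hc t0.
split.
  exact: (beta_process_beta_series a0_gt0 hc hc0 htheta hE hindep).
apply: filterS3 (ae_theta_itv htheta) (ae_exponential_gt0 hE) growth.
move=> w th Ew [l l0 gl].
apply: (vague_cvg_beta a0_gt0 hc0 cC th _ l0).
  move=> i; rewrite /arrival big_ord_recl ltr_pwDl//.
  by apply: sumr_ge0 => j _; exact: ltW.
case: gl => N _ gl; exists N => // n Nn.
by apply: (gl n.+1); exact: leqW.
Qed.
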